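(* Let $n\ge2$, let $\kappa$ be a dominant weight of $\mathfrak{sl}(n)_{\mathrm{aff}}$ of level $\ell\ge1$ and let $\mu$ be a weight with $\mu\le\kappa$ (i.e. $\kappa-\mu=\sum_iv_i\alpha_i$, $v_i\in\mathbb Z_{\ge0}$). The $T$-fixed point set $\mathcal M^{\mathrm s}(\kappa,\mu)^T$ is a single point if $\kappa=\mu^+$, the dominant weight in the Weyl group orbit of $\mu$. It is empty otherwise.
   Context: **Bow varieties.** A bow diagram is an anticlockwise oriented circle with $n\ge2$ points marked $\times$, labelled $x_0,\dots,x_{n-1}$ in anticlockwise order, $\ell\ge 1$ points marked $\circ$ (each called $h$), and an integer $R(\zeta)\ge0$ for every segment $\zeta$ between consecutive marked points. For a marked point $p$, $o(p)$ and $i(p)$ are the segments just before and just after $p$ anticlockwise. Let $V_\zeta$ be a complex vector space of dimension $R(\zeta)$. Consider linear maps $B_\zeta\in\operatorname{End}V_\zeta$; $A_x\colon V_{o(x)}\to V_{i(x)}$, $a_x\colon\mathbb C\to V_{i(x)}$, $b_x\colon V_{o(x)}\to\mathbb C$ for each $\times$; $C_h\colon V_{o(h)}\to V_{i(h)}$, $D_h\colon V_{i(h)}\to V_{o(h)}$ for each $\circ$, with: $B_{i(x)}A_x-A_xB_{o(x)}+a_xb_x=0$; (S1) no nonzero $S\subset V_{o(x)}$ with $B_{o(x)}S\subset S$, $A_xS=0=b_xS$; (S2) no proper $T\subset V_{i(x)}$ with $B_{i(x)}T\subset T$, $\operatorname{Im}A_x+\operatorname{Im}a_x\subset T$; $C_hD_h+B_{i(h)}=0$,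 $D_hC_h+B_{o(h)}=0$. Such data are stable if every graded $S\subset\bigoplus V_\zeta$ invariant under $A,B,C,D$ with $b(S)=0$ and $A_x\colon S_{o(x)}\cong S_{i(x)}$ for all $x$ is $0$, and every invariant graded $T\supset\operatorname{Im}a$ with $A_x$ inducing isomorphisms $V_{o(x)}/T_{o(x)}\cong V_{i(x)}/T_{i(x)}$ for all $x$ is everything. $\mathcal M^{\mathrm s}$ is the quotient of the set of stable data by $\prod_\zeta GL(V_\zeta)$. **$\mathcal M^{\mathrm s}(\kappa,\mu)$.** $\Lambda_i,\alpha_i$ are fundamental weights and simple roots of $\mathfrak{sl}(n)_{\mathrm{aff}}$, $\delta=\sum_i\alpha_i$. Write $\kappa=\sum_iw_i\Lambda_i+c\delta$ ($w_i\ge0$, $\ell=\sum w_i$). $\mathcal M^{\mathrm s}(\kappa,\mu)$ is the quotient $\mathcal M^{\mathrm s}$ of the set of stable data by $\prod_\zeta GL(V_\zeta)$ for the bow diagram with $w_i$ points $\circ$ on the arc from $x_i$ to $x_{i+1}$ (indices mod $n$) and $R(\zeta)=v_i$ for all segments on this arc. **Torus.** $T=(\mathbb C^\times)^n\ni(s_0,\dots,s_{n-1})$ acts by $(a_{x_j},b_{x_j})\mapsto((s_0\cdots s_{j-1})^{-1}a_{x_j},\,s_0\cdots s_{j-1}b_{x_j})$ for $1\le j\le n-1$ and $(A_{x_0},b_{x_0})\mapsto s_0\cdots s_{n-1}(A_{x_0},b_{x_0})$, other maps fixed. *)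

(* Defs.v *)
From HB Require Import structures.
From mathcomp Require Import all_boot all_order all_algebra.
From mathcomp Require Import boolp classical_sets reals.
From mathcomp Require Export complex.

Set Implicit Arguments.
Unset Strict Implicit.
Unset Printing Implicit Defensive.

Import GRing.Theory.
Local Open Scope classical_set_scope.
Local Open Scope ring_scope.

(** * Bow diagrams

  A bow diagram with [n] points x_0, ..., x_(n-1) is encoded by the number
  [w i] of o-points on the arc from x_i to x_(i+1), indices modulo n, together
  with the dimensions of the segments.  The o-points cut that arc into
  [(w i).+1] segments; both are numbered anticlockwise along the arc. *)

Definition segment n (w : 'I_n -> nat) := {i : 'I_n & 'I_(w i).+1}.
Definition circ n (w : 'I_n -> nat) := {i : 'I_n & 'I_(w i)}.

Section BowData.
Variables (n : nat) (w : 'I_n -> nat).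

Definition xin (j : 'I_n) : segment w :=
  Tagged (fun i => 'I_(w i).+1) (ord0 : 'I_(w j).+1).

Definition xout (j : 'I_n) : segment w :=
  Tagged (fun i => 'I_(w i).+1) (ord_max : 'I_(w (ord_pred j)).+1).

(* [tagged h] has value k < w (tag h); it separates segments k and k.+1. *)
Definition hin (h : circ w) : segment w :=
  Tagged (fun i => 'I_(w i).+1) (lift ord0 (tagged h) : 'I_(w (tag h)).+1).

Definition hout (h : circ w) : segment w :=
  Tagged (fun i => 'I_(w i).+1) (widen_ord (leqnSn _) (tagged h)).

Variables (K : fieldType) (r : segment w -> nat).

Definition bowV (z : segment w) : vectType K := 'rV[K]_(r z).

Record bow_maps := BowMaps {
  mB : forall z : segment w, 'Hom(bowV z, bowV z);
  mA : forall x : 'I_n, 'Hom(bowV (xout x), bowV (xin x));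
  ma : forall x : 'I_n, 'Hom(K^o, bowV (xin x));
  mb : forall x : 'I_n, 'Hom(bowV (xout x), K^o);
  mC : forall h : circ w, 'Hom(bowV (hout h), bowV (hin h));
  mD : forall h : circ w, 'Hom(bowV (hin h), bowV (hout h)) }.

Definition cross_eq (m : bow_maps) : Prop := forall x : 'I_n,
  (mB m (xin x) \o mA m x)%VF - (mA m x \o mB m (xout x))%VF
  + (ma m x \o mb m x)%VF = 0.

Definition cond_S1 (m : bow_maps) : Prop :=
  forall (x : 'I_n) (S : {vspace bowV (xout x)}),
  (mB m (xout x) @: S <= S)%VS ->
  (mA m x @: S = 0)%VS -> (mb m x @: S = 0)%VS ->
  S = 0%VS.

Definition cond_S2 (m : bow_maps) : Prop :=
  forall (x : 'I_n) (T : {vspace bowV (xin x)}),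
  (mB m (xin x) @: T <= T)%VS ->
  (limg (mA m x) + limg (ma m x) <= T)%VS ->
  T = fullv.

Definition circ_eq (m : bow_maps) : Prop := forall h : circ w,
  (mC m h \o mD m h)%VF + mB m (hin h) = 0 /\
  (mD m h \o mC m h)%VF + mB m (hout h) = 0.

Definition bow_data (m : bow_maps) : Prop :=
  [/\ cross_eq m, cond_S1 m, cond_S2 m & circ_eq m].

(** A graded subspace of the direct sum of the V_z is a family of subspaces. *)
Definition graded := forall z : segment w, {vspace bowV z}.

Definition invariant (m : bow_maps) (S : graded) : Prop :=
  [/\ forall z, (mB m z @: S z <= S z)%VS,
      forall x, (mA m x @: S (xout x) <= S (xin x))%VS,
      forall h, (mC m h @: S (hout h) <= S (hin h))%VS &
      forall h, (mD m h @: S (hin h) <= S (hout h))%VS].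

Definition iso_on_sub (U V : vectType K) (f : 'Hom(U, V))
    (S : {vspace U}) (S' : {vspace V}) : Prop :=
  {in S &, injective f} /\ (f @: S = S')%VS.

(* [f] induces an isomorphism U / T -> V / T'; well-definedness of the induced
   map is the first clause, then injectivity and surjectivity. *)
Definition iso_on_quot (U V : vectType K) (f : 'Hom(U, V))
    (T : {vspace U}) (T' : {vspace V}) : Prop :=
  [/\ (f @: T <= T')%VS,
      forall u, f u \in T' -> u \in T &
      forall v, exists u, v - f u \in T'].

Definition stable_sub (m : bow_maps) : Prop := forall S : graded,
  invariant m S ->
  (forall x, (mb m x @: S (xout x) = 0)%VS) ->
  (forall x, iso_on_sub (mA m x) (S (xout x)) (S (xin x))) ->
  forall z, S z = 0%VS.

Definition stable_quot (m : bow_maps) : Prop := forall T : graded,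
  invariant m T ->
  (forall x, (limg (ma m x) <= T (xin x))%VS) ->
  (forall x, iso_on_quot (mA m x) (T (xout x)) (T (xin x))) ->
  forall z, T z = fullv.

Definition stable_data : set bow_maps :=
  [set m | [/\ bow_data m, stable_sub m & stable_quot m]].

Definition bowGL : set (forall z : segment w, 'Hom(bowV z, bowV z)) :=
  [set g | forall z, bijective (g z : bowV z -> bowV z)].

Definition gl_act (g : forall z : segment w, 'Hom(bowV z, bowV z))
    (m : bow_maps) : bow_maps := {|
  mB := fun z => (g z \o mB m z \o (g z)^-1)%VF;
  mA := fun x => (g (xin x) \o mA m x \o (g (xout x))^-1)%VF;
  ma := fun x => (g (xin x) \o ma m x)%VF;
  mb := fun x => (mb m x \o (g (xout x))^-1)%VF;
  mC := fun h => (g (hin h) \o mC m h \o (g (hout h))^-1)%VF;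
  mD := fun h => (g (hout h) \o mD m h \o (g (hin h))^-1)%VF |}.

Definition gl_orbit (m : bow_maps) : set bow_maps :=
  [set gl_act g m | g in bowGL].

(** The quotient by the gauge group, as the set of orbits of stable data. *)
Definition Ms : set (set bow_maps) := [set gl_orbit m | m in stable_data].

Definition torus : set ('I_n -> K) := [set s | forall i, s i != 0].

(* For x_0 the products over k < 0 are empty, so [a] is unchanged there. *)
Definition torus_act (s : 'I_n -> K) (m : bow_maps) : bow_maps := {|
  mB := mB m;
  mA := fun x => if x == 0 :> nat then (\prod_(k < n) s k) *: mA m x else mA m x;
  ma := fun x => (\prod_(k < n | (k < x)%N) s k)^-1 *: ma m x;
  mb := fun x => if x == 0 :> nat then (\prod_(k < n) s k) *: mb m x
                 else (\prod_(k < n | (k < x)%N) s k) *: mb m x;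
  mC := mC m;
  mD := mD m |}.

(** The induced action on the quotient sends an orbit to its image, because the
    torus action on data commutes with the gauge group. *)
Definition Ms_fixed : set (set bow_maps) :=
  [set O | Ms O /\ forall s, torus s -> torus_act s @` O = O].

End BowData.

(** The variety M^s(kappa, mu) for kappa = sum_i w_i Lambda_i + c delta and
    kappa - mu = sum_i v_i alpha_i, and its torus fixed points. *)
Definition balanced_dim n (w v : 'I_n -> nat) (z : segment w) : nat := v (tag z).

Definition Ms_weight_fixed (K : fieldType) n (w v : 'I_n -> nat) :
    set (set (bow_maps K (balanced_dim (w := w) v))) :=
  @Ms_fixed n w K (balanced_dim v).

(** * Weights of affine sl(n)

  The dual of the Cartan subalgebra in the basis Lambda_0, ..., Lambda_(n-1),
  delta: a pair [l] has coordinates [l.1 0 i] = <l, coroot_i> and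
  [l.2] = <l, d>, where d is the scaling element, <alpha_i, d> = [i = 0] and
  <Lambda_i, d> = 0. *)

Section AffineWeights.
Variables (K : fieldType) (n : nat).

Definition aff_hdual := ('rV[K]_n * K^o)%type.

(* For n = 2 the two last terms coincide and give -2 off the diagonal. *)
Definition aff_cartan (i j : 'I_n) : K :=
  2 * (i == j)%:R - (j == ordS i)%:R - (j == ord_pred i)%:R.

Definition pairing (l : aff_hdual) (i : 'I_n) : K := l.1 0 i.

Definition Lambda (i : 'I_n) : aff_hdual := (delta_mx 0 i, 0).

Definition alpha (j : 'I_n) : aff_hdual :=
  (\row_i aff_cartan i j, (j == 0 :> nat)%:R).

Definition delta : aff_hdual := \sum_i alpha i.

Definition dominant (l : aff_hdual) : Prop :=
  forall i, exists k : nat, pairing l i = k%:R.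

Definition simple_reflection (i : 'I_n) (l : aff_hdual) : aff_hdual :=
  l - pairing l i *: alpha i.

(** The Weyl group is generated by the simple reflections, which are
    involutions, so its elements act as words in them. *)
Definition weyl_orbit (l : aff_hdual) : set aff_hdual :=
  [set foldr simple_reflection l s | s in [set: seq 'I_n]].

(** mu^+, the dominant weight in the Weyl group orbit of [l], which exists and
    is unique for integral weights of positive level; a default otherwise. *)
Definition dominant_conj (l : aff_hdual) : aff_hdual :=
  xget l [set l' | weyl_orbit l l' /\ dominant l'].

End AffineWeights.

Arguments Lambda {K n}.
Arguments alpha {K n}.
Arguments delta {K n}.
Arguments Ms_weight_fixed K {n} w v.

(* Main.v *)
(* The torus element s = (2, ..., 2) acts on a fixed orbit through
   some g in the gauge group.  Stability forces g to be diagonalizable with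
   eigenvalues powers of 2, which grades the data so that every A has degree 1,
   B, C, D have degree 0, a lands in degree 0 and b starts in degree -1.  This
   unrolls the circle into n lines, the j-th one carrying a nonzero a, b only at
   x_j.  Away from x_j the A are isomorphisms, and stability makes one of the two
   spaces adjacent to x_j zero and every graded piece a cyclic nilpotent
   B-module whose length drops by one at each o-point met when walking away
   from x_j.  Hence fixed data have a normal form determined by the dimension
   jumps at the points x_j: there is at most one fixed point, and there is one
   exactly when the lengths of these strings add up to the dimensions.  On the
   cover the end points of the strings are permuted by the Weyl group, simple
   reflections preserve the length condition, and for a dominant weight it
   forces all dimensions to vanish. *)
Require Import Defs.
From HB Require Import structures.
From mathcomp Require Import all_boot all_order all_algebra.
From mathcomp Require Import boolp classical_sets reals.
From mathcomp Require Import complex zify ring.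

Set Implicit Arguments.
Unset Strict Implicit.
Unset Printing Implicit Defensive.
Import Order.TTheory GRing.Theory Num.Theory.
Local Open Scope classical_set_scope.
Local Open Scope ring_scope.

(** * Recursion along the lines covering the circle *)

(** The element [g] supplied by a fixed orbit is not known to be semisimple. The vectors lying in
    the image of every finite product of distinct factors [g - lam d] form a subspace to which
    stability applies, so it is zero and one such product vanishes. Later facts about graded pieces
    rest on one device: a condition imposed near [x_j] is carried along the line by images and
    preimages under [A], [C], [D], and the resulting graded subspace is tested against stability.
    Hence the recursion along lines, and subspaces given as linear predicates. For existence, the
    jumps at the x-points force all string lengths, so what remains is the identity v_i = sum over X
    of max(q(X) - h, 0) + sum over Y of max(h - q(Y), 0), where h is the height of the segment on
    the cover, X runs over the x-points before it and Y over those after it. A simple reflection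
    exchanges neighbouring values of q, and max(x, 0) - max(-x, 0) = x turns this exchange into the
    reflection of v. *)

Section MeasureRecursion.
Variables (T I J : Type) (F : T -> Type).
Variables (b : I -> T) (src dst : J -> T) (size_of : T -> nat).
Hypotheses (b_inj : injective b) (dst_inj : injective dst).
Hypothesis b_dst : forall i j, b i <> dst j.
Hypothesis coverT : forall z, (exists i, z = b i) \/ (exists j, z = dst j).
Hypothesis src_lt : forall j, (size_of (src j) < size_of (dst j))%N.
Variables (base : forall i, F (b i)) (step : forall j, F (src j) -> F (dst j)).

(** The type of a value depends on its position, so the recursion runs through [Fix] and casts along
    [z = b i] or [z = dst j]. Injectivity and disjointness of [b] and [dst], with proof irrelevance,
    remove the casts and leave the equations. *)
Lemma measure_rec : {f : forall z, F z |
  (forall i, f (b i) = base i) /\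
  (forall j, f (dst j) = step (f (src j)))}.
Proof.
have dec z : {i | z = b i} + {j | z = dst j}.
  have [zb|zb] := pselect (exists i, z = b i); first by left; apply: cid.
  by right; apply: cid; have [] := coverT z.
have lt_src z j : z = dst j -> (size_of (src j) < size_of z)%N by move=> ->.
pose cast z z' (e : z = z') (x : F z') : F z := eq_rect z' F x z (esym e).
pose body z (rec : forall y, (size_of y < size_of z)%N -> F y) : F z :=
  match dec z with
  | inl (exist i e) => cast _ _ e (base i)
  | inr (exist j e) => cast _ _ e (step (rec _ (lt_src _ _ e)))
  end.
have wf : well_founded (fun y z => (size_of y < size_of z)%N).
  have H m : forall z, (size_of z < m)%N ->
      Acc (fun y z => (size_of y < size_of z)%N) z.
    elim: m => [z|m IH z zm]; first by rewrite ltn0.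
    apply: Acc_intro => y yz.
    exact: IH (leq_trans yz zm).
  by move=> z; apply: (H (size_of z).+1).
exists (Fix wf F body).
have fE z : Fix wf F body z = body z (fun y _ => Fix wf F body y).
  apply: Fix_eq => x f g fg; rewrite /body; case: (dec x) => [[i e]|[j e]] //.
  by rewrite fg.
split=> [i|j]; rewrite fE /body.
  case: (dec _) => [[i' e]|[j e]]; last by case: (b_dst e).
  have ii' := b_inj e; subst i'.
  by rewrite /cast (Prop_irrelevance e erefl).
case: (dec _) => [[i e]|[j' e]]; first by case: (b_dst (esym e)).
have jj' := dst_inj e; subst j'.
by rewrite /cast (Prop_irrelevance e erefl).
Qed.
End MeasureRecursion.

Section SegmentRecursion.
Variables (n : nat) (w : 'I_n -> nat).
Local Notation xin := (xin w).
Local Notation xout := (xout w).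

Lemma segment_eq (z z' : segment w) :
  tag z = tag z' -> tagged z = tagged z' :> nat -> z = z'.
Proof.
by case: z z' => i k [i' k'] /= ii'; subst i' => kk'; congr existT; apply: val_inj.
Qed.

Lemma circ_eq_key (z z' : circ w) :
  tag z = tag z' -> tagged z = tagged z' :> nat -> z = z'.
Proof.
by case: z z' => i k [i' k'] /= ii'; subst i' => kk'; congr existT; apply: val_inj.
Qed.

Lemma xin_inj : injective xin.
Proof. by move=> i j /(congr1 tag). Qed.

Lemma xout_inj : injective xout.
Proof. by move=> i j /(congr1 tag) /ord_pred_inj. Qed.

Lemma hin_inj : injective (@hin n w).
Proof.
move=> h h' e; apply: circ_eq_key; first exact: (congr1 tag e).
by have := congr1 (fun z : segment w => tagged z : nat) e; rewrite /= /bump !add1n => -[].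
Qed.

Lemma hout_inj : injective (@hout n w).
Proof.
move=> h h' e; apply: circ_eq_key; first exact: (congr1 tag e).
by have := congr1 (fun z : segment w => tagged z : nat) e.
Qed.

Lemma xin_hin j h : xin j <> hin h.
Proof. by move/(congr1 (fun z : segment w => tagged z : nat)). Qed.

Lemma xout_hout j h : xout j <> hout h.
Proof.
case: h => i k e; have /= ij := congr1 tag e; subst i.
have /= := congr1 (fun z : segment w => tagged z : nat) e.
by move/eqP; rewrite gtn_eqF.
Qed.

Lemma segment_xin_hin (z : segment w) :
  (exists j, z = xin j) \/ (exists h, z = hin h).
Proof.
case: z => i [[|k] Hk]; first by left; exists i; apply: segment_eq.
right; exists (existT _ i (Ordinal (Hk : (k < w i)%N))).
exact: segment_eq.
Qed.

Lemma segment_xout_hout (z : segment w) :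
  (exists j, z = xout j) \/ (exists h, z = hout h).
Proof.
case: z => i k; have [kw|] := ltnP k (w i).
  right; exists (existT (fun i => 'I_(w i)) i (Ordinal kw)); exact: segment_eq.
move=> wk; left; exists (ordS i); apply: segment_eq; rewrite /= ordSK //.
by apply/eqP; rewrite eqn_leq wk -ltnS ltn_ord.
Qed.

(* A pair [(z, t)] is a position on one of the lines covering the circle: [t]
   counts the x-points passed since the base point of the line. *)
Definition line_src_right (j : circ w * nat + 'I_n * nat) : segment w * nat :=
  match j with inl (h, t) => (hout h, t) | inr (x, t) => (xout x, t) end.
Definition line_dst_right (j : circ w * nat + 'I_n * nat) : segment w * nat :=
  match j with inl (h, t) => (hin h, t) | inr (x, t) => (xin x, t.+1) end.
Definition line_src_left (j : circ w * nat + 'I_n * nat) : segment w * nat :=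
  match j with inl (h, t) => (hin h, t) | inr (x, t) => (xin x, t) end.
Definition line_dst_left (j : circ w * nat + 'I_n * nat) : segment w * nat :=
  match j with inl (h, t) => (hout h, t) | inr (x, t) => (xout x, t.+1) end.

Lemma line_rec_right (F : segment w -> nat -> Type)
    (base : forall j, F (xin j) 0%N)
    (stepC : forall h t, F (hout h) t -> F (hin h) t)
    (stepA : forall x t, F (xout x) t -> F (xin x) t.+1) :
  {f : forall z t, F z t |
   [/\ forall j, f (xin j) 0%N = base j,
       forall h t, f (hin h) t = stepC h t (f (hout h) t) &
       forall x t, f (xin x) t.+1 = stepA x t (f (xout x) t)]}.
Proof.
pose b (j : 'I_n) := (xin j, 0%N).
(* Passing one x-point must outweigh returning to the start of an arc, and no arc has more than
   [\sum_i w i] o-points. *)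
pose sz (p : segment w * nat) := (p.2 * (\sum_i w i).+1 + tagged p.1)%N.
have b_inj : injective b by move=> i j /(congr1 fst) /xin_inj.
have d_inj : injective line_dst_right.
  move=> [[h t]|[x t]] [[h' t']|[x' t']] e; have := congr1 snd e => /= e2;
    have := congr1 fst e => /=.
  - by move=> /hin_inj ->; rewrite e2.
  - by move=> /esym /xin_hin.
  - by move=> /xin_hin.
  - by move=> /xin_inj ->; case: e2 => ->.
have bd i j : b i <> line_dst_right j by case: j => [[h t]|[x t]] // /(congr1 fst) /xin_hin.
have cov z : (exists i, z = b i) \/ (exists j, z = line_dst_right j).
  case: z => z t; have [[j ->]|[h ->]] := segment_xin_hin z.
    case: t => [|t]; first by left; exists j.
    by right; exists (inr (j, t)).
  by right; exists (inl (h, t)).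
have lt j : (sz (line_src_right j) < sz (line_dst_right j))%N.
  case: j => [[h t]|[x t]]; rewrite /sz /=; first by rewrite /bump add1n addnS.
  rewrite addn0 mulSnr ltn_add2l ltnS.
  by rewrite (bigD1 (ord_pred x)) //= leq_addr.
pose st (j : circ w * nat + 'I_n * nat) : (fun p => F p.1 p.2) (line_src_right j) ->
    (fun p => F p.1 p.2) (line_dst_right j) :=
  match j with inl (h, t) => @stepC h t | inr (x, t) => @stepA x t end.
have [f [f0 fS]] := @measure_rec _ _ _ (fun p => F p.1 p.2) b line_src_right
  line_dst_right sz b_inj d_inj bd cov lt base st.
exists (fun z t => f (z, t)); split=> [j|h t|x t]; first exact: f0.
- exact: (fS (inl (h, t))).
- exact: (fS (inr (x, t))).
Qed.

Lemma line_rec_left (F : segment w -> nat -> Type)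
    (base : forall j, F (xout j) 0%N)
    (stepC : forall h t, F (hin h) t -> F (hout h) t)
    (stepA : forall x t, F (xin x) t -> F (xout x) t.+1) :
  {f : forall z t, F z t |
   [/\ forall j, f (xout j) 0%N = base j,
       forall h t, f (hout h) t = stepC h t (f (hin h) t) &
       forall x t, f (xout x) t.+1 = stepA x t (f (xin x) t)]}.
Proof.
pose b (j : 'I_n) := (xout j, 0%N).
pose sz (p : segment w * nat) :=
  (p.2 * (\sum_i w i).+1 + (w (tag p.1) - tagged p.1))%N.
have b_inj : injective b by move=> i j /(congr1 fst) /xout_inj.
have d_inj : injective line_dst_left.
  move=> [[h t]|[x t]] [[h' t']|[x' t']] e; have := congr1 snd e => /= e2;
    have := congr1 fst e => /=.
  - by move=> /hout_inj ->; rewrite e2.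
  - by move=> /esym /xout_hout.
  - by move=> /xout_hout.
  - by move=> /xout_inj ->; case: e2 => ->.
have bd i j : b i <> line_dst_left j by case: j => [[h t]|[x t]] // /(congr1 fst) /xout_hout.
have cov z : (exists i, z = b i) \/ (exists j, z = line_dst_left j).
  case: z => z t; have [[j ->]|[h ->]] := segment_xout_hout z.
    case: t => [|t]; first by left; exists j.
    by right; exists (inr (j, t)).
  by right; exists (inl (h, t)).
have lt j : (sz (line_src_left j) < sz (line_dst_left j))%N.
  case: j => [[h t]|[x t]]; rewrite /sz /=.
    rewrite /bump add1n ltn_add2l subnS prednK // subn_gt0; exact: ltn_ord.
  rewrite subnn subn0 addn0 mulSnr ltn_add2l ltnS.
  by rewrite (bigD1 x) //= leq_addr.
pose st (j : circ w * nat + 'I_n * nat) : (fun p => F p.1 p.2) (line_src_left j) ->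
    (fun p => F p.1 p.2) (line_dst_left j) :=
  match j with inl (h, t) => @stepC h t | inr (x, t) => @stepA x t end.
have [f [f0 fS]] := @measure_rec _ _ _ (fun p => F p.1 p.2) b line_src_left
  line_dst_left sz b_inj d_inj bd cov lt base st.
exists (fun z t => f (z, t)); split=> [j|h t|x t]; first exact: f0.
- exact: (fS (inl (h, t))).
- exact: (fS (inr (x, t))).
Qed.

Lemma line_ind_right (P : segment w -> nat -> Prop) :
  (forall j, P (xin j) 0%N) ->
  (forall h t, P (hout h) t -> P (hin h) t) ->
  (forall x t, P (xout x) t -> P (xin x) t.+1) -> forall z t, P z t.
Proof. by move=> P0 PC PA; have [] := line_rec_right P0 PC PA. Qed.

Lemma line_ind_left (P : segment w -> nat -> Prop) :
  (forall j, P (xout j) 0%N) ->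
  (forall h t, P (hin h) t -> P (hout h) t) ->
  (forall x t, P (xin x) t -> P (xout x) t.+1) -> forall z t, P z t.
Proof. by move=> P0 PC PA; have [] := line_rec_left P0 PC PA. Qed.

(** Backward induction on the rightward lines: read from a far position they are walked clockwise,
    so [line_ind_left] applies with the counter [T - t]. *)
Lemma line_ind_from_right (P : segment w -> nat -> Prop) (T : nat) :
  (forall z t, (T <= t)%N -> P z t) ->
  (forall h t, P (hin h) t -> P (hout h) t) ->
  (forall x t, P (xin x) t.+1 -> P (xout x) t) -> forall z t, P z t.
Proof.
move=> PT PC PA z t; have [/PT //|tT] := leqP T t.
have H : forall z t, (t <= T)%N -> P z (T - t)%N.
  apply: line_ind_left => [j _|h s IH sT|x s IH sT].
  - by apply: PT; rewrite subn0.
  - by apply: PC; apply: IH.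
  - by apply: PA; rewrite subnSK //; apply: IH; apply: ltnW.
by rewrite -[t](subKn (ltnW tT)); apply: H; rewrite leq_subr.
Qed.

Lemma line_ind_from_left (P : segment w -> nat -> Prop) (T : nat) :
  (forall z t, (T <= t)%N -> P z t) ->
  (forall h t, P (hout h) t -> P (hin h) t) ->
  (forall x t, P (xout x) t.+1 -> P (xin x) t) -> forall z t, P z t.
Proof.
move=> PT PC PA z t; have [/PT //|tT] := leqP T t.
have H : forall z t, (t <= T)%N -> P z (T - t)%N.
  apply: line_ind_right => [j _|h s IH sT|x s IH sT].
  - by apply: PT; rewrite subn0.
  - by apply: PC; apply: IH.
  - by apply: PA; rewrite subnSK //; apply: IH; apply: ltnW.
by rewrite -[t](subKn (ltnW tT)); apply: H; rewrite leq_subr.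
Qed.

End SegmentRecursion.

(** * Nilpotent cyclic modules *)

Section LinearPredicates.
Variable K : fieldType.

(** Subspaces built along a line are iterated images, preimages and sums, which are easier to write
    as predicates; [lin_pred_vspace] turns them back into subspaces. *)
Definition lin_pred (V : lmodType K) (P : V -> Prop) :=
  P 0 /\ forall a u v, P u -> P v -> P (a *: u + v).

Lemma lin_predD (V : lmodType K) (P : V -> Prop) u v :
  lin_pred P -> P u -> P v -> P (u + v).
Proof. by move=> [_ PL] Pu Pv; rewrite -[u]scale1r; apply: PL. Qed.

Lemma lin_predZ (V : lmodType K) (P : V -> Prop) a u :
  lin_pred P -> P u -> P (a *: u).
Proof. by move=> [P0 PL] Pu; rewrite -[_ *: _]addr0; apply: PL. Qed.

Lemma lin_predN (V : lmodType K) (P : V -> Prop) u :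
  lin_pred P -> P u -> P (- u).
Proof. by move=> PL Pu; rewrite -scaleN1r; apply: lin_predZ. Qed.

Lemma lin_pred_sum (V : lmodType K) (P : V -> Prop) I (s : seq I) (Q : pred I)
    (f : I -> V) :
  lin_pred P -> (forall i, Q i -> P (f i)) -> P (\sum_(i <- s | Q i) f i).
Proof.
move=> PL Pf; apply: (big_ind P) => //; first by case: PL.
by move=> u v; apply: lin_predD.
Qed.

(** A subspace of maximal dimension inside [P] absorbs every vector of [P]. *)
Lemma lin_pred_vspace (V : vectType K) (P : V -> Prop) :
  lin_pred P -> {U : {vspace V} | forall u, u \in U <-> P u}.
Proof.
move=> PL; apply: cid.
pose Q k := `[< exists U : {vspace V}, \dim U = k /\ forall u, u \in U -> P u >].
have Q0 : exists k, Q k.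
  exists 0%N; apply/asboolP; exists 0%VS; rewrite dimv0; split=> // u.
  by rewrite memv0 => /eqP ->; case: PL.
have Qle k : Q k -> (k <= \dim (fullv : {vspace V}))%N.
  by move=> /asboolP [U [<- _]]; apply: dimvS; apply: subvf.
case: (ex_maxnP Q0 Qle) => k /asboolP [U [Uk UP]] kmax.
exists U => u; split=> [/UP //|Pu].
have : Q (\dim (U + <[u]>)%VS).
  apply/asboolP; exists (U + <[u]>)%VS; split=> // v /memv_addP [x /UP Px].
  by move=> [y /vlineP [c ->] ->]; apply: lin_predD => //; apply: lin_predZ.
move=> /kmax; rewrite -Uk => dle.
have /eqP -> : (U == U + <[u]>)%VS by rewrite eqEdim addvSl.
by rewrite (subvP (addvSr _ _)) // memv_line.
Qed.

Lemma iter_linear (V : vectType K) (B : 'End(V)) l a u v :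
  iter l B (a *: u + v) = a *: iter l B u + iter l B v.
Proof. by elim: l => //= l ->; rewrite linearP. Qed.

Lemma iter_lin0 (V : vectType K) (B : 'End(V)) l : iter l B 0 = 0.
Proof. by elim: l => //= l ->; rewrite linear0. Qed.

Lemma iter_linB (V : vectType K) (B : 'End(V)) l u v :
  iter l B (u - v) = iter l B u - iter l B v.
Proof. by rewrite addrC -scaleN1r iter_linear scaleN1r addrC. Qed.

Lemma iter_linN (V : vectType K) (B : 'End(V)) l u :
  iter l B (- u) = - iter l B u.
Proof. by rewrite -[- u]add0r iter_linB iter_lin0 add0r. Qed.

Lemma iter_linZ (V : vectType K) (B : 'End(V)) l a u :
  iter l B (a *: u) = a *: iter l B u.
Proof. by rewrite -[a *: u]addr0 iter_linear iter_lin0 addr0. Qed.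

Lemma iter_lin_sum (V : vectType K) (B : 'End(V)) l I (s : seq I) (f : I -> V) :
  iter l B (\sum_(i <- s) f i) = \sum_(i <- s) iter l B (f i).
Proof.
elim: s => [|i s IH]; rewrite ?big_nil ?iter_lin0 // !big_cons.
by rewrite -[f i]scale1r iter_linear IH !scale1r.
Qed.

Lemma iter_comm (V V' : vectType K) (B : 'End(V)) (B' : 'End(V')) (F : 'Hom(V, V'))
    (U : {vspace V}) :
  (forall u, u \in U -> B u \in U) ->
  (forall u, u \in U -> F (B u) = B' (F u)) ->
  forall l u, u \in U -> F (iter l B u) = iter l B' (F u).
Proof.
move=> BU FB; elim=> //= l IH u uU; rewrite FB ?IH //.
by elim: l {IH} => //= l; apply: BU.
Qed.

Lemma iter_mem (V : vectType K) (B : 'End(V)) (U : {vspace V}) :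
  (forall u, u \in U -> B u \in U) ->
  forall l u, u \in U -> iter l B u \in U.
Proof. by move=> BU; elim=> //= l IH u uU; apply/BU/IH. Qed.

Lemma iter_ge0 (V : vectType K) (B : 'End(V)) q l u :
  iter q B u = 0 -> (q <= l)%N -> iter l B u = 0.
Proof. by move=> Bq /subnK <-; rewrite iterD Bq iter_lin0. Qed.

(** When [B] preserves [U], this says that [U] is K[t]/(t^q) with [t] acting as [B] and [e] as 1;
    [q = 0] is the zero space. *)
Record cyclic_nilp (V : vectType K) (U : {vspace V}) (B : 'End(V)) (e : V)
    (q : nat) : Prop := CyclicNilp {
  cyc_mem : e \in U;
  cyc_span : forall u, u \in U ->
    exists c : nat -> K, u = \sum_(0 <= l < q) c l *: iter l B e;
  cyc_nil : iter q B e = 0;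
  cyc_last : (0 < q)%N -> iter q.-1 B e != 0 }.

Lemma cyc_free (V : vectType K) (U : {vspace V}) B e q (c : nat -> K) :
  cyclic_nilp U B e q -> \sum_(0 <= l < q) c l *: iter l B e = 0 ->
  forall l, (l < q)%N -> c l = 0.
Proof.
move=> cU sum0; elim/ltn_ind=> l IH lq.
(* This power moves the term of index [l] to the last nonzero power of [B] and kills all higher
   terms; the lower ones vanish by induction. *)
have := congr1 (iter (q - l.+1) B) sum0.
rewrite iter_lin0 iter_lin_sum.
rewrite (big_cat_nat _ (n := l)) //=; last exact: ltnW.
rewrite big_nat big1 ?add0r; last first.
  by move=> i /andP[_ il]; rewrite (IH i il (ltn_trans il lq)) scale0r iter_lin0.
rewrite big_ltn // big_nat big1 ?addr0; last first.
  move=> i /andP[li iq]; rewrite iter_linZ -iterD.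
  rewrite (iter_ge0 (cyc_nil cU)) ?scaler0 //; lia.
rewrite iter_linZ -iterD.
have -> : (q - l.+1 + l = q.-1)%N by lia.
move/eqP; rewrite scaler_eq0 => /orP[/eqP //|].
by rewrite (negbTE (cyc_last cU _)) // (leq_ltn_trans _ lq).
Qed.

(** Since [F] is onto and [G F = - B], the injective [G] identifies [U'] with the image of [B] on
    [U], which is cyclic of length [q - 1]. This is the drop of length at an o-point. *)
Lemma cyc_step (V V' : vectType K) (U : {vspace V}) (U' : {vspace V'})
    (B : 'End(V)) (B' : 'End(V')) (F : 'Hom(V, V')) (G : 'Hom(V', V)) e q :
  (forall u, u \in U -> B u \in U) ->
  (forall u, u \in U -> F u \in U') ->
  (forall v, v \in U' -> exists2 u, u \in U & v = F u) ->
  (forall v, v \in U' -> G v = 0 -> v = 0) ->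
  (forall u, u \in U -> F (B u) = B' (F u)) ->
  (forall u, u \in U -> G (F u) = - B u) ->
  cyclic_nilp U B e q -> cyclic_nilp U' B' (F e) q.-1.
Proof.
move=> BU FU Fsurj Ginj FB GF [eU espan enil elast].
have FBl := iter_comm BU FB.
have BlU := iter_mem BU.
have nil' : iter q.-1 B' (F e) = 0.
  rewrite -FBl //; apply: Ginj; first by apply: FU; apply: BlU.
  rewrite GF ?BlU // -iterS; apply/eqP; rewrite oppr_eq0; apply/eqP.
  by apply: iter_ge0 enil _; case: (q).
split=> //; first exact: FU.
- move=> v /Fsurj [u /espan [c ->] ->]; exists c; rewrite linear_sum /=.
  case: (q) nil' => [|k] nil'; first by rewrite !big_geq.
  rewrite big_nat_recr //= linearZ /= FBl // nil' scaler0 addr0.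
  by apply: eq_bigr => l _; rewrite linearZ /= FBl.
- move=> q1; apply/negP => /eqP; rewrite -FBl // => FB0.
  have := congr1 G FB0; rewrite linear0 GF ?BlU // -iterS.
  move/eqP; rewrite oppr_eq0 prednK //.
  by rewrite (negbTE (elast _)) //; apply: leq_trans q1 (leq_pred _).
Qed.

Lemma cyc_iso (V V' : vectType K) (U : {vspace V}) (U' : {vspace V'})
    (B : 'End(V)) (B' : 'End(V')) (F : 'Hom(V, V')) e q :
  (forall u, u \in U -> B u \in U) ->
  (forall u, u \in U -> F u \in U') ->
  (forall v, v \in U' -> exists2 u, u \in U & v = F u) ->
  (forall u, u \in U -> F u = 0 -> u = 0) ->
  (forall u, u \in U -> F (B u) = B' (F u)) ->
  cyclic_nilp U B e q -> cyclic_nilp U' B' (F e) q.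
Proof.
move=> BU FU Fsurj Finj FB [eU espan enil elast].
have FBl := iter_comm BU FB.
have BlU := iter_mem BU.
split=> //; first exact: FU.
- move=> v /Fsurj [u /espan [c ->] ->]; exists c; rewrite linear_sum /=.
  by apply: eq_bigr => l _; rewrite linearZ /= FBl.
- by rewrite -FBl // enil linear0.
- move=> q0; rewrite -FBl //; apply/negP => /eqP /Finj; rewrite BlU // => /(_ isT).
  by move/eqP; rewrite (negbTE (elast _)).
Qed.

Lemma cyclic_nilpW (V : vectType K) (U : {vspace V}) (B : 'End(V)) e N :
  e \in U -> iter N B e = 0 ->
  (forall u, u \in U -> exists c : nat -> K, exists M,
    u = \sum_(0 <= l < M) c l *: iter l B e) ->
  exists q, cyclic_nilp U B e q.
Proof.
move=> eU Be espan.
have ex0 : exists q, iter q B e == 0 by exists N; apply/eqP.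
case: (ex_minnP ex0) => q /eqP Bq qmin; exists q; split=> //.
- move=> u /espan [c [M ->]].
  exists (fun l => if (l < M)%N then c l else 0).
  rewrite (big_nat_widen _ _ (maxn M q)) ?leq_maxl // [RHS](big_nat_widen _ _ (maxn M q)) ?leq_maxr //.
  rewrite big_mkcond /= [RHS]big_mkcond /=; apply: eq_bigr => l _.
  case: (ltnP l M) => lM; case: (ltnP l q) => // lq; last by rewrite scale0r.
  by rewrite (iter_ge0 Bq) // scaler0.
- move=> q0; apply/negP => /qmin; case: (q) q0 => // k _; by rewrite ltnn.
Qed.

(** The dual of generation by one vector: if the functionals [f B^l] separate [U], then [U] is also
    cyclic, and the generator can be normalized so that [f] only sees the last vector of the
    string. *)
Lemma cocyclic_nilp (V : vectType K) (U : {vspace V}) (B : 'End(V))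
    (f : 'Hom(V, K^o)) N :
  (forall u, u \in U -> B u \in U) ->
  (forall u, u \in U -> iter N B u = 0) ->
  (forall u, u \in U -> (forall l, f (iter l B u) = 0) -> u = 0) ->
  exists e q, cyclic_nilp U B e q /\ forall l, f (iter l B e) = (l.+1 == q)%:R.
Proof.
move=> BU Bnil fsep.
have BlU := iter_mem BU.
have exq : exists q, `[< forall u, u \in U -> f (iter q B u) = 0 >].
  by exists N; apply/asboolP => u uU; rewrite Bnil // linear0.
case: (ex_minnP exq) => q /asboolP fq qmin.
have fge l u : (q <= l)%N -> u \in U -> f (iter l B u) = 0.
  by move=> ql uU; rewrite -(subnKC ql) iterD fq ?BlU.
case: q fq qmin fge => [|q] fq qmin fge.
  exists 0, 0%N; split; last by move=> l; rewrite iter_lin0 linear0.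
  split=> //; first exact: mem0v.
  by move=> u uU; exists (fun=> 0); rewrite big_geq //; apply: fsep => // l; apply: fge.
have [u1 u1U fu1] : exists2 u, u \in U & f (iter q B u) != 0.
  apply: contrapT => H; suff : (q < q)%N by rewrite ltnn.
  apply: qmin; apply/asboolP => u uU; apply: contrapT => /eqP fu; apply: H; by exists u.
(* Successive corrections by multiples of [B^(M+1) u] fix the values [f (B^l u)] one by one, from
   [l = q] downwards. *)
have norm M : exists2 u, u \in U & forall l, (q <= l + M)%N ->
    f (iter l B u) = (l == q)%:R.
  elim: M => [|M [u uU uM]].
    exists ((f (iter q B u1))^-1 *: u1); first exact: memvZ.
    move=> l; rewrite addn0 leq_eqVlt => /predU1P[<-|ql].
      by rewrite iter_linZ linearZ /= eqxx; apply: mulVf.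
    by rewrite fge ?memvZ // gtn_eqF.
  exists (u - (if (M < q)%N then f (iter (q - M.+1) B u) else 0) *: iter M.+1 B u).
    by rewrite memvB // memvZ // BlU.
  move=> l ql; rewrite iter_linB iter_linZ -iterD linearB linearZ /=.
  have [lM|lM] := leqP q (l + M).
    rewrite (fge (l + _)%N) ?addnS ?ltnS //.
    by rewrite scaler0 subr0 uM.
  have lE : (l + M.+1)%N = q by apply/eqP; rewrite eqn_leq ql addnS lM.
  have Mq : (M < q)%N by rewrite -lE addnS ltnS leq_addl.
  rewrite lE Mq (uM q) ?leq_addr // eqxx.
  have -> : (q - M.+1)%N = l by lia.
  have -> : (l == q) = false by lia.
  by rewrite /GRing.scale /= mulr1 subrr.
have [e eU eq] := norm q.
have {}eq l : f (iter l B e) = (l == q)%:R by apply: eq; rewrite leq_addl.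
exists e, q.+1; split; last by move=> l; rewrite eqSS.
(* [f (B^k (B^l e))] is 1 exactly when [k + l = q], so [f B^(q-l)] is the coordinate dual to
   [B^l e]. *)
have span u : u \in U -> u = \sum_(0 <= l < q.+1) f (iter (q - l) B u) *: iter l B e.
  move=> uU; apply/eqP; rewrite -subr_eq0; apply/eqP; apply: fsep.
    by rewrite memvB // memv_suml // => l _; rewrite memvZ // BlU.
  move=> k; rewrite iter_linB iter_lin_sum linearB linear_sum /=.
  have [qk|kq] := ltnP q k.
    rewrite fge // sub0r; apply/eqP; rewrite oppr_eq0 big1 // => l _.
    rewrite iter_linZ linearZ /= -iterD (fge (k + l)%N) ?scaler0 //.
    by apply: leq_trans qk _; rewrite leq_addr.
  rewrite (bigD1_seq (q - k)%N) ?iota_uniq ?mem_index_iota ?ltnS ?leq_subr //=.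
  rewrite subKn // big1_seq ?addr0.
    by rewrite iter_linZ linearZ /= -iterD (eq (k + _)%N) subnKC // eqxx /GRing.scale /= mulr1 subrr.
  move=> l /andP[lqk _]; rewrite iter_linZ linearZ /= -iterD (eq (k + l)%N).
  case: eqP => [kl|]; last by rewrite scaler0.
  by move: lqk; rewrite -kl addKn eqxx.
split=> //.
- by move=> u uU; exists (fun l => f (iter (q - l) B u)); apply: span.
- apply: fsep; first exact: BlU.
  by move=> l; rewrite -iterD fge // leq_addl.
- move=> _ /=; apply/negP => /eqP /(congr1 f); rewrite linear0 eq eqxx.
  by apply/eqP; rewrite oner_eq0.
Qed.

Lemma dual_basis (V : vectType K) (I : eqType) (s : seq I) (E : I -> V) :
  uniq s ->
  (forall a : I -> K, \sum_(i <- s) a i *: E i = 0 -> {in s, forall i, a i = 0}) ->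
  (forall u, exists a : I -> K, u = \sum_(i <- s) a i *: E i) ->
  exists c : I -> 'Hom(V, K^o),
    (forall i j, i \in s -> j \in s -> c i (E j) = (i == j)%:R) /\
    (forall u, u = \sum_(i <- s) (c i u : K) *: E i).
Proof.
move=> us Efree Espan.
have [a aE] := choice Espan.
have aU u (b : I -> K) : u = \sum_(i <- s) b i *: E i -> {in s, forall i, a u i = b i}.
  move=> ub i si; apply/eqP; rewrite -subr_eq0; apply/eqP.
  apply: (Efree (fun i => a u i - b i)) si.
  under eq_bigr do rewrite scalerBl.
  by rewrite sumrB -aE -ub subrr.
pose c0 i (u : V) : K^o := if i \in s then a u i else 0.
have c0lin i : linear (c0 i).
  move=> k u v; rewrite /c0; case: ifP => si; last by rewrite scaler0 addr0.
  rewrite (aU (k *: u + v) (fun i => k * a u i + a v i)) //.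
  rewrite [in LHS](aE u) [in LHS](aE v) scaler_sumr -big_split /=.
  by apply: eq_bigr => j _; rewrite scalerDl scalerA.
pose cl i := GRing.isLinear.Build K V K^o *:%R (c0 i) (c0lin i).
pose c i : 'Hom(V, K^o) := linfun (HB.pack (c0 i) (cl i) : {linear V -> K^o}).
have cE i u : c i u = c0 i u by rewrite /c lfunE.
exists c; split=> [i j si sj|u].
  rewrite cE /c0 si (aU (E j) (fun i => (i == j)%:R)) //.
  rewrite (bigD1_seq j) //= eqxx scale1r big1 ?addr0 // => k /negbTE ->.
  by rewrite scale0r.
rewrite {1}(aE u); apply: eq_big_seq => i si.
by rewrite cE /c0 si.
Qed.

End LinearPredicates.

(** * Stability tested on linear predicates *)

Section PredicateStability.
Variables (n : nat) (w : 'I_n -> nat) (K : fieldType) (r : segment w -> nat).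
Implicit Types (m : bow_maps K r) (P : forall z : segment w, bowV K r z -> Prop).
Local Notation xin := (xin w).
Local Notation xout := (xout w).

Definition inv_pred m P : Prop :=
  [/\ forall z u, P z u -> P z (mB m z u),
      forall x u, P (xout x) u -> P (xin x) (mA m x u),
      forall h u, P (hout h) u -> P (hin h) (mC m h u) &
      forall h u, P (hin h) u -> P (hout h) (mD m h u)].

Lemma cross_eqE m x u : cross_eq m ->
  mB m (xin x) (mA m x u) + ma m x (mb m x u) = mA m x (mB m (xout x) u).
Proof.
move=> /(_ x) /lfunP /(_ u); rewrite !(add_lfunE, opp_lfunE, comp_lfunE, zero_lfunE).
by move/eqP; rewrite addrAC subr_eq0 => /eqP.
Qed.

Lemma circ_eq_in m h u : circ_eq m -> mC m h (mD m h u) = - mB m (hin h) u.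
Proof.
move=> /(_ h) [/lfunP /(_ u) + _]; rewrite add_lfunE comp_lfunE zero_lfunE => /eqP.
by rewrite addr_eq0 => /eqP.
Qed.

Lemma circ_eq_out m h u : circ_eq m -> mD m h (mC m h u) = - mB m (hout h) u.
Proof.
move=> /(_ h) [_ /lfunP /(_ u)]; rewrite add_lfunE comp_lfunE zero_lfunE => /eqP.
by rewrite addr_eq0 => /eqP.
Qed.

Lemma circ_eq_CB m h u : circ_eq m ->
  mC m h (mB m (hout h) u) = mB m (hin h) (mC m h u).
Proof.
move=> Hm; apply: oppr_inj; rewrite -linearN -circ_eq_out //=.
by rewrite circ_eq_in.
Qed.

Lemma circ_eq_DB m h u : circ_eq m ->
  mD m h (mB m (hin h) u) = mB m (hout h) (mD m h u).
Proof.
move=> Hm; apply: oppr_inj; rewrite -linearN -circ_eq_in //=.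
by rewrite circ_eq_out.
Qed.

Lemma cond_S1P m x (P : bowV K r (xout x) -> Prop) : cond_S1 m -> lin_pred P ->
  (forall u, P u -> P (mB m (xout x) u)) ->
  (forall u, P u -> mA m x u = 0) -> (forall u, P u -> mb m x u = 0) ->
  forall u, P u -> u = 0.
Proof.
move=> S1 PL PB PA Pb u Pu; have [S SP] := lin_pred_vspace PL.
have S0 : S = 0%VS.
  apply: (S1 x).
  - by apply/subvP => _ /memv_imgP [v /SP Pv ->]; apply/SP/PB.
  - by apply/eqP; rewrite -subv0; apply/subvP => _ /memv_imgP [v /SP Pv ->];
       rewrite PA ?mem0v.
  - by apply/eqP; rewrite -subv0; apply/subvP => _ /memv_imgP [v /SP Pv ->];
       rewrite Pb ?mem0v.
by have := (SP u).2 Pu; rewrite S0 memv0 => /eqP.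
Qed.

Lemma cond_S2P m x (P : bowV K r (xin x) -> Prop) : cond_S2 m -> lin_pred P ->
  (forall u, P u -> P (mB m (xin x) u)) ->
  (forall u, P (mA m x u)) -> (forall u, P (ma m x u)) ->
  forall u, P u.
Proof.
move=> S2 PL PB PA Pa u; have [S SP] := lin_pred_vspace PL.
suff S1 : S = fullv by apply/SP; rewrite S1 memvf.
apply: (S2 x).
  by apply/subvP => _ /memv_imgP [v /SP Pv ->]; apply/SP/PB.
apply/subvP => _ /memv_addP [_ /memv_imgP [v _ ->] [_ /memv_imgP [k _ ->] ->]].
by apply/SP; apply: (lin_predD PL).
Qed.

(** Only surjectivity of [A] on the subspace needs checking: where [b] vanishes, the kernel of [A]
    is [B]-stable by the cross equation, and (S1) makes it zero. *)
Lemma stable_subP m P : bow_data m -> stable_sub m ->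
  (forall z, lin_pred (@P z)) -> inv_pred m P ->
  (forall x u, P (xout x) u -> mb m x u = 0) ->
  (forall x v, P (xin x) v -> exists2 u, P (xout x) u & v = mA m x u) ->
  forall z u, P z u -> u = 0.
Proof.
move=> [cr S1 S2 ci] st PL [PB PA PC PD] Pb Psurj z u Pu.
pose S z := projT1 (lin_pred_vspace (PL z)).
have SP z0 u0 : u0 \in S z0 <-> P z0 u0.
  exact: (projT2 (lin_pred_vspace (PL z0)) u0).
have img (z1 z2 : segment w) (F : 'Hom(bowV K r z1, bowV K r z2)) :
    (forall u, P z1 u -> P z2 (F u)) -> (F @: S z1 <= S z2)%VS.
  by move=> PF; apply/subvP => _ /memv_imgP [v /SP Pv ->]; apply/SP/PF.
suff S0 : S z = 0%VS by have := (SP z u).2 Pu; rewrite S0 memv0 => /eqP.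
apply: st => [|x|x].
- by split=> *; apply: img => v; [apply: PB|apply: PA|apply: PC|apply: PD].
- apply/eqP; rewrite -subv0; apply/subvP => _ /memv_imgP [v /SP Pv ->].
  by rewrite (Pb x) ?mem0v.
- split; last first.
    apply/eqP; rewrite eqEsubv img //=; last exact: PA.
    by apply/subvP => v /SP /Psurj [y /SP Sy ->]; apply: memv_img.
  move=> a b /SP Pa /SP Pb' ab; apply/eqP; rewrite -subr_eq0; apply/eqP.
  apply: (@cond_S1P m x (fun u => P _ u /\ mA m x u = 0)) => //.
  - split; first by split; [case: (PL (xout x)) | rewrite linear0].
    move=> k y y' [Py Ay] [Py' Ay']; split; first by apply: (PL (xout x)).2.
    by rewrite linearP /= Ay Ay' scaler0 addr0.
  - move=> y [Py Ay]; split; first exact: PB.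
    by rewrite -cross_eqE // Ay (Pb x) // !linear0 addr0.
  - by move=> y [].
  - by move=> y [/Pb].
  - split; last by rewrite linearB /= ab subrr.
    by apply: (lin_predD (PL _)) => //; apply: (lin_predN (PL _)).
Qed.

(** Dually, [P] plus the image of [A] is [B]-stable by the cross equation and contains the image of
    [a], so (S2) gives surjectivity of [A] modulo [P]; only injectivity needs checking. *)
Lemma stable_quotP m P : bow_data m -> stable_quot m ->
  (forall z, lin_pred (@P z)) -> inv_pred m P ->
  (forall x k, P (xin x) (ma m x k)) ->
  (forall x u, P (xin x) (mA m x u) -> P (xout x) u) ->
  forall z u, P z u.
Proof.
move=> [cr S1 S2 ci] st PL [PB PA PC PD] Pa Pinj z u.
pose S z := projT1 (lin_pred_vspace (PL z)).
have SP z0 u0 : u0 \in S z0 <-> P z0 u0.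
  exact: (projT2 (lin_pred_vspace (PL z0)) u0).
have img (z1 z2 : segment w) (F : 'Hom(bowV K r z1, bowV K r z2)) :
    (forall u, P z1 u -> P z2 (F u)) -> (F @: S z1 <= S z2)%VS.
  by move=> PF; apply/subvP => _ /memv_imgP [v /SP Pv ->]; apply/SP/PF.
suff S1z : S z = fullv by apply/SP; rewrite S1z memvf.
apply: st => [|x|x].
- by split=> *; apply: img => v; [apply: PB|apply: PA|apply: PC|apply: PD].
- by apply/subvP => _ /memv_imgP [v _ ->]; apply/SP.
- split=> [|y /SP /Pinj /SP //|]; first by apply: img; apply: PA.
  suff H : forall v, exists y, P (xin x) (v - mA m x y).
    by move=> v; have [y /SP] := H v; exists y.
  apply: (@cond_S2P m x (fun v => exists y, P (xin x) (v - mA m x y))) => //.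
  - split; first by exists 0; rewrite linear0 subrr; case: (PL (xin x)).
    move=> k v v' [y Py] [y' Py']; exists (k *: y + y').
    rewrite linearP /= opprD addrACA -scalerBr; exact: (PL (xin x)).2.
  - move=> v [y Py]; exists (mB m (xout x) y).
    rewrite -cross_eqE // opprD addrA -linearB /=.
    by apply: (lin_predD (PL _)); [apply: PB | apply: (lin_predN (PL _))].
  - by move=> y; exists y; rewrite subrr; case: (PL (xin x)).
  - by move=> k; exists 0; rewrite linear0 subr0.
Qed.

End PredicateStability.

(** * Gradings *)

(** [Negz t] is the degree -(t+1). Thus [Posz t] and [Negz t] are both reached from the base of a
    line after passing [t] x-points, to the right and to the left, and matching on constructors fits
    the recursions along lines. *)
Definition degS (d : int) : int :=
  match d with Posz t => Posz t.+1 | Negz 0 => Posz 0 | Negz t.+1 => Negz t end.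
Definition degP (d : int) : int :=
  match d with Posz 0 => Negz 0 | Posz t.+1 => Posz t | Negz t => Negz t.+1 end.

Lemma degPK : cancel degP degS. Proof. by do 2?case. Qed.
Lemma degSK : cancel degS degP. Proof. by do 2?case. Qed.
Lemma degS_inj : injective degS. Proof. exact: can_inj degSK. Qed.

Definition degrees T : seq int :=
  [seq Posz t | t <- iota 0 T] ++ [seq Negz t | t <- iota 0 T].

Lemma mem_Posz T t : (Posz t \in degrees T) = (t < T)%N.
Proof.
rewrite mem_cat orbC; case: mapP => [[] //|_] /=.
by rewrite mem_map ?mem_iota // => x y [].
Qed.

Lemma mem_Negz T t : (Negz t \in degrees T) = (t < T)%N.
Proof.
rewrite mem_cat; case: mapP => [[] //|_] /=.
by rewrite mem_map ?mem_iota // => x y [].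
Qed.

Lemma degrees_uniq T : uniq (degrees T).
Proof.
rewrite cat_uniq !map_inj_uniq ?iota_uniq ?andbT //=; try by move=> x y [].
by apply/hasPn => _ /mapP [t _ ->]; apply/mapP => -[].
Qed.

Section Grading.
Variables (n : nat) (w : 'I_n -> nat) (K : fieldType) (r : segment w -> nat).
Variable m : bow_maps K r.
Local Notation xin := (xin w).
Local Notation xout := (xout w).
Local Notation V := (bowV K r).

(* The eigenspace decomposition for a one-parameter subgroup of the torus,
   indexed so that every [A] has degree one. *)
Record grading (hom : forall z : segment w, int -> {vspace V z})
    (pi : forall z : segment w, int -> 'End(V z)) (T : nat) : Prop := Grading {
  gr_B : forall z d u, u \in hom z d -> mB m z u \in hom z d;
  gr_A : forall x d u, u \in hom (xout x) d -> mA m x u \in hom (xin x) (degS d);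
  gr_C : forall h d u, u \in hom (hout h) d -> mC m h u \in hom (hin h) d;
  gr_D : forall h d u, u \in hom (hin h) d -> mD m h u \in hom (hout h) d;
  gr_a : forall x k, ma m x k \in hom (xin x) (Posz 0);
  gr_b : forall x d u, d != Negz 0 -> u \in hom (xout x) d -> mb m x u = 0;
  gr_bound : forall z d u, d \notin degrees T -> u \in hom z d -> u = 0;
  gr_pi : forall z d u, pi z d u \in hom z d;
  gr_piE : forall z d d' u, u \in hom z d' -> pi z d u = if d == d' then u else 0;
  gr_sum : forall z u, u = \sum_(d <- degrees T) pi z d u }.

Variables (hom : forall z : segment w, int -> {vspace V z}).
Variables (pi : forall z : segment w, int -> 'End(V z)) (T : nat).
Hypothesis gr : grading hom pi T.
Hypotheses (bm : bow_data m) (ss : stable_sub m) (sq : stable_quot m).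

Let cr : cross_eq m. Proof. by case: bm. Qed.
Let ci : circ_eq m. Proof. by case: bm. Qed.

Definition graded_inv (P : forall z : segment w, int -> V z -> Prop) : Prop :=
  [/\ forall z d u, P z d u -> P z d (mB m z u),
      forall x d u, P (xout x) d u -> P (xin x) (degS d) (mA m x u),
      forall h d u, P (hout h) d u -> P (hin h) d (mC m h u) &
      forall h d u, P (hin h) d u -> P (hout h) d (mD m h u)].

Inductive gr_span (P : forall z : segment w, int -> V z -> Prop) z : V z -> Prop :=
| gr_span0 : gr_span P 0
| gr_spanD d v u : P z d v -> gr_span P u -> gr_span P (v + u).

Lemma gr_span_lin P z : (forall z d, lin_pred (@P z d)) -> lin_pred (@gr_span P z).
Proof.
move=> PL; split; first exact: gr_span0.
move=> a u v Pu Pv; elim: Pu => [|d v' u' Pv' _ IH]; first by rewrite scaler0 add0r.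
rewrite scalerDr -addrA; apply: gr_spanD IH; exact: (lin_predZ _ (PL z d)).
Qed.

Lemma gr_span1 (P : forall z : segment w, int -> V z -> Prop) z d u :
  P z d u -> gr_span P u.
Proof. by move=> Pu; rewrite -[u]addr0; apply: gr_spanD Pu _; apply: gr_span0. Qed.

Lemma gr_span_inv P : graded_inv P -> inv_pred m (@gr_span P).
Proof.
move=> [PB PA PC PD]; split=> [z|x|h|h] u; elim=> [|d v' u' Pv' _ IH];
  rewrite ?linear0 ?linearD; try exact: gr_span0; apply: gr_spanD IH.
- exact: PB Pv'.
- exact: PA Pv'.
- exact: PC Pv'.
- exact: PD Pv'.
Qed.

(** The span of the homogeneous pieces meets the conditions of [stable_subP]; outside degree -1 the
    map [b] vanishes by the grading. *)
Lemma graded_stable_sub (P : forall z : segment w, int -> V z -> Prop) :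
  (forall z d, lin_pred (@P z d)) -> graded_inv P ->
  (forall z d u, P z d u -> u \in hom z d) ->
  (forall x u, P (xout x) (Negz 0) u -> mb m x u = 0) ->
  (forall x d v, P (xin x) (degS d) v ->
     exists2 u, P (xout x) d u & v = mA m x u) ->
  forall z d u, P z d u -> u = 0.
Proof.
move=> PL Pinv Phom Pb Psurj z d u Pu.
apply: (@stable_subP _ _ _ _ m (@gr_span P)) (gr_span1 Pu) => //.
- by move=> z'; apply: gr_span_lin.
- exact: gr_span_inv.
- move=> x v; elim=> [|d' v' u' Pv' _ IH]; first by rewrite linear0.
  rewrite linearD /= IH addr0; have [d0|d0] := eqVneq d' (Negz 0).
    by subst d'; apply: Pb.
  by apply: (gr_b gr d0); apply: Phom Pv'.
- move=> x v; elim=> [|d' v' u' Pv' _ [y Py ->]].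
    by exists 0; [apply: gr_span0 | rewrite linear0].
  rewrite -[d']degPK in Pv'; have [y' Py' ->] := Psurj _ _ _ Pv'.
  by exists (y' + y); [apply: gr_spanD Py' Py | rewrite linearD].
Qed.

Lemma gr_pi_comm z z' (F : 'Hom(V z, V z')) (f : int -> int) : injective f ->
  (forall d u, u \in hom z d -> F u \in hom z' (f d)) ->
  forall d u, pi z' (f d) (F u) = F (pi z d u).
Proof.
move=> f_inj Fh d u.
rewrite {1}(gr_sum gr u) linear_sum linear_sum /=.
rewrite [in RHS](gr_sum gr u) linear_sum linear_sum /=; apply: eq_bigr => d' _.
have H := gr_pi gr d' u.
rewrite (gr_piE gr _ (Fh _ _ H)) (gr_piE gr _ H) (inj_eq f_inj).
by case: ifP; rewrite ?linear0.
Qed.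

Lemma gr_pi_A x d u : pi (xin x) (degS d) (mA m x u) = mA m x (pi (xout x) d u).
Proof. by apply: gr_pi_comm => // [|d' v]; [apply: degS_inj | apply: (gr_A gr)]. Qed.

Lemma gr_pi_B z d u : pi z d (mB m z u) = mB m z (pi z d u).
Proof. by apply: (@gr_pi_comm _ _ _ id) => // d' v; apply: (gr_B gr). Qed.

Lemma graded_stable_quot (P : forall z : segment w, int -> V z -> Prop) :
  (forall z d, lin_pred (@P z d)) -> graded_inv P ->
  (forall x k, P (xin x) (Posz 0) (ma m x k)) ->
  (forall x d u, u \in hom (xout x) d -> P (xin x) (degS d) (mA m x u) ->
     P (xout x) d u) ->
  forall z d u, u \in hom z d -> P z d u.
Proof.
move=> PL Pinv Pa Pinj z d u uhom.
(* [P] may contain inhomogeneous vectors; after cutting it down, the projections recover membership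
   in [P] from membership in the span. *)
pose P' z d u := P z d u /\ u \in hom z d.
have P'L z0 d0 : lin_pred (@P' z0 d0).
  split; first by split; [case: (PL z0 d0)|apply: mem0v].
  move=> k y y' [Py hy] [Py' hy']; split; first exact: (PL z0 d0).2.
  by rewrite memvD // memvZ.
have P'pi z0 v d0 : gr_span P' v -> P z0 d0 (pi z0 d0 v).
  elim=> [|d' v' u' [Pv' hv'] _ IH].
    by rewrite linear0; case: (PL z0 d0).
  rewrite linearD /=; apply: (lin_predD (PL _ _)) => //.
  rewrite (gr_piE gr _ hv'); case: eqP => [->//|_]; by case: (PL z0 d0).
suff H : gr_span P' u by have := P'pi z u d H; rewrite (gr_piE gr _ uhom) eqxx.
case: Pinv => PB PA PC PD.
apply: (@stable_quotP _ _ _ _ m (@gr_span P')) => //.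
- by move=> z'; apply: gr_span_lin.
- apply: gr_span_inv; split=> [z' d' v|x d' v|h d' v|h d' v] [Pv hv]; split.
  + exact: PB.
  + exact: (gr_B gr).
  + exact: PA.
  + exact: (gr_A gr).
  + exact: PC.
  + exact: (gr_C gr).
  + exact: PD.
  + exact: (gr_D gr).
- move=> x k; apply: (@gr_span1 P' _ (Posz 0)); split; first exact: Pa.
  exact: (gr_a gr).
- move=> x v Av; rewrite (gr_sum gr v).
  apply: (@lin_pred_sum _ _ (@gr_span P' (xout x))) => [|d' _]; first exact: gr_span_lin.
  apply: (@gr_span1 P' _ d'); split; last exact: (gr_pi gr).
  apply: Pinj; first exact: (gr_pi gr).
  by rewrite -gr_pi_A; apply: P'pi.
Qed.

(** Outside degree -1 there is no [b], so the kernel of [A] is [B]-stable and (S1) applies. *)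
Lemma gr_A_inj x d u : d != Negz 0 -> u \in hom (xout x) d -> mA m x u = 0 -> u = 0.
Proof.
move=> d0 uh Au; case: bm => _ S1 _ _.
apply: (@cond_S1P _ _ _ _ m x
  (fun u => u \in hom (xout x) d /\ mA m x u = 0)) => //.
- split; first by rewrite mem0v linear0.
  move=> k y y' [Py hy] [Py' hy']; split; first by rewrite memvD // memvZ.
  by rewrite linearP /= hy hy' scaler0 addr0.
- move=> y [hy Ay]; split; first exact: (gr_B gr).
  by rewrite -cross_eqE // Ay (gr_b gr d0 hy) !linear0 addr0.
- by move=> y [].
- by move=> y [hy _]; apply: (gr_b gr d0 hy).
Qed.

Lemma gr_A_surj x d v : d != Negz 0 -> v \in hom (xin x) (degS d) ->
  exists2 u, u \in hom (xout x) d & v = mA m x u.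
Proof.
move=> d0 vh; case: bm => _ _ S2 _.
(* (S2) is applied to the vectors whose component of degree [degS d] comes from [A]; the image of
   [a] has no such component, because [degS d] is not 0. *)
have := @cond_S2P _ _ _ _ m x (fun v => exists2 u, u \in hom (xout x) d &
  pi (xin x) (degS d) v = mA m x u) S2.
move=> /(_ _ _ _ _ v) []; last by move=> u uh; rewrite (gr_piE gr _ vh) eqxx; exists u.
- split; first by exists 0; rewrite ?mem0v // !linear0.
  move=> k y y' [u hu yu] [u' hu' yu']; exists (k *: u + u').
    by rewrite memvD // memvZ.
  by rewrite !linearP /= yu yu'.
- move=> y [u hu yu]; exists (mB m (xout x) u); first exact: (gr_B gr).
  by rewrite -cross_eqE // (gr_b gr d0 hu) linear0 addr0 -yu gr_pi_B.
- move=> u; exists (pi (xout x) d u); [exact: (gr_pi gr) | exact: gr_pi_A].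
- move=> k; exists 0; rewrite ?mem0v // linear0 (gr_piE gr _ (gr_a gr x k)).
  by case: (d) d0 => [|[]].
Qed.

End Grading.

Section LinPredOps.
Variables (K : fieldType) (V V' : vectType K).

Lemma lin_pred_mem (U : {vspace V}) : lin_pred (fun u => u \in U).
Proof. by split=> [|k u v hu hv]; rewrite ?mem0v // memvD // memvZ. Qed.

Lemma lin_pred0 : lin_pred (fun u : V => u = 0).
Proof. by split=> // k u v -> ->; rewrite scaler0 addr0. Qed.

Lemma lin_pred_and (P Q : V -> Prop) :
  lin_pred P -> lin_pred Q -> lin_pred (fun u => P u /\ Q u).
Proof. by move=> [P0 PL] [Q0 QL]; split=> // k u v [? ?] [? ?]; split; auto. Qed.

Lemma lin_pred_preim (P : V' -> Prop) (F : 'Hom(V, V')) :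
  lin_pred P -> lin_pred (fun u => P (F u)).
Proof.
by move=> [P0 PL]; split=> [|k u v ? ?]; rewrite ?linear0 // linearP; apply: PL.
Qed.

Lemma lin_pred_img (P : V -> Prop) (F : 'Hom(V, V')) :
  lin_pred P -> lin_pred (fun v => exists2 u, P u & v = F u).
Proof.
move=> [P0 PL]; split=> [|k _ _ [u Pu ->] [v Pv ->]]; first by exists 0; rewrite ?linear0.
by exists (k *: u + v); [apply: PL | rewrite linearP].
Qed.

Lemma lin_pred_add (P Q : V -> Prop) :
  lin_pred P -> lin_pred Q -> lin_pred (fun v => exists u k, [/\ P u, Q k & v = u + k]).
Proof.
move=> [P0 PL] [Q0 QL]; split=> [|k _ _ [u [q [? ? ->]]] [u' [q' [? ? ->]]]].
  by exists 0, 0; rewrite addr0.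
exists (k *: u + u'), (k *: q + q'); split; [exact: PL | exact: QL |].
by rewrite scalerDr addrACA.
Qed.

Lemma lin_pred_all I (P : I -> V -> Prop) :
  (forall i, lin_pred (P i)) -> lin_pred (fun v => forall i, P i v).
Proof.
move=> PL; split=> [i|k u v Pu Pv i]; first by case: (PL i).
by apply: (PL i).2.
Qed.

End LinPredOps.

(** * The graded pieces on the two sides of an x-point *)

Section ActivePoint.
Variables (n : nat) (w : 'I_n -> nat) (K : fieldType) (r : segment w -> nat).
Variable m : bow_maps K r.
Local Notation xin := (xin w).
Local Notation xout := (xout w).
Local Notation V := (bowV K r).

Variables (hom : forall z : segment w, int -> {vspace V z}).
Variables (pi : forall z : segment w, int -> 'End(V z)) (T : nat).
Hypothesis gr : grading m hom pi T.
Hypotheses (bm : bow_data m) (ss : stable_sub m) (sq : stable_quot m).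

Let cr : cross_eq m. Proof. by case: bm. Qed.
Let ci : circ_eq m. Proof. by case: bm. Qed.

Definition posneg (Sp Sn : forall z : segment w, nat -> V z -> Prop)
    (z : segment w) (d : int) : V z -> Prop :=
  match d with Posz t => @Sp z t | Negz t => @Sn z t end.

Lemma cross_comm x u : mb m x u = 0 ->
  mA m x (mB m (xout x) u) = mB m (xin x) (mA m x u).
Proof. by move=> bu; rewrite -cross_eqE // bu linear0 addr0. Qed.

Lemma gr_AB x d u : d != Negz 0 -> u \in hom (xout x) d ->
  mA m x (mB m (xout x) u) = mB m (xin x) (mA m x u).
Proof. by move=> d0 /(gr_b gr d0); apply: cross_comm. Qed.

(** The vectors that [b] never sees spread to a graded subspace: to the left all vectors which [C]
    and [A] carry into them, to the right their images under [A] and [C]. Invariance under [C] and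
    [D] comes from [C D = - B] and [D C = - B], and stability makes the subspace zero. *)
Lemma gr_b_cocyclic x u : u \in hom (xout x) (Negz 0) ->
  (forall l, mb m x (iter l (mB m (xout x)) u) = 0) -> u = 0.
Proof.
move=> uh ub.
have [Sn [n0 nC nA]] := @line_rec_left n w (fun z t => V z -> Prop)
  (fun j u => u \in hom (xout j) (Negz 0) /\
     forall l, mb m j (iter l (mB m (xout j)) u) = 0)
  (fun h t S u => u \in hom (hout h) (Negz t) /\ S (mC m h u))
  (fun x t S u => u \in hom (xout x) (Negz t.+1) /\ S (mA m x u)).
have [Sp [p0 pC pA]] := @line_rec_right n w (fun z t => V z -> Prop)
  (fun j v => exists2 u, Sn (xout j) 0%N u & v = mA m j u)
  (fun h t S v => exists2 u, S u & v = mC m h u)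
  (fun x t S v => exists2 u, S u & v = mA m x u).
have nL : forall z t, lin_pred (Sn z t).
  apply: line_ind_left => [j|h t IH|y t IH]; rewrite ?n0 ?nC ?nA.
  - apply: lin_pred_and; first exact: lin_pred_mem.
    apply: lin_pred_all => l; split=> [|k y y' by_ by'].
      by rewrite iter_lin0 linear0.
    by rewrite iter_linear linearP /= by_ by' scaler0 addr0.
  - by apply: lin_pred_and; [apply: lin_pred_mem | apply: lin_pred_preim].
  - by apply: lin_pred_and; [apply: lin_pred_mem | apply: lin_pred_preim].
have nB : forall z t u, Sn z t u -> Sn z t (mB m z u).
  apply: line_ind_left => [j|h t IH|y t IH] v; rewrite ?n0 ?nC ?nA.
  - move=> [hv bv]; split; first exact: (gr_B gr).
    by move=> l; rewrite -iterSr.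
  - move=> [hv Sv]; split; first exact: (gr_B gr).
    by rewrite circ_eq_CB //; apply: IH.
  - move=> [hv Sv]; split; first exact: (gr_B gr).
    by rewrite (gr_AB _ hv) //; apply: IH.
have nh : forall z t u, Sn z t u -> u \in hom z (Negz t).
  by apply: line_ind_left => [j|h t IH|y t IH] v; rewrite ?n0 ?nC ?nA => -[].
have pL : forall z t, lin_pred (Sp z t).
  by apply: line_ind_right => [j|h t IH|y t IH]; rewrite ?p0 ?pC ?pA;
    apply: lin_pred_img.
have ph : forall z t u, Sp z t u -> u \in hom z (Posz t).
  apply: line_ind_right => [j|h t IH|y t IH] v; rewrite ?p0 ?pC ?pA => -[v' Sv ->].
  - exact: (gr_A gr (nh _ _ _ Sv)).
  - exact/(gr_C gr)/IH.
  - exact: (gr_A gr (IH _ Sv)).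
have pB : forall z t u, Sp z t u -> Sp z t (mB m z u).
  apply: line_ind_right => [j|h t IH|y t IH] v; rewrite ?p0 ?pC ?pA => -[v' Sv ->].
  - exists (mB m _ v'); first exact: nB.
    by rewrite cross_comm //; move: Sv; rewrite n0 => -[_ /(_ 0%N)].
  - by exists (mB m _ v'); [apply: IH | rewrite circ_eq_CB].
  - by exists (mB m _ v'); [apply: IH | rewrite (@gr_AB _ (Posz t)) //; apply: ph].
have lin z d : lin_pred (@posneg Sp Sn z d) by case: d => t; [apply: pL | apply: nL].
apply: (@graded_stable_sub _ _ _ _ m _ _ _ gr bm ss (posneg Sp Sn)) (Negz 0) _ _ => //.
- split.
  + by move=> z [t|t] v /=; [apply: pB | apply: nB].
  + move=> y [t|[|t]] v /=; rewrite ?pA ?p0.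
    * by move=> Sv; exists v.
    * by move=> Sv; exists v.
    * by rewrite nA => -[].
  + move=> h [t|t] v /=; first by rewrite pC => Sv; exists v.
    by rewrite nC => -[].
  + move=> h [t|t] v /=.
      by rewrite pC => -[v' Sv ->]; rewrite circ_eq_out //; apply: (lin_predN (pL _ _)); apply: pB.
    rewrite nC => Sv; split; first exact/(gr_D gr)/nh.
    by rewrite circ_eq_in //; apply: (lin_predN (nL _ _)); apply: nB.
- by move=> z [t|t] v /=; [apply: ph | apply: nh].
- by move=> y v /=; rewrite n0 => -[_ /(_ 0%N)].
- move=> y [t|[|t]] v /=; rewrite ?pA ?p0; try by move=> [v' Sv ->]; exists v'.
  move=> Sv; have [//|v' hv' vE] := gr_A_surj gr bm (d := Negz t.+1) _ (nh _ _ _ Sv).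
  by exists v' => //; rewrite nA; split=> //; rewrite -vE.
- by rewrite /= n0.
Qed.

(** The dual construction: the vectors generated by [a] are continued to the right by preimages
    under [D] and images under [A], and to the left by preimages under [A] and [C]. The result
    contains the image of [a], so stability makes it everything. *)
Lemma gr_a_cyclic x v : v \in hom (xin x) (Posz 0) ->
  exists c : nat -> K, exists M,
  v = \sum_(0 <= l < M) c l *: iter l (mB m (xin x)) (ma m x 1).
Proof.
move=> vh.
pose cycl j v := exists c : nat -> K, exists M,
  v = \sum_(0 <= l < M) c l *: iter l (mB m (xin j)) (ma m j 1).
have cycL j : lin_pred (@cycl j).
  split; first by exists (fun=> 0), 0%N; rewrite big_geq.
  move=> k _ _ [c [M ->]] [c' [M' ->]].
  exists (fun l => k * (if (l < M)%N then c l else 0) + (if (l < M')%N then c' l else 0)).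
  exists (maxn M M').
  under [RHS]eq_bigr do rewrite scalerDl.
  rewrite big_split /=; congr (_ + _).
    rewrite scaler_sumr (big_nat_widen _ M (maxn M M')) ?leq_maxl // big_mkcond /=.
    by apply: eq_bigr => l _; case: ifP; rewrite ?scalerA // mulr0 scale0r.
  rewrite (big_nat_widen _ M' (maxn M M')) ?leq_maxr // big_mkcond /=.
  by apply: eq_bigr => l _; case: ifP; rewrite // scale0r.
have cycB j y : cycl j y -> cycl j (mB m _ y).
  move=> [c [M ->]]; exists (fun l => if l is l'.+1 then c l' else 0), M.+1.
  rewrite big_nat_recl // scale0r add0r linear_sum /=.
  by apply: eq_bigr => l _; rewrite linearZ.
have [Sp [p0 pC pA]] := @line_rec_right n w (fun z t => V z -> Prop)
  (fun j v => cycl j v /\ v \in hom (xin j) (Posz 0))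
  (fun h t S v => v \in hom (hin h) (Posz t) /\ S (mD m h v))
  (fun x t S v => exists2 u, S u & v = mA m x u).
have [Sn [n0 nC nA]] := @line_rec_left n w (fun z t => V z -> Prop)
  (fun j u => u \in hom (xout j) (Negz 0) /\ Sp (xin j) 0%N (mA m j u))
  (fun h t S u => u \in hom (hout h) (Negz t) /\ S (mC m h u))
  (fun x t S u => u \in hom (xout x) (Negz t.+1) /\ S (mA m x u)).
have pL : forall z t, lin_pred (Sp z t).
  apply: line_ind_right => [j|h t IH|y t IH]; rewrite ?p0 ?pC ?pA.
  - by apply: lin_pred_and; [apply: cycL | apply: lin_pred_mem].
  - by apply: lin_pred_and; [apply: lin_pred_mem | apply: lin_pred_preim].
  - exact: lin_pred_img.
have nL : forall z t, lin_pred (Sn z t).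
  by apply: line_ind_left => [j|h t IH|y t IH]; rewrite ?n0 ?nC ?nA;
    (apply: lin_pred_and; [apply: lin_pred_mem | apply: lin_pred_preim]).
have ph : forall z t u, Sp z t u -> u \in hom z (Posz t).
  apply: line_ind_right => [j|h t IH|y t IH] u; rewrite ?p0 ?pC ?pA => -[] //.
  by move=> u' /IH hu ->; apply: (gr_A gr hu).
have nh : forall z t u, Sn z t u -> u \in hom z (Negz t).
  by apply: line_ind_left => [j|h t IH|y t IH] u; rewrite ?n0 ?nC ?nA => -[].
have pB : forall z t u, Sp z t u -> Sp z t (mB m z u).
  apply: line_ind_right => [j|h t IH|y t IH] u; rewrite ?p0 ?pC ?pA.
  - by move=> [/cycB ? ?]; split=> //; apply: (gr_B gr).
  - by move=> [hu /IH Su]; split; [apply: (gr_B gr) | rewrite circ_eq_DB].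
  - move=> [u' Su ->]; exists (mB m _ u'); first exact: IH.
    by rewrite (@gr_AB _ (Posz t)) //; apply: ph.
have Sa j k : Sp (xin j) 0%N (ma m j k).
  rewrite p0; split; last exact: (gr_a gr).
  exists (fun=> k), 1%N; rewrite big_nat1 /= -linearZ /=.
  by rewrite /GRing.scale /= mulr1.
have nB : forall z t u, Sn z t u -> Sn z t (mB m z u).
  apply: line_ind_left => [j|h t IH|y t IH] u; rewrite ?n0 ?nC ?nA.
  - move=> [hu Su]; split; first exact: (gr_B gr).
    by rewrite -cross_eqE //; apply: (lin_predD (pL _ _)) => //; apply: pB.
  - by move=> [hu /IH Su]; split; [apply: (gr_B gr) | rewrite circ_eq_CB].
  - by move=> [hu /IH Su]; split; [apply: (gr_B gr) | rewrite (gr_AB _ hu)].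
have lin z d : lin_pred (@posneg Sp Sn z d) by case: d => t; [apply: pL | apply: nL].
have Sv : posneg Sp Sn (Posz 0) v; last by move: Sv; rewrite /= p0 => -[].
apply: (@graded_stable_quot _ _ _ _ m _ _ _ gr bm sq (posneg Sp Sn)) => //.
- split.
  + by move=> z [t|t] u /=; [apply: pB | apply: nB].
  + move=> y [t|[|t]] u /=; rewrite ?pA ?n0 ?nA; try by case.
    by move=> Su; exists u.
  + move=> h [t|t] u /=; last by rewrite nC => -[].
    rewrite pC => Su; split; first exact/(gr_C gr)/ph.
    by rewrite circ_eq_out //; apply: (lin_predN (pL _ _)); apply: pB.
  + move=> h [t|t] u /=; first by rewrite pC => -[].
    rewrite nC => Su; split; first exact/(gr_D gr)/nh.
    by rewrite circ_eq_in //; apply: (lin_predN (nL _ _)); apply: nB.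
- move=> y [t|[|t]] u uh /=; rewrite ?pA ?n0 ?nA => Su; try by split.
  case: Su => u' Su' /eqP; rewrite -subr_eq0 -linearB /= => /eqP Au.
  have /eqP := gr_A_inj gr bm (d := Posz t) isT (memvB uh (ph _ _ _ Su')) Au.
  by rewrite subr_eq0 => /eqP ->.
Qed.

End ActivePoint.

(** The version of [cyc_iso] that pulls the generator back; on the left of the base point [A] points
    towards the base, against the recursion. *)
Lemma cyc_iso_pre (K : fieldType) (V V' : vectType K) (U : {vspace V})
    (U' : {vspace V'}) (B : 'End(V)) (B' : 'End(V')) (F : 'Hom(V, V')) e q :
  (forall u, u \in U -> B u \in U) ->
  (forall u, u \in U -> F u \in U') ->
  (forall u, u \in U -> F u = 0 -> u = 0) ->
  (forall u, u \in U -> F (B u) = B' (F u)) ->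
  e \in U -> cyclic_nilp U' B' (F e) q -> cyclic_nilp U B e q.
Proof.
move=> BU FU Finj FB eU [e'U espan enil elast].
have FBl := iter_comm BU FB.
have BlU := iter_mem BU.
split=> //.
- move=> u uU; have [c cE] := espan _ (FU _ uU); exists c.
  apply/eqP; rewrite -subr_eq0; apply/eqP; apply: Finj.
    by rewrite memvB // memv_suml // => l _; rewrite memvZ // BlU.
  rewrite linearB /= linear_sum /= cE; apply/eqP; rewrite subr_eq0; apply/eqP.
  by apply: eq_bigr => l _; rewrite linearZ /= FBl.
- by apply: Finj; rewrite ?BlU // FBl.
- move=> /elast; apply: contraNneq => /(congr1 F); rewrite FBl // linear0 => ->.
  exact: eqxx.
Qed.

(** * Generators of the strings and the drop of their lengths *)

Section StringGenerators.
Variables (n : nat) (w : 'I_n -> nat) (K : fieldType) (r : segment w -> nat).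
Variable m : bow_maps K r.
Local Notation xin := (xin w).
Local Notation xout := (xout w).
Local Notation V := (bowV K r).

(** What remains of a fixed point once the vectors are forgotten. The predecessor truncates at 0, so
    an exhausted string stays empty. *)
Record string_length (L : segment w -> int -> nat) T : Prop := StringLength {
  len_hin : forall h t, L (hin h) (Posz t) = (L (hout h) (Posz t)).-1;
  len_xin : forall x t, L (xin x) (Posz t.+1) = L (xout x) (Posz t);
  len_hout : forall h t, L (hout h) (Negz t) = (L (hin h) (Negz t)).-1;
  len_xout : forall x t, L (xout x) (Negz t.+1) = L (xin x) (Negz t);
  len_side : forall x, L (xin x) (Posz 0) = 0%N \/ L (xout x) (Negz 0) = 0%N;
  len_bound : forall z d, d \notin degrees T -> L z d = 0%N }.

Variables (hom : forall z : segment w, int -> {vspace V z}).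
Variables (pi : forall z : segment w, int -> 'End(V z)) (T : nat).
Hypothesis gr : grading m hom pi T.
Hypotheses (bm : bow_data m) (ss : stable_sub m) (sq : stable_quot m).

Let cr : cross_eq m. Proof. by case: bm. Qed.
Let ci : circ_eq m. Proof. by case: bm. Qed.

Lemma iter_CB h l u :
  mC m h (iter l (mB m (hout h)) u) = iter l (mB m (hin h)) (mC m h u).
Proof. by elim: l => //= l IH; rewrite circ_eq_CB // IH. Qed.

Lemma iter_DB h l u :
  mD m h (iter l (mB m (hin h)) u) = iter l (mB m (hout h)) (mD m h u).
Proof. by elim: l => //= l IH; rewrite circ_eq_DB // IH. Qed.

Lemma gr_Bl z d l u : u \in hom z d -> iter l (mB m z) u \in hom z d.
Proof. by move=> uh; elim: l => //= l IH; apply: (gr_B gr). Qed.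

Lemma iter_AB x d l u : d != Negz 0 -> u \in hom (xout x) d ->
  mA m x (iter l (mB m (xout x)) u) = iter l (mB m (xin x)) (mA m x u).
Proof.
move=> d0 uh; elim: l => //= l IH.
by rewrite (gr_AB gr bm d0) ?IH // gr_Bl.
Qed.

(** Induction from the far end of the lines, where the pieces vanish: [A] transports nilpotency, and
    an o-point costs one more power because [B^(N+1) = - D B^N C], or the same with [C] and [D]
    exchanged. *)
Lemma gr_nilp z d : exists N, forall u, u \in hom z d -> iter N (mB m z) u = 0.
Proof.
case: d => t; move: z t.
- apply: (@line_ind_from_right _ _ _ T) => [z t Tt|h t [N HN]|x t [N HN]].
  + exists 0%N => u uh /=; apply: (gr_bound gr) uh; by rewrite mem_Posz -leqNgt.
  + exists N.+1 => u uh; rewrite iterSr -[mB m _ u]opprK -circ_eq_out //.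
    by rewrite iter_linN -iter_DB HN ?linear0 ?oppr0 // (gr_C gr).
  + exists N => u uh; apply: (gr_A_inj gr bm (d := Posz t)) => //.
      exact: gr_Bl.
    by rewrite (iter_AB _ _ uh) // HN // (gr_A gr uh).
- apply: (@line_ind_from_left _ _ _ T) => [z t Tt|h t [N HN]|x t [N HN]].
  + exists 0%N => u uh /=; apply: (gr_bound gr) uh; by rewrite mem_Negz -leqNgt.
  + exists N.+1 => u uh; rewrite iterSr -[mB m _ u]opprK -circ_eq_in //.
    by rewrite iter_linN -iter_CB HN ?linear0 ?oppr0 // (gr_D gr).
  + exists N => v vh; have [//|u uh ->] := gr_A_surj gr bm (d := Negz t.+1) _ vh.
    by rewrite -(iter_AB _ _ uh) // HN // linear0.
Qed.

(* A kernel vector of [B] on the left has [b <> 0], so the cross equation puts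
   [a] in the image of [B]; a cyclic vector of a nonzero nilpotent module is not
   in the image. *)
Lemma gr_one_sided x :
  (forall u, u \in hom (xout x) (Negz 0) -> u = 0) \/
  (forall v, v \in hom (xin x) (Posz 0) -> v = 0).
Proof.
have [N nilN] := gr_nilp (xout x) (Negz 0).
have [N' nilN'] := gr_nilp (xin x) (Posz 0).
have [e [q [cyc be]]] := cocyclic_nilp (@gr_B _ _ _ _ _ _ _ _ gr _ _) nilN
   (@gr_b_cocyclic _ _ _ _ _ _ _ _ gr bm ss x).
case: q cyc be => [|q] cyc be; [left|right].
  by move=> u /(cyc_span cyc) [c ->]; rewrite big_geq.
pose u := iter q (mB m (xout x)) e.
have uh : u \in hom (xout x) (Negz 0) by apply: gr_Bl; case: cyc.
have Bu : mB m (xout x) u = 0 by have := cyc_nil cyc.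
have bu : mb m x u = 1 by rewrite /u be eqxx.
have aE : ma m x 1 = mB m (xin x) (- mA m x u).
  have := cross_eqE u cr; rewrite Bu linear0 bu linearN /= => /eqP.
  by rewrite addr_eq0 -[in X in X -> _]eqr_oppLR => /eqP.
have step v : v \in hom (xin x) (Posz 0) ->
    exists2 v', v' \in hom (xin x) (Posz 0) & v = mB m (xin x) v'.
  move=> /(gr_a_cyclic gr bm sq) [c [M ->]].
  exists (\sum_(0 <= l < M) c l *: iter l (mB m (xin x)) (- mA m x u)).
    apply: memv_suml => l _; apply/memvZ/gr_Bl; rewrite memvN.
    exact: (gr_A gr uh).
  rewrite linear_sum; apply: eq_bigr => l _.
  by rewrite linearZ /= -iterS iterSr -aE.
have stepN l v : v \in hom (xin x) (Posz 0) ->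
    exists2 v', v' \in hom (xin x) (Posz 0) & v = iter l (mB m (xin x)) v'.
  move=> vh; elim: l => [|l [v' /step [v'' v''h ->] ->]]; first by exists v.
  by exists v'' => //; rewrite -iterSr.
by move=> v /(stepN N') [v' /nilN' ? ->].
Qed.

(** The kernels of [D], carried to the right by [C] and [A], form an invariant graded subspace in
    degrees at least 0: [B = - C D] kills them, and [D C = - B] keeps their images inside. Nothing
    lies in degree -1, so [b] vanishes on it and stability applies. *)
Lemma gr_D_inj h t v : v \in hom (hin h) (Posz t) -> mD m h v = 0 -> v = 0.
Proof.
move=> vh Dv.
have [Sp [p0 pC pA]] := @line_rec_right n w (fun z t => V z -> Prop)
  (fun j v => v = 0)
  (fun h t S v => exists u k, [/\ exists2 u', S u' & u = mC m h u',
     k \in hom (hin h) (Posz t) /\ mD m h k = 0 & v = u + k])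
  (fun x t S v => exists2 u, S u & v = mA m x u).
pose Sn (z : segment w) (t : nat) (v : V z) := v = 0.
have pL : forall z t, lin_pred (Sp z t).
  apply: line_ind_right => [j|h' t' IH|y t' IH]; rewrite ?p0 ?pC ?pA.
  - exact: lin_pred0.
  - apply: lin_pred_add; first exact: lin_pred_img.
    apply: lin_pred_and; first exact: lin_pred_mem.
    exact: (lin_pred_preim (mD m h') (@lin_pred0 _ _)).
  - exact: lin_pred_img.
have nL z t' : lin_pred (@Sn z t') by apply: lin_pred0.
have ph : forall z t u, Sp z t u -> u \in hom z (Posz t).
  apply: line_ind_right => [j|h' t' IH|y t' IH] u; rewrite ?p0 ?pC ?pA.
  - by move=> ->; rewrite mem0v.
  - by move=> [u1 [k [[u2 Su2 ->] [kh Dk] ->]]]; rewrite memvD // (gr_C gr) // IH.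
  - by move=> [u' Su ->]; apply: (gr_A gr (d := Posz t')); apply: IH.
have pB : forall z t u, Sp z t u -> Sp z t (mB m z u).
  apply: line_ind_right => [j|h' t' IH|y t' IH] u; rewrite ?p0 ?pC ?pA.
  - by move=> ->; rewrite linear0.
  - move=> [u1 [k [[u2 Su2 ->] [kh Dk] ->]]].
    exists (mC m h' (mB m (hout h') u2)), 0; split.
    + by exists (mB m (hout h') u2) => //; apply: IH.
    + by rewrite mem0v linear0.
    + rewrite linearD /= circ_eq_CB //; congr (_ + _).
      by rewrite -[mB m _ k]opprK -circ_eq_in // Dk linear0 oppr0.
  - move=> [u' Su ->]; exists (mB m _ u'); first exact: IH.
    rewrite (@gr_AB _ _ _ _ _ _ _ _ gr bm _ (Posz t')) //.
    exact: ph.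
have lin z d : lin_pred (@posneg _ _ _ _ Sp Sn z d) by case: d => t'; [apply: pL | apply: nL].
apply: (@graded_stable_sub _ _ _ _ m _ _ _ gr bm ss (posneg Sp Sn)) (Posz t) _ _ => //.
- split.
  + by move=> z [t'|t'] u /=; [apply: pB | rewrite /Sn => ->; rewrite linear0].
  + move=> y [t'|[|t']] u /=; rewrite ?pA ?p0 /Sn.
    * by move=> Su; exists u.
    * by move=> ->; rewrite linear0.
    * by move=> ->; rewrite linear0.
  + move=> h' [t'|t'] u /=; last by rewrite /Sn => ->; rewrite linear0.
    rewrite pC => Su; exists (mC m h' u), 0; split; [by exists u| |by rewrite addr0].
    by rewrite mem0v linear0.
  + move=> h' [t'|t'] u /=; last by rewrite /Sn => ->; rewrite linear0.
    rewrite pC => -[u1 [k [[u2 Su2 ->] [kh Dk] ->]]].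
    rewrite linearD /= Dk addr0 circ_eq_out //; apply: (lin_predN (pL _ _)); exact: pB.
- by move=> z [t'|t'] u /=; [apply: ph | rewrite /Sn => ->; rewrite mem0v].
- by move=> y u /=; rewrite /Sn => ->; rewrite linear0.
- move=> y [t'|[|t']] u /=; rewrite ?pA ?p0 /Sn.
  + by move=> [v' Sv ->]; exists v'.
  + by move=> ->; exists 0; rewrite ?linear0.
  + by move=> ->; exists 0; rewrite ?linear0.
- rewrite /= pC; exists 0, v; split=> //; last by rewrite add0r.
  by exists 0; rewrite ?linear0 //; case: (pL (hout h) t).
Qed.

(** Dually, take everything in negative degrees and at the base points, and past an o-point those
    images under [C] which [D] sends back into the family. This invariant subspace contains the
    image of [a], hence is everything. *)
Lemma gr_C_surj h t v : v \in hom (hin h) (Posz t) ->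
  exists2 u, u \in hom (hout h) (Posz t) & v = mC m h u.
Proof.
move=> vh.
have [Sp [p0 pC pA]] := @line_rec_right n w (fun z t => V z -> Prop)
  (fun j v => v \in hom (xin j) (Posz 0))
  (fun h t S v => (exists2 u, u \in hom (hout h) (Posz t) & v = mC m h u) /\
     S (mD m h v))
  (fun x t S v => exists2 u, S u & v = mA m x u).
pose Sn (z : segment w) (t : nat) (v : V z) := v \in hom z (Negz t).
have pL : forall z t, lin_pred (Sp z t).
  apply: line_ind_right => [j|h' t' IH|y t' IH]; rewrite ?p0 ?pC ?pA.
  - exact: lin_pred_mem.
  - apply: lin_pred_and; last exact: lin_pred_preim.
    by apply: lin_pred_img; apply: lin_pred_mem.
  - exact: lin_pred_img.
have nL z t' : lin_pred (@Sn z t') by apply: lin_pred_mem.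
have ph : forall z t u, Sp z t u -> u \in hom z (Posz t).
  apply: line_ind_right => [j|h' t' IH|y t' IH] u; rewrite ?p0 ?pC ?pA //.
  - by move=> [[u' uh ->] _]; apply: (gr_C gr).
  - by move=> [u' Su ->]; apply: (gr_A gr (d := Posz t')); apply: IH.
have pB : forall z t u, Sp z t u -> Sp z t (mB m z u).
  apply: line_ind_right => [j|h' t' IH|y t' IH] u; rewrite ?p0 ?pC ?pA.
  - exact: (gr_B gr).
  - move=> [[u' uh ->] Su]; split; last by rewrite circ_eq_DB //; apply: IH.
    by exists (mB m _ u'); [apply: (gr_B gr) | rewrite circ_eq_CB].
  - move=> [u' Su ->]; exists (mB m _ u'); first exact: IH.
    rewrite (@gr_AB _ _ _ _ _ _ _ _ gr bm _ (Posz t')) //.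
    exact: ph.
have lin z d : lin_pred (@posneg _ _ _ _ Sp Sn z d) by case: d => t'; [apply: pL | apply: nL].
have Sv : posneg Sp Sn (Posz t) v; last by move: Sv; rewrite /= pC => -[].
apply: (@graded_stable_quot _ _ _ _ m _ _ _ gr bm sq (posneg Sp Sn)) => //.
- split.
  + by move=> z [t'|t'] u /=; [apply: pB | apply: (gr_B gr)].
  + move=> y [t'|[|t']] u /=; rewrite ?pA ?p0 /Sn.
    * by move=> Su; exists u.
    * exact: (gr_A gr (d := Negz 0)).
    * exact: (gr_A gr (d := Negz t'.+1)).
  + move=> h' [t'|t'] u /=; last exact: (gr_C gr).
    rewrite pC => Su; split; first by exists u => //; apply: ph.
    by rewrite circ_eq_out //; apply: (lin_predN (pL _ _)); apply: pB.
  + move=> h' [t'|t'] u /=; last exact: (gr_D gr).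
    by rewrite pC => -[].
- by move=> y k; rewrite /= p0; apply: (gr_a gr).
- move=> y [t'|[|t']] u uh /=; rewrite ?pA ?p0 //.
  case=> u' Su' /eqP; rewrite -subr_eq0 -linearB /= => /eqP Au.
  have /eqP := gr_A_inj gr bm (d := Posz t') isT (memvB uh (ph _ _ _ Su')) Au.
  by rewrite subr_eq0 => /eqP ->.
Qed.

(** The mirror image of [gr_D_inj], spread to the left by [D] and by preimages under [A]. *)
Lemma gr_C_inj h t v : v \in hom (hout h) (Negz t) -> mC m h v = 0 -> v = 0.
Proof.
move=> vh Cv.
have [Sn [n0 nC nA]] := @line_rec_left n w (fun z t => V z -> Prop)
  (fun j v => v = 0)
  (fun h t S v => exists u k, [/\ exists2 u', S u' & u = mD m h u',
     k \in hom (hout h) (Negz t) /\ mC m h k = 0 & v = u + k])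
  (fun x t S u => u \in hom (xout x) (Negz t.+1) /\ S (mA m x u)).
pose Sp (z : segment w) (t : nat) (v : V z) := v = 0.
have nL : forall z t, lin_pred (Sn z t).
  apply: line_ind_left => [j|h' t' IH|y t' IH]; rewrite ?n0 ?nC ?nA.
  - exact: lin_pred0.
  - apply: lin_pred_add; first exact: lin_pred_img.
    apply: lin_pred_and; first exact: lin_pred_mem.
    exact: (lin_pred_preim (mC m h') (@lin_pred0 _ _)).
  - by apply: lin_pred_and; [apply: lin_pred_mem | apply: lin_pred_preim].
have pL z t' : lin_pred (@Sp z t') by apply: lin_pred0.
have nh : forall z t u, Sn z t u -> u \in hom z (Negz t).
  apply: line_ind_left => [j|h' t' IH|y t' IH] u; rewrite ?n0 ?nC ?nA.
  - by move=> ->; rewrite mem0v.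
  - by move=> [u1 [k [[u2 Su2 ->] [kh Dk] ->]]]; rewrite memvD // (gr_D gr) // IH.
  - by case.
have nB : forall z t u, Sn z t u -> Sn z t (mB m z u).
  apply: line_ind_left => [j|h' t' IH|y t' IH] u; rewrite ?n0 ?nC ?nA.
  - by move=> ->; rewrite linear0.
  - move=> [u1 [k [[u2 Su2 ->] [kh Ck] ->]]].
    exists (mD m h' (mB m (hin h') u2)), 0; split.
    + by exists (mB m (hin h') u2) => //; apply: IH.
    + by rewrite mem0v linear0.
    + rewrite linearD /= circ_eq_DB //; congr (_ + _).
      by rewrite -[mB m _ k]opprK -circ_eq_out // Ck linear0 oppr0.
  - move=> [uh Su]; split; first exact: (gr_B gr).
    by rewrite (gr_AB gr bm _ uh) //; apply: IH.
have lin z d : lin_pred (@posneg _ _ _ _ Sp Sn z d) by case: d => t'; [apply: pL | apply: nL].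
apply: (@graded_stable_sub _ _ _ _ m _ _ _ gr bm ss (posneg Sp Sn)) (Negz t) _ _ => //.
- split.
  + by move=> z [t'|t'] u /=; [rewrite /Sp => ->; rewrite linear0 | apply: nB].
  + move=> y [t'|[|t']] u /=; rewrite ?nA ?n0 /Sp.
    * by move=> ->; rewrite linear0.
    * by move=> ->; rewrite linear0.
    * by case.
  + move=> h' [t'|t'] u /=; first by rewrite /Sp => ->; rewrite linear0.
    rewrite nC => -[u1 [k [[u2 Su2 ->] [kh Ck] ->]]].
    rewrite linearD /= Ck addr0 circ_eq_in //; apply: (lin_predN (nL _ _)); exact: nB.
  + move=> h' [t'|t'] u /=; first by rewrite /Sp => ->; rewrite linear0.
    rewrite nC => Su; exists (mD m h' u), 0; split; [by exists u| |by rewrite addr0].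
    by rewrite mem0v linear0.
- by move=> z [t'|t'] u /=; [rewrite /Sp => ->; rewrite mem0v | apply: nh].
- by move=> y u /=; rewrite n0 => ->; rewrite linear0.
- move=> y [t'|[|t']] u /=; rewrite ?nA ?n0 /Sp.
  + by move=> ->; exists 0; rewrite ?linear0.
  + by move=> ->; exists 0; rewrite ?linear0.
  + move=> Su; have [//|u' uh' uE] := gr_A_surj gr bm (d := Negz t'.+1) _ (nh _ _ _ Su).
    by exists u' => //; rewrite ?nA; split=> //; rewrite -uE.
- rewrite /= nC; exists 0, v; split=> //; last by rewrite add0r.
  by exists 0; rewrite ?linear0 //; case: (nL (hin h) t).
Qed.

Lemma gr_D_surj h t v : v \in hom (hout h) (Negz t) ->
  exists2 u, u \in hom (hin h) (Negz t) & v = mD m h u.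
Proof.
move=> vh.
have [Sn [n0 nC nA]] := @line_rec_left n w (fun z t => V z -> Prop)
  (fun j v => v \in hom (xout j) (Negz 0))
  (fun h t S v => (exists2 u, u \in hom (hin h) (Negz t) & v = mD m h u) /\
     S (mC m h v))
  (fun x t S u => u \in hom (xout x) (Negz t.+1) /\ S (mA m x u)).
pose Sp (z : segment w) (t : nat) (v : V z) := v \in hom z (Posz t).
have nL : forall z t, lin_pred (Sn z t).
  apply: line_ind_left => [j|h' t' IH|y t' IH]; rewrite ?n0 ?nC ?nA.
  - exact: lin_pred_mem.
  - apply: lin_pred_and; last exact: lin_pred_preim.
    by apply: lin_pred_img; apply: lin_pred_mem.
  - by apply: lin_pred_and; [apply: lin_pred_mem | apply: lin_pred_preim].
have pL z t' : lin_pred (@Sp z t') by apply: lin_pred_mem.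
have nh : forall z t u, Sn z t u -> u \in hom z (Negz t).
  apply: line_ind_left => [j|h' t' IH|y t' IH] u; rewrite ?n0 ?nC ?nA //.
  - by move=> [[u' uh ->] _]; apply: (gr_D gr).
  - by case.
have nB : forall z t u, Sn z t u -> Sn z t (mB m z u).
  apply: line_ind_left => [j|h' t' IH|y t' IH] u; rewrite ?n0 ?nC ?nA.
  - exact: (gr_B gr).
  - move=> [[u' uh ->] Su]; split; last by rewrite circ_eq_CB //; apply: IH.
    by exists (mB m _ u'); [apply: (gr_B gr) | rewrite circ_eq_DB].
  - move=> [uh Su]; split; first exact: (gr_B gr).
    by rewrite (gr_AB gr bm _ uh) //; apply: IH.
have lin z d : lin_pred (@posneg _ _ _ _ Sp Sn z d) by case: d => t'; [apply: pL | apply: nL].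
have Sv : posneg Sp Sn (Negz t) v; last by move: Sv; rewrite /= nC => -[].
apply: (@graded_stable_quot _ _ _ _ m _ _ _ gr bm sq (posneg Sp Sn)) => //.
- split.
  + by move=> z [t'|t'] u /=; [apply: (gr_B gr) | apply: nB].
  + move=> y [t'|[|t']] u /=; rewrite ?nA ?n0 /Sp.
    * exact: (gr_A gr (d := Posz t')).
    * exact: (gr_A gr (d := Negz 0)).
    * by case.
  + move=> h' [t'|t'] u /=; first exact: (gr_C gr).
    by rewrite nC => -[].
  + move=> h' [t'|t'] u /=; first exact: (gr_D gr).
    rewrite nC => Su; split; first by exists u => //; apply: nh.
    by rewrite circ_eq_in //; apply: (lin_predN (nL _ _)); apply: nB.
- by move=> y k; apply: (gr_a gr).
- move=> y [t'|[|t']] u uh /=; rewrite ?nA ?n0 // => Su.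
Qed.

(** The sign in [gen_hout] is chosen so that, by [C D = - B], the map [C] sends the generator at
    [hout h] to [B] of the generator at [hin h] without a sign. *)
Record string_gens (e : forall z : segment w, int -> V z) (L : segment w -> int -> nat)
   : Prop := StringGens {
  gen_cyc : forall z d, cyclic_nilp (hom z d) (mB m z) (e z d) (L z d);
  gen_xin0 : forall j, e (xin j) (Posz 0) = ma m j 1;
  gen_hin : forall h t, e (hin h) (Posz t) = mC m h (e (hout h) (Posz t));
  gen_xin : forall x t, e (xin x) (Posz t.+1) = mA m x (e (xout x) (Posz t));
  gen_xout0 : forall j l, mb m j (iter l (mB m (xout j)) (e (xout j) (Negz 0)))
    = (l.+1 == L (xout j) (Negz 0))%:R;
  gen_hout : forall h t, e (hout h) (Negz t) = - mD m h (e (hin h) (Negz t));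
  gen_xout : forall x t, mA m x (e (xout x) (Negz t.+1)) = e (xin x) (Negz t) }.

Lemma cyclic_nilp0 (U : vectType K) (S : {vspace U}) B e q :
  cyclic_nilp S B e q -> (forall u, u \in S -> u = 0) -> q = 0%N.
Proof.
move=> [eS _ _ last] S0; case: q last => // q /(_ isT) /=.
by rewrite (S0 e eS) iter_lin0 eqxx.
Qed.

Lemma string_gens_exist : exists e L, string_gens e L /\ string_length L T.
Proof.
pose F (d : nat -> int) z (t : nat) := {p : V z * nat | cyclic_nilp (hom z (d t)) (mB m z) p.1 p.2}.
have base0 j : {p : F Posz (xin j) 0%N | (sval p).1 = ma m j 1}.
  have /cid [N nilN] := gr_nilp (xin j) (Posz 0).
  have ah := gr_a gr j 1.
  have /cid [q cyc] := cyclic_nilpW ah (nilN _ ah)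
    (@gr_a_cyclic _ _ _ _ _ _ _ _ gr bm sq j).
  by exists (exist _ (ma m j 1, q) cyc).
have stepC h t (p : F Posz (hout h) t) : {p' : F Posz (hin h) t |
    (sval p').1 = mC m h (sval p).1 /\ (sval p').2 = (sval p).2.-1}.
  case: p => [[e q] /= cyc].
  have cyc' : cyclic_nilp (hom (hin h) (Posz t)) (mB m (hin h)) (mC m h e) q.-1.
    apply: (cyc_step (F := mC m h) (G := mD m h)) cyc.
    - by move=> u; apply: (gr_B gr).
    - by move=> u; apply: (gr_C gr).
    - exact: gr_C_surj.
    - by move=> v; apply: gr_D_inj.
    - by move=> u _; apply: circ_eq_CB.
    - by move=> u _; apply: circ_eq_out.
  by exists (exist _ (mC m h e, q.-1) cyc').
have stepA x t (p : F Posz (xout x) t) : {p' : F Posz (xin x) t.+1 |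
    (sval p').1 = mA m x (sval p).1 /\ (sval p').2 = (sval p).2}.
  case: p => [[e q] /= cyc].
  have cyc' : cyclic_nilp (hom (xin x) (Posz t.+1)) (mB m (xin x)) (mA m x e) q.
    apply: (cyc_iso (F := mA m x)) cyc.
    - by move=> u; apply: (gr_B gr).
    - by move=> u; apply: (gr_A gr (d := Posz t)).
    - by move=> v; apply: (gr_A_surj gr bm (d := Posz t)).
    - by move=> v; apply: (gr_A_inj gr bm (d := Posz t)).
    - by move=> u; apply: (gr_AB gr bm (d := Posz t)).
  by exists (exist _ (mA m x e, q) cyc').
have nbase0 j : {p : F Negz (xout j) 0%N |
   forall l, mb m j (iter l (mB m (xout j)) (sval p).1) = (l.+1 == (sval p).2)%:R}.
  have /cid [N nilN] := gr_nilp (xout j) (Negz 0).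
  have /cid [e /cid [q [cyc be]]] := cocyclic_nilp (@gr_B _ _ _ _ _ _ _ _ gr _ _) nilN
    (@gr_b_cocyclic _ _ _ _ _ _ _ _ gr bm ss j).
  by exists (exist _ (e, q) cyc).
have nstepC h t (p : F Negz (hin h) t) : {p' : F Negz (hout h) t |
    (sval p').1 = - mD m h (sval p).1 /\ (sval p').2 = (sval p).2.-1}.
  case: p => [[e q] /= cyc].
  have cyc' : cyclic_nilp (hom (hout h) (Negz t)) (mB m (hout h)) (- mD m h e) q.-1.
    rewrite -opp_lfunE.
    (* To the left [C] and [D] exchange roles; both carry a sign, so that the composite is still
       [C D = - B]. *)
    apply: (cyc_step (F := (- mD m h)%VF) (G := (- mC m h)%VF)) cyc.
    - by move=> u; apply: (gr_B gr).
    - by move=> u uh; rewrite opp_lfunE memvN; apply: (gr_D gr).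
    - move=> v /gr_D_surj [u uh ->]; exists (- u); rewrite ?memvN //.
      by rewrite opp_lfunE linearN opprK.
    - move=> v vh; rewrite opp_lfunE => /eqP; rewrite oppr_eq0 => /eqP.
      exact: gr_C_inj vh.
    - by move=> u _; rewrite !opp_lfunE circ_eq_DB // linearN.
    - by move=> u _; rewrite !opp_lfunE linearN opprK; apply: circ_eq_in.
  by exists (exist _ (- mD m h e, q.-1) cyc').
have nstepA x t (p : F Negz (xin x) t) : {p' : F Negz (xout x) t.+1 |
    mA m x (sval p').1 = (sval p).1 /\ (sval p').2 = (sval p).2}.
  case: p => [[e q] /= cyc].
  have [//|e' e'h eE] := cid2 (gr_A_surj gr bm (d := Negz t.+1) _ (cyc_mem cyc)).
  have cyc' : cyclic_nilp (hom (xout x) (Negz t.+1)) (mB m (xout x)) e' q.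
    rewrite eE in cyc; apply: (cyc_iso_pre (F := mA m x)) cyc => //.
    - by move=> u; apply: (gr_B gr).
    - by move=> u; apply: (gr_A gr (d := Negz t.+1)).
    - by move=> v; apply: (gr_A_inj gr bm (d := Negz t.+1)).
    - by move=> u; apply: (gr_AB gr bm (d := Negz t.+1)).
  by exists (exist _ (e', q) cyc').
have [fp [p0 pC pA]] := @line_rec_right n w (F Posz) (fun j => sval (base0 j))
  (fun h t p => sval (stepC h t p)) (fun x t p => sval (stepA x t p)).
have [fn [n0 nC nA]] := @line_rec_left n w (F Negz) (fun j => sval (nbase0 j))
  (fun h t p => sval (nstepC h t p)) (fun x t p => sval (nstepA x t p)).
pose f z (d : int) : V z * nat :=
  match d with Posz t => sval (fp z t) | Negz t => sval (fn z t) end.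
have fcyc z d : cyclic_nilp (hom z d) (mB m z) (f z d).1 (f z d).2.
  by case: d => t /=; [case: (fp z t) | case: (fn z t)].
exists (fun z d => (f z d).1), (fun z d => (f z d).2); split; split=> //=.
- by move=> j; rewrite p0; case: (base0 j).
- by move=> h t; rewrite pC; case: (stepC h t _) => p' [].
- by move=> x t; rewrite pA; case: (stepA x t _) => p' [].
- by move=> j l; rewrite n0; case: (nbase0 j).
- by move=> h t; rewrite nC; case: (nstepC h t _) => p' [].
- by move=> x t; rewrite nA; case: (nstepA x t _) => p' [].
- by move=> h t; rewrite pC; case: (stepC h t _) => p' [].
- by move=> x t; rewrite pA; case: (stepA x t _) => p' [].
- by move=> h t; rewrite nC; case: (nstepC h t _) => p' [].
- by move=> x t; rewrite nA; case: (nstepA x t _) => p' [].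
- move=> x; have [H|H] := gr_one_sided x; [right|left].
    exact: (cyclic_nilp0 (fcyc (xout x) (Negz 0)) H).
  exact: (cyclic_nilp0 (fcyc (xin x) (Posz 0)) H).
- move=> z d dT; apply: (cyclic_nilp0 (fcyc z d)) => u.
  exact: (gr_bound gr).
Qed.
End StringGenerators.

(** * Frames *)

Section Frames.
Variable K : fieldType.

Definition frame_index (T : nat) (L : int -> nat) : seq (int * nat) :=
  [seq (d, l) | d <- degrees T, l <- iota 0 (L d)].

Lemma frame_index_uniq T L : uniq (frame_index T L).
Proof.
apply: allpairs_uniq_dep => [|d _|]; [exact: degrees_uniq|exact: iota_uniq|].
by move=> [d l] [d' l'] _ _ /= [-> ->].
Qed.

Lemma mem_frame_index T L d l :
  ((d, l) \in frame_index T L) = (d \in degrees T) && (l < L d)%N.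
Proof.
apply/allpairsPdep/andP => [[d' [l' [d'T + [-> ->]]]]|[dT lL]].
  by rewrite mem_iota add0n d'T.
by exists d, l; rewrite mem_iota.
Qed.

Lemma size_frame_index T L : size (frame_index T L) = (\sum_(d <- degrees T) L d)%N.
Proof.
by rewrite size_allpairs_dep sumnE big_map; apply: eq_bigr => d _; rewrite size_iota.
Qed.

(** A basis indexed by degree and power of [B], with its coordinate functions. Extending [ep] by
    zero beyond the length lets formulas such as [B] raising the index hold without a case
    distinction at the end of a string. *)
Record frame (V : vectType K) T (L : int -> nat) (ep : int -> nat -> V)
    (co : int -> nat -> 'Hom(V, K^o)) : Prop := Frame {
  fr_zero : forall d l, (L d <= l)%N -> ep d l = 0;
  fr_dual : forall d l d' l',
    co d l (ep d' l') = [&& d == d', l == l' & (l < L d)%N]%:R;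
  fr_sum : forall u,
    u = \sum_(i <- frame_index T L) (co i.1 i.2 u : K) *: ep i.1 i.2 }.

Section OneFrame.
Variables (V : vectType K) (T : nat) (L : int -> nat).
Variables (ep : int -> nat -> V) (co : int -> nat -> 'Hom(V, K^o)).
Hypothesis fr : frame T L ep co.
Hypothesis LT : forall d, d \notin degrees T -> L d = 0%N.

Lemma frame_ext (W : vectType K) (F G : 'Hom(V, W)) :
  (forall d l, F (ep d l) = G (ep d l)) -> F = G.
Proof.
move=> FG; apply/lfunP => u; rewrite (fr_sum fr u) !linear_sum.
by apply: eq_bigr => i _; rewrite !linearZ /= FG.
Qed.

Lemma frame_eq0 u : (forall d l, co d l u = 0) -> u = 0.
Proof.
by move=> cu; rewrite (fr_sum fr u) big1 // => i _; rewrite cu scale0r.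
Qed.

Lemma frame_map (W : vectType K) (f : int -> nat -> W) :
  (forall d l, (L d <= l)%N -> f d l = 0) ->
  {F : 'Hom(V, W) | forall d l, F (ep d l) = f d l}.
Proof.
move=> f0.
pose F0 u := \sum_(i <- frame_index T L) (co i.1 i.2 u : K) *: f i.1 i.2.
have F0lin : linear F0.
  move=> k u v; rewrite /F0 scaler_sumr -big_split /=; apply: eq_bigr => i _.
  by rewrite linearP scalerDl scalerA.
pose Fl := GRing.isLinear.Build K V W *:%R F0 F0lin.
pose F : 'Hom(V, W) := linfun (HB.pack F0 Fl : {linear V -> W}).
have FE u : F u = F0 u by rewrite /F lfunE.
exists F => d l; rewrite FE /F0.
have [Ll|lL] := leqP (L d) l.
  by rewrite (fr_zero fr) // f0 // big1 // => i _; rewrite linear0 scale0r.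
have dT : d \in degrees T by apply: contraLR lL => /LT ->; rewrite ltn0.
rewrite (bigD1_seq (d, l)) ?frame_index_uniq ?mem_frame_index ?dT //=.
rewrite (fr_dual fr) !eqxx lL scale1r big1 ?addr0 // => -[d' l'] /= dl.
rewrite (fr_dual fr).
case: eqP => [dd|_]; last by rewrite scale0r.
case: eqP => [ll|_]; last by rewrite scale0r.
by rewrite dd ll eqxx in dl.
Qed.

Lemma frame_dim : \dim (fullv : {vspace V}) = (\sum_(d <- degrees T) L d)%N.
Proof.
rewrite -size_frame_index.
pose X := [tuple of [seq ep i.1 i.2 | i <- in_tuple (frame_index T L)]].
have sX : size X = size (frame_index T L) by rewrite size_map.
have nX i : X`_i = ep (nth (Posz 0, 0%N) (frame_index T L) i).1
    (nth (Posz 0, 0%N) (frame_index T L) i).2 \/ (size (frame_index T L) <= i)%N.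
  have [ii|ii] := ltnP i (size (frame_index T L)); [left|by right].
  by rewrite (nth_map (Posz 0, 0%N)).
have fX : free X.
  apply/freeP => k sum0 i.
  set ii := nth (Posz 0, 0%N) (frame_index T L) i.
  have := congr1 (co ii.1 ii.2) sum0; rewrite linear0 linear_sum /= (bigD1 i) //=.
  have memi (j : 'I_(size (frame_index T L))) :
      nth (Posz 0, 0%N) (frame_index T L) j \in frame_index T L by rewrite mem_nth.
  have XE (j : 'I_(size (frame_index T L))) : [seq ep i0.1 i0.2 | i0 <- frame_index T L]`_j
      = ep (nth (Posz 0, 0%N) (frame_index T L) j).1
       (nth (Posz 0, 0%N) (frame_index T L) j).2.
    by rewrite (nth_map (Posz 0, 0%N)).
  rewrite linearZ /= XE (fr_dual fr) !eqxx.
  have := memi i; rewrite -/ii (surjective_pairing ii) mem_frame_index => /andP[_ ->].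
  rewrite big1 => [|j ji]; first by rewrite addr0 /GRing.scale /= mulr1.
  rewrite linearZ /= XE (fr_dual fr).
  case: eqP => [dd|_]; last by rewrite scaler0.
  case: eqP => [ll|_]; last by rewrite scaler0.
  case/eqP: ji; apply: val_inj; apply/eqP.
  rewrite -(nth_uniq (Posz 0, 0%N) _ _ (frame_index_uniq T L)) ?ltn_ord //.
  by rewrite -/ii [X in X == _]surjective_pairing -dd -ll -surjective_pairing.
have spanX : (<<X>> = fullv)%VS.
  apply/eqP; rewrite eqEsubv subvf; apply/subvP => u _.
  rewrite (fr_sum fr u) big_seq; apply: memv_suml => i iI.
  by apply: memvZ; apply: memv_span; apply/mapP; exists i.
by rewrite -spanX; move: fX; rewrite /free => /eqP ->.
Qed.

End OneFrame.

Lemma frame_exists (p T : nat) (L : int -> nat) :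
  (forall d, d \notin degrees T -> L d = 0%N) ->
  p = (\sum_(d <- degrees T) L d)%N ->
  exists (ep : int -> nat -> 'rV[K]_p) co, frame T L ep co.
Proof.
move=> LT pE; rewrite -size_frame_index in pE.
pose ix d l := index (d, l) (frame_index T L).
pose ep d l : 'rV[K]_p := \row_k (k == ix d l :> nat)%:R.
pose co0 d l (u : 'rV[K]_p) : K^o := \sum_k u 0 k * (k == ix d l :> nat)%:R.
have co0lin d l : linear (co0 d l).
  move=> k u v; rewrite /co0 scaler_sumr -big_split /=; apply: eq_bigr => i _.
  by rewrite !mxE mulrDl -mulrA.
pose cl d l := GRing.isLinear.Build K _ K^o *:%R (co0 d l) (co0lin d l).
pose co d l : 'Hom('rV[K]_p, K^o) :=
  linfun (HB.pack (co0 d l) (cl d l) : {linear 'rV[K]_p -> K^o}).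
have coE d l u : co d l u = co0 d l u by rewrite /co lfunE.
have ix_lt d l : (ix d l < p)%N = (l < L d)%N.
  rewrite pE index_mem mem_frame_index; case: (boolP (d \in _)) => //= /LT ->.
  by rewrite ltn0.
have coi (i : 'I_p) d l u : i = ix d l :> nat -> co d l u = u 0 i.
  move=> iE; rewrite coE /co0 (bigD1 i) //= iE eqxx mulr1 big1 ?addr0 // => k ki.
  have -> : (k == ix d l :> nat) = false.
    by apply: contra_neqF ki => /eqP ki; apply: val_inj; rewrite /= ki.
  by rewrite mulr0.
exists ep, co; split.
- move=> d l Ll; apply/rowP => k; rewrite !mxE.
  case: eqP => // kE; have := ltn_ord k; by rewrite kE ix_lt ltnNge Ll.
- move=> d l d' l'; have [lL|Ll] := ltnP l (L d).
    have H : (ix d l < p)%N by rewrite ix_lt.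
    rewrite (coi (Ordinal H)) // mxE /=; congr (_%:R).
    rewrite andbT -[in RHS]xpair_eqE; congr (nat_of_bool _).
    apply/eqP/eqP => [|[-> ->] //]; rewrite /ix => e.
    have mem : (d, l) \in frame_index T L by rewrite -index_mem -pE.
    have mem' : (d', l') \in frame_index T L by rewrite -index_mem -e -pE.
    by rewrite -[LHS](nth_index (Posz 0, 0%N) mem) e nth_index.
  rewrite !andbF coE /co0 big1 // => k _.
  case: eqP => [kE|]; last by rewrite mulr0.
  by have := ltn_ord k; rewrite kE ix_lt ltnNge Ll.
- move=> u; apply/rowP => k; rewrite summxE.
  have kI : (k < size (frame_index T L))%N by rewrite -pE.
  set i0 := nth (Posz 0, 0%N) (frame_index T L) k.
  have i0k : k = ix i0.1 i0.2 :> nat.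
    by rewrite /ix -surjective_pairing index_uniq // frame_index_uniq.
  rewrite (bigD1_seq i0) ?mem_nth ?frame_index_uniq //=.
  rewrite !mxE -i0k eqxx mulr1 (coi k) // big1_seq ?addr0 // => i /andP[ii0 iI].
  rewrite !mxE; case: eqP => [kE|]; last by rewrite mulr0.
  move: ii0; rewrite /i0 kE /ix -surjective_pairing nth_index ?eqxx //.
Qed.

End Frames.

(** * Standard data *)

Section Standard.
Variables (n : nat) (w : 'I_n -> nat) (K : fieldType) (r : segment w -> nat).
Local Notation xin := (xin w).
Local Notation xout := (xout w).
Local Notation V := (bowV K r).
Variables (L : segment w -> int -> nat) (T : nat).
Hypothesis HL : string_length L T.

(* In both signs [ep z d l] is [B^l] of a generator; in negative degree the
   strings grow towards the x-point, so there [C] raises the index and [b]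
   reads off the last vector. *)
Record standard (m : bow_maps K r) (ep : forall z : segment w, int -> nat -> V z)
    (co : forall z : segment w, int -> nat -> 'Hom(V z, K^o)) : Prop := Standard {
  std_frame : forall z, frame T (L z) (ep z) (co z);
  std_B : forall z d l, mB m z (ep z d l) = ep z d l.+1;
  std_A : forall x d l, d != Negz 0 ->
    mA m x (ep (xout x) d l) = ep (xin x) (degS d) l;
  std_A0 : forall x l, mA m x (ep (xout x) (Negz 0) l) = 0;
  std_Cp : forall h t l, mC m h (ep (hout h) (Posz t) l) = ep (hin h) (Posz t) l;
  std_Cn : forall h t l, mC m h (ep (hout h) (Negz t) l) = ep (hin h) (Negz t) l.+1;
  std_Dp : forall h t l, mD m h (ep (hin h) (Posz t) l) = - ep (hout h) (Posz t) l.+1;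
  std_Dn : forall h t l, mD m h (ep (hin h) (Negz t) l) = - ep (hout h) (Negz t) l;
  std_a : forall x, ma m x 1 = ep (xin x) (Posz 0) 0%N;
  std_b : forall x d l, mb m x (ep (xout x) d l)
    = ((d == Negz 0) && (l.+1 == L (xout x) (Negz 0)))%:R }.

Lemma standard_of_grading (m : bow_maps K r) hom pi :
  grading m hom pi T -> bow_data m -> stable_sub m -> stable_quot m ->
  (exists e, string_gens m hom e L) -> exists ep co, standard m ep co.
Proof.
move=> gr bm ss sq [e ge].
have cr : cross_eq m by case: bm.
have ci : circ_eq m by case: bm.
pose ep z d l := iter l (mB m z) (e z d).
have eph z d l : ep z d l \in hom z d.
  by apply: (gr_Bl gr); case: (gen_cyc ge z d).
have fr z : exists co, frame T (L z) (ep z) co.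
  have ep0 d l : (L z d <= l)%N -> ep z d l = 0.
    by apply: iter_ge0; case: (gen_cyc ge z d).
  have sumE (a : int * nat -> K) d : pi z d (\sum_(i <- frame_index T (L z)) a i *: ep z i.1 i.2)
      = if d \in degrees T then \sum_(0 <= l < L z d) a (d, l) *: ep z d l else 0.
    rewrite linear_sum /=.
    transitivity (\sum_(i <- frame_index T (L z)) (if d == i.1 then a i *: ep z i.1 i.2 else 0)).
      apply: eq_bigr => i _; rewrite linearZ /= (gr_piE gr _ (eph _ _ _)).
      by case: ifP; rewrite ?scaler0.
    rewrite big_allpairs_dep /=.
    transitivity (\sum_(d' <- degrees T) if d == d' then
        \sum_(0 <= l < L z d') a (d', l) *: ep z d' l else 0).
      apply: eq_bigr => d' _; rewrite /index_iota subn0; case: ifP => // _.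
      by rewrite big1.
    case: ifP => dT.
      rewrite (bigD1_seq d) ?degrees_uniq //= eqxx [X in _ + X]big1 ?addr0 // => d'.
      by rewrite eq_sym => /negbTE ->.
    rewrite big1_seq // => d' /andP[_ d'T]; case: eqP => // dd.
    by rewrite dd d'T in dT.
  have [||co [codual cosum]] := @dual_basis K (V z) _ (frame_index T (L z))
    (fun i => ep z i.1 i.2) (frame_index_uniq _ _).
  - move=> a sum0 [d l]; rewrite mem_frame_index => /andP[dT lL].
    have := congr1 (pi z d) sum0; rewrite sumE dT linear0 => sumd.
    exact: (cyc_free (gen_cyc ge z d) (c := fun l => a (d, l)) sumd).
  - move=> u.
    have H d : exists c : nat -> K, pi z d u = \sum_(0 <= l < L z d) c l *: ep z d l.
      exact: (cyc_span (gen_cyc ge z d) (gr_pi gr d u)).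
    have [c cE] := choice H.
    exists (fun i => c i.1 i.2).
    rewrite {1}(gr_sum gr u) big_allpairs_dep /=; apply: eq_bigr => d _.
    by rewrite cE /index_iota subn0.
  exists (fun d l => if (d, l) \in frame_index T (L z) then co (d, l) else 0).
  split=> // [d l d' l'|u].
    have [lL|Ll] := ltnP l (L z d); last first.
      by rewrite mem_frame_index ltnNge Ll !andbF zero_lfunE.
    have dT : d \in degrees T.
      by apply: contraLR lL => /(len_bound HL) ->; rewrite ltn0.
    rewrite mem_frame_index dT lL /= andbT.
    case: (boolP ((d', l') \in frame_index T (L z))) => [I'|].
      have I : (d, l) \in frame_index T (L z) by rewrite mem_frame_index dT.
      by have := codual _ _ I I'; rewrite xpair_eqE.
    rewrite mem_frame_index => dl'.
    have -> : ep z d' l' = 0.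
      apply: ep0; rewrite leqNgt; apply: contra dl' => lL'; rewrite lL' andbT.
      by apply: contraLR lL' => /(len_bound HL) ->; rewrite ltn0.
    rewrite linear0; case: eqP => [dd|//]; case: eqP => [ll|//].
    by rewrite -dd -ll dT lL in dl'.
  rewrite {1}(cosum u); apply: eq_big_seq => -[d l] -> //.
pose co z := sval (cid (fr z)).
exists ep, co; split=> //.
- by move=> z; apply: (svalP (cid (fr z))).
- by move=> x d l d0; rewrite /ep (iter_AB gr bm _ d0) ?(cyc_mem (gen_cyc ge _ _)) //;
    case: d d0 => [t|[|t]] //= _; rewrite ?(gen_xin ge) ?(gen_xout ge).
(* Between degrees -1 and 0 the map [A] vanishes, since its source or its target is zero. *)
- move=> x l; have [L0|L0] := len_side HL x.
    have := cyc_nil (gen_cyc ge (xin x) (Posz 0)).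
    have H := gr_A gr (eph (xout x) (Negz 0) l).
    have [c ->] := cyc_span (gen_cyc ge (xin x) (Posz 0)) H.
    by rewrite L0 big_geq.
  rewrite /ep (iter_ge0 (cyc_nil (gen_cyc ge (xout x) (Negz 0)))) ?L0 //.
  exact: linear0.
- by move=> h t l; rewrite /ep iter_CB // (gen_hin ge).
- move=> h t l; rewrite /ep iter_CB // (gen_hout ge) linearN /= circ_eq_in // opprK.
  by rewrite -iterSr.
- by move=> h t l; rewrite /ep iter_DB // (gen_hin ge) circ_eq_out // iter_linN -iterSr.
- by move=> h t l; rewrite /ep iter_DB // (gen_hout ge) iter_linN opprK.
- by move=> x; rewrite /ep /= (gen_xin0 ge).
- move=> x d l; have [->|d0] /= := eqVneq d (Negz 0).
    exact: (gen_xout0 ge).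
  exact: (gr_b gr d0 (eph _ _ _)).
Qed.

End Standard.

(** * Stability and uniqueness of standard data *)

Section StandardProperties.
Variables (n : nat) (w : 'I_n -> nat) (K : fieldType) (r : segment w -> nat).
Local Notation xin := (xin w).
Local Notation xout := (xout w).
Local Notation V := (bowV K r).
Variables (L : segment w -> int -> nat) (T : nat).
Hypothesis HL : string_length L T.

Lemma bij_lfunK (U W : vectType K) (g : 'Hom(U, W)) : bijective (g : U -> W) ->
  cancel g (g^-1)%VF /\ cancel (g^-1)%VF g.
Proof.
move=> [g' gK g'K].
have k0 : lker g == 0%VS by apply/lker0P; apply: can_inj gK.
split=> u; first exact: lker0_lfunK.
apply: limg_lfunVK; rewrite -[u]g'K; exact: memv_img (memvf _).
Qed.

Lemma bow_maps_ext (m m' : bow_maps K r) :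
  (forall z, mB m z = mB m' z) -> (forall x, mA m x = mA m' x) ->
  (forall x, ma m x = ma m' x) -> (forall x, mb m x = mb m' x) ->
  (forall h, mC m h = mC m' h) -> (forall h, mD m h = mD m' h) -> m = m'.
Proof.
case: m m' => B A a b C D [B' A' a' b' C' D'] /= eB eA ea eb eC eD.
have := functional_extensionality_dep eB; have := functional_extensionality_dep eA.
have := functional_extensionality_dep ea; have := functional_extensionality_dep eb.
have := functional_extensionality_dep eC; have := functional_extensionality_dep eD.
by do 6![move=> ->].
Qed.

Lemma regular_ext (U : vectType K) (F G : 'Hom(K^o, U)) : F 1 = G 1 -> F = G.
Proof.
move=> FG; apply/lfunP => k; have -> : k = k *: (1 : K^o) by rewrite /GRing.scale /= mulr1.
by rewrite !linearZ /= FG.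
Qed.

Lemma natb_regular (b : bool) : (b%:R : K^o) = b%:R *: (1 : K^o).
Proof. by rewrite /GRing.scale /= mulr1. Qed.

Section OneStandard.
Variables (m : bow_maps K r) (ep : forall z : segment w, int -> nat -> V z).
Variable co : forall z : segment w, int -> nat -> 'Hom(V z, K^o).
Hypothesis st : standard L T m ep co.

Let fr z : frame T (L z) (ep z) (co z). Proof. exact: std_frame st z. Qed.

Lemma iter_std_B z d l k : iter k (mB m z) (ep z d l) = ep z d (k + l).
Proof. by elim: k => //= k ->; rewrite (std_B st). Qed.

Lemma standard_dim z : r z = (\sum_(d <- degrees T) L z d)%N.
Proof. by rewrite -(frame_dim (fr z)) dimvf /dim /= mul1n. Qed.

(** In degree -1 the term [a b] has to vanish by itself; it does because a left string and a right
    string never coexist at an x-point. *)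
Lemma standard_cross : cross_eq m.
Proof.
move=> x; apply: (frame_ext (fr (xout x))) => d l.
rewrite !(add_lfunE, opp_lfunE, comp_lfunE, zero_lfunE) (std_B st) (std_b st).
have [->|d0] /= := eqVneq d (Negz 0).
  rewrite !(std_A0 st) linear0 subrr add0r natb_regular linearZ /= (std_a st).
  case: eqP => [lE|_]; last by rewrite scale0r.
  have [L0|L0] := len_side HL x; last by rewrite L0 in lE.
  by rewrite (fr_zero (fr _)) ?L0 // scaler0.
by rewrite !(std_A st) // (std_B st) subrr add0r linear0.
Qed.

Lemma standard_circ : circ_eq m.
Proof.
move=> h; split.
  apply: (frame_ext (fr (hin h))) => -[t|t] l;
  rewrite !(add_lfunE, comp_lfunE, zero_lfunE) (std_B st).
    by rewrite (std_Dp st) linearN /= (std_Cp st) addNr.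
  by rewrite (std_Dn st) linearN /= (std_Cn st) addNr.
apply: (frame_ext (fr (hout h))) => -[t|t] l;
  rewrite !(add_lfunE, comp_lfunE, zero_lfunE) (std_B st).
  by rewrite (std_Cp st) (std_Dp st) addNr.
by rewrite (std_Cn st) (std_Dn st) addNr.
Qed.

Lemma co_A x d l : d != Negz 0 -> (co (xin x) (degS d) l \o mA m x)%VF = co (xout x) d l.
Proof.
move=> d0; apply: (frame_ext (fr (xout x))) => d' l'; rewrite comp_lfunE.
have LE : L (xin x) (degS d) = L (xout x) d.
  by case: d d0 => [t|[|t]] //= _; rewrite ?(len_xin HL) ?(len_xout HL).
have [->|d0'] := eqVneq d' (Negz 0).
  by rewrite (std_A0 st) linear0 (fr_dual (fr _)) (negbTE d0).
by rewrite (std_A st) // !(fr_dual (fr _)) LE (inj_eq degS_inj).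
Qed.

Lemma co_A0 x l : (co (xin x) (Posz 0) l \o mA m x)%VF = 0.
Proof.
apply: (frame_ext (fr (xout x))) => d' l'; rewrite comp_lfunE zero_lfunE.
have [->|d0'] := eqVneq d' (Negz 0); first by rewrite (std_A0 st) linear0.
rewrite (std_A st) // (fr_dual (fr _)).
by case: d' d0' => [t|[|t]].
Qed.

(** As [b] reads the last vector of the string, a suitable power of [B] first moves the coordinate
    [l] there. *)
Lemma co_b x l u : (l < L (xout x) (Negz 0))%N ->
  co (xout x) (Negz 0) l u = mb m x (iter ((L (xout x) (Negz 0)).-1 - l) (mB m (xout x)) u).
Proof.
move=> lL; rewrite [in LHS](fr_sum (fr _) u) [in RHS](fr_sum (fr _) u).
rewrite iter_lin_sum !linear_sum; apply: eq_bigr => -[d l'] _ /=.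
rewrite iter_linZ !linearZ /= iter_std_B (std_b st) (fr_dual (fr _)) lL andbT.
rewrite [d == _]eq_sym; congr (_ *: (_%:R)); congr (nat_of_bool (_ && _)).
by apply/eqP/eqP; lia.
Qed.

Lemma co_C h t l : (l < L (hout h) (Negz t))%N ->
  (co (hin h) (Negz t) l.+1 \o mC m h)%VF = co (hout h) (Negz t) l.
Proof.
move=> lL; apply: (frame_ext (fr (hout h))) => -[t'|t'] l'; rewrite comp_lfunE.
  by rewrite (std_Cp st) !(fr_dual (fr _)).
rewrite (std_Cn st) !(fr_dual (fr _)) lL eqSS; move: lL; rewrite (len_hout HL).
by move=> lL; have -> : (l.+1 < L (hin h) (Negz t))%N by lia.
Qed.

Lemma co_D h t l : (l < L (hin h) (Posz t))%N ->
  (co (hout h) (Posz t) l.+1 \o mD m h)%VF = - co (hin h) (Posz t) l.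
Proof.
move=> lL; apply: (frame_ext (fr (hin h))) => -[t'|t'] l'; rewrite comp_lfunE opp_lfunE.
  rewrite (std_Dp st) linearN /= !(fr_dual (fr _)) lL eqSS; move: lL; rewrite (len_hin HL).
  by move=> lL; have -> : (l.+1 < L (hout h) (Posz t))%N by lia.
by rewrite (std_Dn st) linearN /= !(fr_dual (fr _)).
Qed.

Lemma co_ge z d l u : (L z d <= l)%N -> co z d l u = 0.
Proof.
move=> Ll; rewrite (fr_sum (fr z) u) linear_sum big1 // => i _.
by rewrite linearZ /= (fr_dual (fr z)) ltnNge Ll !andbF scaler0.
Qed.

Lemma memv_frame z (S : {vspace V z}) : (forall d l, ep z d l \in S) -> S = fullv.
Proof.
move=> eS; apply/eqP; rewrite eqEsubv subvf; apply/subvP => u _.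
by rewrite (fr_sum (fr z) u); apply: memv_suml => i _; apply: memvZ.
Qed.

Lemma vspace0P z (S : {vspace V z}) : (forall u, u \in S -> u = 0) -> S = 0%VS.
Proof.
by move=> S0; apply/eqP; rewrite -subv0; apply/subvP => u /S0 ->; apply: mem0v.
Qed.

Lemma img0P (U W : vectType K) (F : 'Hom(U, W)) (S : {vspace U}) u :
  (F @: S = 0)%VS -> u \in S -> F u = 0.
Proof. by move=> FS uS; apply/eqP; rewrite -memv0 -FS memv_img. Qed.

Lemma imgSP (U W : vectType K) (F : 'Hom(U, W)) (S : {vspace U}) (S' : {vspace W}) u :
  (F @: S <= S')%VS -> u \in S -> F u \in S'.
Proof. by move=> /subvP FS uS; apply/FS/memv_img. Qed.

Lemma iter_imgSP (U : vectType K) (F : 'End(U)) (S : {vspace U}) k u :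
  (F @: S <= S)%VS -> u \in S -> iter k F u \in S.
Proof. by move=> FS; elim: k u => //= k IH u /IH; apply: imgSP. Qed.

Lemma co_b0 x l u (S : {vspace V (xout x)}) : (mB m (xout x) @: S <= S)%VS ->
  (mb m x @: S = 0)%VS -> u \in S -> co (xout x) (Negz 0) l u = 0.
Proof.
move=> BS bS uS; have [Ll|lL] := leqP (L (xout x) (Negz 0)) l; first exact: co_ge.
by rewrite co_b // (img0P bS) // iter_imgSP.
Qed.

Lemma standard_S1 : cond_S1 m.
Proof.
move=> x S BS AS bS; apply: vspace0P => u uS; apply: (frame_eq0 (fr _)) => d l.
have [->|d0] := eqVneq d (Negz 0); first exact: co_b0 uS.
by rewrite -co_A // comp_lfunE (img0P AS) // linear0.
Qed.

Lemma a_mem x (S : {vspace V (xin x)}) l :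
  (mB m (xin x) @: S <= S)%VS -> (limg (ma m x) <= S)%VS ->
  ep (xin x) (Posz 0) l \in S.
Proof.
move=> BS aS; have -> : ep (xin x) (Posz 0) l = iter l (mB m (xin x)) (ma m x 1).
  by rewrite (std_a st) iter_std_B addn0.
apply: iter_imgSP => //; exact: imgSP aS (memvf _).
Qed.

Lemma standard_S2 : cond_S2 m.
Proof.
move=> x S BS; rewrite subv_add => /andP[AS aS]; apply: memv_frame => d l.
have [->|d0] := eqVneq d (Posz 0); first exact: a_mem.
have d'0 : degP d != Negz 0 by case: d d0 => [[|t]|t].
by rewrite -[d]degPK -(std_A st) //; apply: imgSP AS (memvf _).
Qed.

(** Every coordinate vanishes on [S]. In negative degrees this starts from [b] at [x_j] and runs
    left through [C] and [A]. In the others it starts from the fact that [S] at [xin] comes from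
    [A], which misses degree 0, and runs right through [D] and the surjectivity of [A] on [S]. *)
Lemma standard_stable_sub : stable_sub m.
Proof.
move=> S [BS AS CS DS] bS isoS z.
have neg : forall z t l u, u \in S z -> co z (Negz t) l u = 0.
  apply: line_ind_left => [j|h t IH|x t IH] l u uS.
  - exact: co_b0 uS.
  - have [Ll|lL] := leqP (L (hout h) (Negz t)) l; first exact: co_ge.
    by rewrite -co_C // comp_lfunE IH // (imgSP (CS h)).
  - by rewrite -(@co_A x (Negz t.+1)) // comp_lfunE IH // (imgSP (AS x)).
have surjS x v : v \in S (xin x) -> exists2 u, u \in S (xout x) & v = mA m x u.
  by have [_ <-] := isoS x => /memv_imgP [u ? ->]; exists u.
have pos : forall z t l u, u \in S z -> co z (Posz t) l u = 0.
  apply: line_ind_right => [j|h t IH|x t IH] l u uS.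
  - have [u' _ ->] := surjS _ _ uS.
    by rewrite -comp_lfunE co_A0 zero_lfunE.
  - have [Ll|lL] := leqP (L (hin h) (Posz t)) l; first exact: co_ge.
    apply: oppr_inj; rewrite -opp_lfunE -co_D // comp_lfunE IH ?oppr0 //.
    exact: (imgSP (DS h)).
  - have [u' uS' ->] := surjS _ _ uS.
    by rewrite -comp_lfunE (@co_A x (Posz t)) // IH.
apply: vspace0P => u uS; apply: (frame_eq0 (fr _)) => -[t|t] l; [exact: pos|exact: neg].
Qed.

(** Every basis vector lies in [S]: in degree -1 because [A] kills it and is injective modulo [S],
    in degree 0 at [xin] because [a] and [B] produce it, and then along the lines. *)
Lemma standard_stable_quot : stable_quot m.
Proof.
move=> S [BS AS CS DS] aS isoS z.
have injS x u : mA m x u \in S (xin x) -> u \in S (xout x).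
  by have [_ H _] := isoS x; apply: H.
have neg : forall z t l, ep z (Negz t) l \in S z.
  apply: line_ind_left => [j|h t IH|x t IH] l.
  - by apply: injS; rewrite (std_A0 st) mem0v.
  - by rewrite -[ep _ _ _]opprK -(std_Dn st) memvN (imgSP (DS h)).
  - by apply: injS; rewrite (std_A st).
have pos : forall z t l, ep z (Posz t) l \in S z.
  apply: line_ind_right => [j|h t IH|x t IH] l.
  - exact: a_mem.
  - by rewrite -(std_Cp st) (imgSP (CS h)).
  - have <- : mA m x (ep (xout x) (Posz t) l) = ep (xin x) (Posz t.+1) l.
      by rewrite (std_A st).
    by rewrite (imgSP (AS x)).
by apply: memv_frame => -[t|t] l.
Qed.

Lemma standard_stable : stable_data m.
Proof.
split; [split|exact: standard_stable_sub|exact: standard_stable_quot].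
- exact: standard_cross.
- exact: standard_S1.
- exact: standard_S2.
- exact: standard_circ.
Qed.

Lemma standard_gl g : bowGL g ->
  exists ep' co', standard L T (gl_act g m) ep' co'.
Proof.
move=> gGL; have gK z := (bij_lfunK (gGL z)).1.
have gVK z := (bij_lfunK (gGL z)).2.
exists (fun z d l => g z (ep z d l)), (fun z d l => (co z d l \o (g z)^-1)%VF).
split=> /=.
- move=> z; split.
  + by move=> d l Ll; rewrite (fr_zero (fr z)) // linear0.
  + by move=> d l d' l'; rewrite comp_lfunE gK (fr_dual (fr z)).
  + move=> u; rewrite -{1}[u]gVK {1}(fr_sum (fr z) ((g z)^-1%VF u)) linear_sum /=.
    by apply: eq_bigr => i _; rewrite linearZ comp_lfunE.
- by move=> z d l; rewrite !comp_lfunE gK (std_B st).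
- by move=> x d l d0; rewrite !comp_lfunE gK (std_A st).
- by move=> x l; rewrite !comp_lfunE gK (std_A0 st) linear0.
- by move=> h t l; rewrite !comp_lfunE gK (std_Cp st).
- by move=> h t l; rewrite !comp_lfunE gK (std_Cn st).
- by move=> h t l; rewrite !comp_lfunE gK (std_Dp st) linearN.
- by move=> h t l; rewrite !comp_lfunE gK (std_Dn st) linearN.
- by move=> x; rewrite comp_lfunE (std_a st).
- by move=> x d l; rewrite comp_lfunE gK (std_b st).
Qed.

End OneStandard.

Lemma standard_iso (m m' : bow_maps K r) ep ep' co co' :
  standard L T m ep co -> standard L T m' ep' co' -> gl_orbit m m'.
Proof.
move=> st st'.
have fr z := std_frame st z; have fr' z := std_frame st' z.
have LT z d : d \notin degrees T -> L z d = 0%N by apply: (len_bound HL).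
pose g z := sval (frame_map (fr z) (LT z) (fr_zero (fr' z))).
pose g' z := sval (frame_map (fr' z) (LT z) (fr_zero (fr z))).
have gE z d l : g z (ep z d l) = ep' z d l by apply: (svalP (frame_map (fr z) _ _)).
have g'E z d l : g' z (ep' z d l) = ep z d l by apply: (svalP (frame_map (fr' z) _ _)).
have gGL : bowGL g.
  move=> z; exists (g' z) => u.
    suff /lfunP /(_ u) : (g' z \o g z)%VF = \1%VF by rewrite comp_lfunE id_lfunE.
    by apply: (frame_ext (fr z)) => d l; rewrite comp_lfunE id_lfunE gE g'E.
  suff /lfunP /(_ u) : (g z \o g' z)%VF = \1%VF by rewrite comp_lfunE id_lfunE.
  by apply: (frame_ext (fr' z)) => d l; rewrite comp_lfunE id_lfunE g'E gE.
have gVE z d l : (g z)^-1%VF (ep' z d l) = ep z d l.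
  by rewrite -gE (bij_lfunK (gGL z)).1.
exists g => //; apply: bow_maps_ext => [z|x|x|x|h|h] /=;
  try (apply: regular_ext); try (apply: (frame_ext (fr' _)) => d l); rewrite !comp_lfunE ?gVE.
- by rewrite (std_B st) (std_B st') gE.
- have [->|d0] := eqVneq d (Negz 0).
    by rewrite (std_A0 st) (std_A0 st') linear0.
  by rewrite (std_A st) // (std_A st') // gE.
- by rewrite (std_a st) (std_a st') gE.
- by rewrite (std_b st) (std_b st').
- case: d => t; first by rewrite (std_Cp st) (std_Cp st') gE.
  by rewrite (std_Cn st) (std_Cn st') gE.
- case: d => t; first by rewrite (std_Dp st) (std_Dp st') linearN /= gE.
  by rewrite (std_Dn st) (std_Dn st') linearN /= gE.
Qed.

End StandardProperties.

(** * Torus invariance and existence of standard data *)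

Section StandardTorus.
Variables (n : nat) (w : 'I_n -> nat) (K : fieldType) (r : segment w -> nat).
Local Notation xin := (xin w).
Local Notation xout := (xout w).
Local Notation V := (bowV K r).
Variables (L : segment w -> int -> nat) (T : nat).
Hypothesis HL : string_length L T.

(** Rescaling the strings absorbs the torus: the factor is fixed at the base point by [a] or [b],
    and changes only where the line crosses [x_0]. *)
Lemma standard_torus (m : bow_maps K r) ep co s : standard L T m ep co -> torus s ->
  exists ep' co', standard L T (torus_act s m) ep' co'.
Proof.
move=> st sT.
pose p := \prod_(k < n) s k.
pose chi (x : 'I_n) := \prod_(k < n | (k < x)%N) s k.
have p0 : p != 0 by apply/prodf_neq0 => k _; apply: sT.
have chi0 x : chi x != 0 by apply/prodf_neq0 => k _; apply: sT.
pose pf (x : 'I_n) := if x == 0 :> nat then p else 1.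
pose bs (x : 'I_n) := if x == 0 :> nat then p else chi x.
have pf0 x : pf x != 0 by rewrite /pf; case: ifP => // _; apply: oner_neq0.
have bs0 x : bs x != 0 by rewrite /bs; case: ifP.
have AE x u : mA (torus_act s m) x u = pf x *: mA m x u.
  by rewrite /= /pf; case: ifP => _; rewrite ?scale1r // scale_lfunE.
have bE x u : mb (torus_act s m) x u = bs x *: mb m x u.
  by rewrite /= /bs; case: ifP => _; rewrite scale_lfunE.
have [sp [p1 pC pA]] := @line_rec_right n w (fun z t => K) (fun j => (chi j)^-1)
  (fun h t v => v) (fun x t v => pf x * v).
have [sn [n1 nC nA]] := @line_rec_left n w (fun z t => K) (fun j => (bs j)^-1)
  (fun h t v => v) (fun x t v => (pf x)^-1 * v).
have sp0 : forall z t, sp z t != 0.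
  apply: line_ind_right => [j|h t IH|x t IH]; rewrite ?p1 ?pC ?pA //.
    by rewrite invr_eq0.
  by rewrite mulf_neq0.
have sn0 : forall z t, sn z t != 0.
  apply: line_ind_left => [j|h t IH|x t IH]; rewrite ?n1 ?nC ?nA //.
    by rewrite invr_eq0.
  by rewrite mulf_neq0 // invr_eq0.
pose sg z (d : int) := match d with Posz t => sp z t | Negz t => sn z t end.
have sg0 z d : sg z d != 0 by case: d => t; [apply: sp0 | apply: sn0].
exists (fun z d l => sg z d *: ep z d l), (fun z d l => (sg z d)^-1 *: co z d l).
have fr z := std_frame st z.
split.
- move=> z; split.
  + by move=> d l Ll; rewrite (fr_zero (fr z)) // scaler0.
  + move=> d l d' l'; rewrite scale_lfunE linearZ /= (fr_dual (fr z)).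
    case: eqP => [->|_]; last by rewrite !scaler0.
    by rewrite scalerA mulVf // scale1r.
  + move=> u; rewrite {1}(fr_sum (fr z) u); apply: eq_bigr => i _.
    by rewrite scale_lfunE scalerA /GRing.scale /= mulrAC mulVf // mul1r.
- by move=> z d l; rewrite linearZ /= (std_B st).
- move=> x d l d0; rewrite AE linearZ /= (std_A st) // scalerA.
  case: d d0 => [t|[|t]] //= _; first by rewrite pA.
  by rewrite nA mulrA divff // mul1r.
- by move=> x l; rewrite AE linearZ /= (std_A0 st) !scaler0.
- by move=> h t l; rewrite linearZ /= (std_Cp st) pC.
- by move=> h t l; rewrite linearZ /= (std_Cn st) nC.
- by move=> h t l; rewrite linearZ /= (std_Dp st) scalerN pC.
- by move=> h t l; rewrite linearZ /= (std_Dn st) scalerN nC.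
- by move=> x; rewrite /= scale_lfunE (std_a st) p1.
- move=> x d l; rewrite bE linearZ /= (std_b st) scalerA.
  have [->|d0] := eqVneq d (Negz 0); last by rewrite scaler0.
  by rewrite /= n1 divff // scale1r.
Qed.

Lemma standard_exists : (forall z, r z = (\sum_(d <- degrees T) L z d)%N) ->
  exists (m : bow_maps K r) ep co, standard L T m ep co.
Proof.
move=> rE.
have LT z d : d \notin degrees T -> L z d = 0%N by apply: (len_bound HL).
have frex z : exists p : (int -> nat -> V z) * (int -> nat -> 'Hom(V z, K^o)),
    frame T (L z) p.1 p.2.
  by have [ep [co fr]] := @frame_exists K (r z) T (L z) (@LT z) (rE z); exists (ep, co).
pose ep z := (sval (cid (frex z))).1; pose co z := (sval (cid (frex z))).2.
have fr z : frame T (L z) (ep z) (co z) by apply: (svalP (cid (frex z))).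
pose mk z (W : vectType K) f H := @frame_map K (V z) T (L z) _ _ (fr z) (@LT z) W f H.
have HB z d l : (L z d <= l)%N -> ep z d l.+1 = 0.
  by move=> Ll; apply: (fr_zero (fr z)); apply: leqW.
have HA x d l : (L (xout x) d <= l)%N ->
    (if d == Negz 0 then 0 else ep (xin x) (degS d) l) = 0.
  move=> Ll; case: eqP => // /eqP d0; apply: (fr_zero (fr _)); apply: leq_trans Ll.
  by case: d d0 => [t|[|t]] //= _; rewrite ?(len_xin HL) ?(len_xout HL).
have HC h d l : (L (hout h) d <= l)%N ->
    (if d is Posz _ then ep (hin h) d l else ep (hin h) d l.+1) = 0.
  case: d => t Ll; apply: (fr_zero (fr _)).
    by rewrite (len_hin HL); lia.
  by move: Ll; rewrite (len_hout HL); lia.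
have HD h d l : (L (hin h) d <= l)%N ->
    (if d is Posz _ then - ep (hout h) d l.+1 else - ep (hout h) d l) = 0.
  case: d => t Ll; apply/eqP; rewrite oppr_eq0; apply/eqP; apply: (fr_zero (fr _)).
    by move: Ll; rewrite (len_hin HL); lia.
  by rewrite (len_hout HL); lia.
have Hb x d l : (L (xout x) d <= l)%N ->
    ((d == Negz 0) && (l.+1 == L (xout x) (Negz 0)))%:R = 0 :> K^o.
  by case: eqP => // -> Ll; case: eqP => // lE; rewrite -lE ltnn in Ll.
pose ma0 x (k : K^o) : V (xin x) := k *: ep (xin x) (Posz 0) 0%N.
have ma0lin x : linear (ma0 x).
  by move=> k u v; rewrite /ma0 scalerDl scalerA.
pose mal x := GRing.isLinear.Build K _ _ *:%R (ma0 x) (ma0lin x).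
pose ma1 x : 'Hom(K^o, V (xin x)) :=
  linfun (HB.pack (ma0 x) (mal x) : {linear K^o -> V (xin x)}).
have ma1E x k : ma1 x k = ma0 x k by rewrite /ma1 lfunE.
pose m : bow_maps K r := {|
  mB := fun z => sval (mk z _ _ (@HB z));
  mA := fun x => sval (mk (xout x) _ _ (@HA x));
  ma := ma1;
  mb := fun x => sval (mk (xout x) _ _ (@Hb x));
  mC := fun h => sval (mk (hout h) _ _ (@HC h));
  mD := fun h => sval (mk (hin h) _ _ (@HD h)) |}.
exists m, ep, co; split=> //=.
- by move=> z d l; case: (mk _ _ _ _) => F /= ->.
- by move=> x d l /negbTE d0; case: (mk _ _ _ _) => F /= ->; rewrite d0.
- by move=> x l; case: (mk _ _ _ _) => F /= ->.
- by move=> h t l; case: (mk _ _ _ _) => F /= ->.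
- by move=> h t l; case: (mk _ _ _ _) => F /= ->.
- by move=> h t l; case: (mk _ _ _ _) => F /= ->.
- by move=> h t l; case: (mk _ _ _ _) => F /= ->.
- by move=> x; rewrite ma1E /ma0 scale1r.
- by move=> x d l; case: (mk _ _ _ _) => F /= ->.
Qed.

End StandardTorus.

(** * The grading of a torus-fixed point *)

Lemma linearBZ (K : fieldType) (U W : vectType K) (F : 'Hom(U, W)) a u v :
  F (u - a *: v) = F u - a *: F v.
Proof. by rewrite linearB linearZ. Qed.

Section ShiftedProducts.
Variables (K : fieldType) (U : vectType K) (g : 'End(U)) (lam : int -> K).

Definition shift_prod (s : seq int) (u : U) : U :=
  foldr (fun d v => g v - lam d *: v) u s.

Lemma shift_prod_lin s a u v :
  shift_prod s (a *: u + v) = a *: shift_prod s u + shift_prod s v.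
Proof.
elim: s => //= d s ->.
rewrite linearP /= [lam d *: (_ + _)]scalerDr opprD addrACA scalerBr.
by rewrite !scalerA [lam d * a]mulrC.
Qed.

Lemma shift_prod0 s : shift_prod s 0 = 0.
Proof. by elim: s => //= d s ->; rewrite linear0 scaler0 subrr. Qed.

Lemma shift_prodZ s a u : shift_prod s (a *: u) = a *: shift_prod s u.
Proof. by rewrite -[a *: u]addr0 shift_prod_lin shift_prod0 addr0. Qed.

Lemma shift_prodD s u v : shift_prod s (u + v) = shift_prod s u + shift_prod s v.
Proof. by rewrite -[u]scale1r shift_prod_lin !scale1r. Qed.

Lemma shift_prodN s u : shift_prod s (- u) = - shift_prod s u.
Proof. by rewrite -scaleN1r shift_prodZ scaleN1r. Qed.

Lemma shift_prod_cat s t u : shift_prod (s ++ t) u = shift_prod s (shift_prod t u).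
Proof. exact: foldr_cat. Qed.

Lemma shift_prod_g s u : shift_prod s (g u) = g (shift_prod s u).
Proof. by elim: s => //= d s ->; rewrite linearBZ. Qed.

Lemma shift_prod_perm s t u : perm_eq s t -> shift_prod s u = shift_prod t u.
Proof.
elim: s t => [|d s IH] t; first by move=> /perm_size /esym/eqP /nilP ->.
move=> pst; have dt : d \in t by rewrite -(perm_mem pst) inE eqxx.
case/splitPr: dt pst => t1 t2; rewrite perm_sym perm_catC /= perm_cons perm_catC perm_sym.
move=> /IH E; rewrite /= E !shift_prod_cat /=.
by rewrite shift_prodD shift_prodN shift_prodZ shift_prod_g.
Qed.

Lemma shift_prod_sub s t u : uniq s -> {subset s <= t} ->
  exists v, shift_prod t u = shift_prod s v.
Proof.
elim: s t u => [|d s IH] t u; first by exists (shift_prod t u).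
move=> /= /andP[ds us] st; have dt : d \in t by apply: st; rewrite inE eqxx.
have [|v vE] := IH (rem d t) u us.
  move=> e es; have et : e \in t by apply: st; rewrite inE es orbT.
  have : e \in d :: rem d t by rewrite -(perm_mem (perm_to_rem dt)).
  by rewrite inE => /predU1P[ed|//]; rewrite -ed es in ds.
by exists v; rewrite (shift_prod_perm _ (perm_to_rem dt)) /= vE.
Qed.

Lemma shift_prod_eigen s d u : g u = lam d *: u ->
  shift_prod s u = (\prod_(e <- s) (lam d - lam e)) *: u.
Proof.
move=> gu; elim: s => [|e s IH] /=; first by rewrite big_nil scale1r.
by rewrite big_cons IH linearZ /= gu !scalerA -scalerBl mulrBl mulrC.
Qed.

Hypothesis lam_inj : injective lam.

Lemma shift_prod_neq0 s d : d \notin s -> \prod_(e <- s) (lam d - lam e) != 0.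
Proof.
move=> ds; rewrite prodf_seq_neq0; apply/allP => e es /=.
by rewrite subr_eq0 (inj_eq lam_inj); apply: contraNneq ds => ->.
Qed.

(** Applying all factors but one to [u] gives an eigenvector for the omitted one; a suitable
    multiple of it is split off and the remainder is killed by the shorter product. *)
Lemma eigen_decomposition s u : uniq s -> shift_prod s u = 0 ->
  exists f : int -> U, (forall d, g (f d) = lam d *: f d) /\ u = \sum_(d <- s) f d.
Proof.
elim: s u => [|d s IH] u /=.
  by move=> _ ->; exists (fun=> 0); rewrite big_nil; split=> // d; rewrite linear0 scaler0.
move=> /andP[ds us] /eqP; rewrite subr_eq0 => /eqP gv.
set v := shift_prod s u in gv; set k := \prod_(e <- s) (lam d - lam e).
have k0 : k != 0 by apply: shift_prod_neq0.
have [|f [fE uE]] := IH (u - k^-1 *: v) us.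
  rewrite shift_prodD shift_prodN shift_prodZ (shift_prod_eigen _ gv) -/k -/v.
  by rewrite scalerA mulVf // scale1r subrr.
exists (fun e => if e == d then k^-1 *: v else f e); split.
  move=> e; case: eqP => // ->; by rewrite linearZ /= gv !scalerA mulrC.
rewrite big_cons eqxx (eq_big_seq f); first by rewrite -uE addrC subrK.
by move=> e es; case: eqP => // ed; rewrite -ed es in ds.
Qed.

(* The images of the [shift_prod s] form a decreasing filtered family, hence
   are eventually constant. *)
Lemma shift_prod_stable s0 : uniq s0 -> exists2 s, uniq s /\ {subset s0 <= s} &
  forall t u, uniq t -> exists v, shift_prod s u = shift_prod t v.
Proof.
move=> us0.
have lin s : lin_pred (fun u => exists v, u = shift_prod s v).
  split; first by exists 0; rewrite shift_prod0.
  by move=> k _ _ [v ->] [v' ->]; exists (k *: v + v'); rewrite shift_prod_lin.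
pose I s := sval (lin_pred_vspace (lin s)).
have IP s u : u \in I s <-> exists v, u = shift_prod s v.
  exact: (svalP (lin_pred_vspace (lin s))).
have ex : exists k, `[< exists s, [/\ uniq s, {subset s0 <= s} & \dim (I s) = k] >].
  by exists (\dim (I s0)); apply/asboolP; exists s0; split.
case: (ex_minnP ex) => k /asboolP [s [us ss0 sk]] kmin.
exists s => // t u ut.
pose q := undup (s ++ t).
have Iqs : (I q <= I s)%VS.
  apply/subvP => _ /IP [v ->]; apply/IP; apply: shift_prod_sub => // e es.
  by rewrite mem_undup mem_cat es.
have : (k <= \dim (I q))%N.
  apply: kmin; apply/asboolP; exists q; split=> //; first exact: undup_uniq.
  by move=> e /ss0 es; rewrite mem_undup mem_cat es.
rewrite -sk => dle; have /eqP Iq : I q == I s by rewrite eqEdim Iqs.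
have : shift_prod s u \in I q by rewrite Iq; apply/IP; exists u.
move=> /IP [v ->]; apply: shift_prod_sub => // e et.
by rewrite mem_undup mem_cat et orbT.
Qed.

End ShiftedProducts.

(** * From a gauge element to a grading *)

Section GradingOfWeights.
Variables (n : nat) (w : 'I_n -> nat) (K : fieldType) (r : segment w -> nat).
Variable m : bow_maps K r.
Local Notation xin := (xin w).
Local Notation xout := (xout w).
Local Notation V := (bowV K r).
Variables (g : forall z : segment w, 'End(V z)) (lam : segment w -> int -> K).
Variables (pf bs : 'I_n -> K).
Hypotheses (bm : bow_data m) (ss : stable_sub m).
Hypothesis lam_inj : forall z, injective (lam z).
Hypotheses (pf0 : forall x, pf x != 0) (bs0 : forall x, bs x != 0).
Hypothesis lamA : forall x d, pf x * lam (xout x) d = lam (xin x) (degS d).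
Hypothesis lamC : forall h d, lam (hin h) d = lam (hout h) d.
Hypothesis lamb : forall x, bs x * lam (xout x) (Negz 0) = 1.
Hypothesis gB : forall z u, g z (mB m z u) = mB m z (g z u).
Hypothesis gA : forall x u, g (xin x) (mA m x u) = pf x *: mA m x (g (xout x) u).
Hypothesis gC : forall h u, g (hin h) (mC m h u) = mC m h (g (hout h) u).
Hypothesis gD : forall h u, g (hout h) (mD m h u) = mD m h (g (hin h) u).
Hypothesis ga : forall x k, g (xin x) (ma m x k) = lam (xin x) (Posz 0) *: ma m x k.
Hypothesis gb : forall x u, mb m x u = bs x *: mb m x (g (xout x) u).

Local Notation hop z := (shift_prod (g z) (lam z)).

Let cr : cross_eq m. Proof. by case: bm. Qed.

Lemma hop_B z s u : hop z s (mB m z u) = mB m z (hop z s u).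
Proof. by elim: s => //= d s ->; rewrite gB linearBZ. Qed.

Lemma hop_C h s u : hop (hin h) s (mC m h u) = mC m h (hop (hout h) s u).
Proof. by elim: s => //= d s ->; rewrite gC lamC linearBZ. Qed.

Lemma hop_D h s u : hop (hout h) s (mD m h u) = mD m h (hop (hin h) s u).
Proof. by elim: s => //= d s ->; rewrite gD -lamC linearBZ. Qed.

Lemma hop_A x s u : hop (xin x) (map degS s) (mA m x u)
  = pf x ^+ size s *: mA m x (hop (xout x) s u).
Proof.
elim: s => [|d s IH] /=; first by rewrite expr0 scale1r.
rewrite IH linearZ /= gA -lamA linearBZ exprS !scalerA scalerBr !scalerA.
by congr (_ *: _ - _ *: _); ring.
Qed.

Lemma hop_b x s u : Negz 0 \in s -> mb m x (hop (xout x) s u) = 0.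
Proof.
move=> s0; rewrite (shift_prod_perm _ _ _ (perm_to_rem s0)) /=.
set v := hop _ _ u; rewrite linearBZ.
have -> : mb m x (g (xout x) v) = (bs x)^-1 *: mb m x v.
  by rewrite (gb v) scalerA mulVf // scale1r.
have -> : (bs x)^-1 = lam (xout x) (Negz 0).
  by apply: (mulfI (bs0 x)); rewrite lamb divff.
by rewrite subrr.
Qed.

(** The vectors [P] in the images of all products form an invariant subspace; the factor of degree
    -1 puts it in the kernel of [b]. By stability it is zero, and a product with stationary image
    vanishes. *)
Lemma hop_eq0 z : exists2 s, uniq s & forall u, hop z s u = 0.
Proof.
pose P z u := forall s, uniq s -> exists v, u = hop z s v.
suff P0 : forall z u, P z u -> u = 0.
  have [s [us _] sP] := shift_prod_stable (g z) (lam z) (isT : uniq [::]).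
  by exists s => // u; apply: P0 => t ut; apply: sP.
have PL z' : lin_pred (@P z').
  split; first by move=> s _; exists 0; rewrite shift_prod0.
  move=> k u v Pu Pv s us; have [u' ->] := Pu s us; have [v' ->] := Pv s us.
  by exists (k *: u' + v'); rewrite shift_prod_lin.
apply: (stable_subP bm ss PL).
- split.
  + by move=> z' u Pu s us; have [v ->] := Pu s us; exists (mB m z' v); rewrite hop_B.
  + move=> x u Pu s us.
    have us' : uniq (map degP s) by rewrite map_inj_uniq // ; exact: (can_inj degPK).
    have [v ->] := Pu _ us'; exists ((pf x ^+ size (map degP s))^-1 *: mA m x v).
    have := hop_A (map degP s) v; rewrite (mapK degPK) shift_prodZ => ->.
    rewrite scalerA mulVf ?scale1r //.
    by rewrite expf_neq0.
  + by move=> h u Pu s us; have [v ->] := Pu s us; exists (mC m h v); rewrite hop_C.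
  + by move=> h u Pu s us; have [v ->] := Pu s us; exists (mD m h v); rewrite hop_D.
- move=> x u Pu; have [v ->] := Pu [:: Negz 0] isT.
  exact: hop_b.
- move=> x v Pv.
  (* The values of this product already lie in [P]. Shifted by one degree it contains the factor of
     degree 0, which kills [a], so (S2) shows that its values come from [A]. *)
  have [s [us s0] sP] := shift_prod_stable (g (xout x)) (lam (xout x)) (isT : uniq [:: Negz 0]).
  have {}s0 : Negz 0 \in s by apply: s0; rewrite inE.
  have us' : uniq (map degS s) by rewrite map_inj_uniq //; exact: degS_inj.
  have [y ->] := Pv _ us'.
  suff [u ->] : exists u, hop (xin x) (map degS s) y = mA m x (hop (xout x) s u).
    by exists (hop (xout x) s u) => // t ut; apply: sP.
  case: bm => _ _ S2 _.
  apply: (@cond_S2P _ _ _ _ m x (fun y => exists u, hop (xin x) (map degS s) y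
     = mA m x (hop (xout x) s u)) S2) y.
  + split; first by exists 0; rewrite !shift_prod0 linear0.
    move=> k y y' [u yu] [u' yu']; exists (k *: u + u').
    by rewrite !shift_prod_lin linearP /= yu yu'.
  + move=> y [u yu]; exists (mB m _ u).
    by rewrite !hop_B yu -cross_eqE // (hop_b _ s0) linear0 addr0.
  + move=> u; exists (pf x ^+ size s *: u); rewrite hop_A shift_prodZ linearZ //.
  + move=> k; exists 0; rewrite shift_prod0 linear0.
    have s0' : Posz 0 \in map degS s by apply/mapP; exists (Negz 0).
    rewrite (shift_prod_perm _ _ _ (perm_to_rem s0')) /=.
    by rewrite -shift_prod_g ga shift_prodZ subrr.
Qed.

Lemma hop_degrees : exists T, forall z u, hop z (degrees T) u = 0.
Proof.
have H z : exists T, forall T', (T <= T')%N -> forall u, hop z (degrees T') u = 0.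
  have [s us s0] := hop_eq0 z.
  pose F (d : int) := (match d with Posz t => t | Negz t => t end).+1.
  exists (\max_(d <- s) F d) => T' TT' u.
  have sub : {subset s <= degrees T'}.
    move=> d ds; have := leq_trans (leq_bigmax_seq (F := F) d ds isT) TT'; rewrite /F.
    by case: d ds => t _; rewrite ?mem_Posz ?mem_Negz.
  by have [v ->] := @shift_prod_sub _ _ (g z) (lam z) _ _ u us sub.
have [T TP] := choice H.
exists (\max_z T z) => z u; apply: TP; exact: leq_bigmax.
Qed.

Lemma grading_of_weights : exists hom pi T, grading m hom pi T.
Proof.
have [T hop0] := hop_degrees.
pose hom z d := lker (g z - lam z d *: \1)%VF.
have homP z d u : u \in hom z d <-> g z u = lam z d *: u.
  rewrite memv_ker add_lfunE opp_lfunE scale_lfunE id_lfunE subr_eq0.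
  by split=> [/eqP|/eqP].
have bound z d u : d \notin degrees T -> u \in hom z d -> u = 0.
  move=> dT /homP gu; have := hop0 z u; rewrite (shift_prod_eigen _ gu) => /eqP.
  by rewrite scaler_eq0 (negbTE (shift_prod_neq0 (@lam_inj z) dT)) => /eqP.
(* The projection is the Lagrange polynomial in [g] that is 1 at [lam z d] and 0 at the other
   weights of [degrees T]. *)
have piex z d : exists F : 'End(V z), forall u, F u = if d \in degrees T then
   (\prod_(e <- rem d (degrees T)) (lam z d - lam z e))^-1 *: hop z (rem d (degrees T)) u else 0.
  pose F0 (u : V z) : V z := if d \in degrees T then
   (\prod_(e <- rem d (degrees T)) (lam z d - lam z e))^-1 *: hop z (rem d (degrees T)) u else 0.
  have F0lin : linear F0.
    move=> k u v; rewrite /F0; case: ifP => _; last by rewrite scaler0 addr0.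
    by rewrite shift_prod_lin scalerDr !scalerA mulrC.
  pose Fl := GRing.isLinear.Build K (V z) (V z) *:%R F0 F0lin.
  exists (linfun (HB.pack F0 Fl : {linear V z -> V z})) => u; by rewrite lfunE.
pose pi z d := sval (cid (piex z d)).
have piE z d u := svalP (cid (piex z d)) u.
have remE d : d \in degrees T -> forall e, (e \in rem d (degrees T)) = (e != d) && (e \in degrees T).
  by move=> dT e; rewrite mem_rem_uniq ?degrees_uniq // !inE.
have pi_hom z d d' u : u \in hom z d' -> pi z d u = if d == d' then u else 0.
  move=> uh; rewrite piE; case: ifP => dT; last first.
    by case: eqP => // dd; rewrite (bound z d u) ?dT // dd.
  rewrite (shift_prod_eigen _ ((homP _ _ _).1 uh)) scalerA.
  case: eqP => [<-|/eqP dd].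
    rewrite mulVf ?scale1r //; apply: shift_prod_neq0 => //.
    by rewrite remE // eqxx.
  have [d'T|d'T] := boolP (d' \in degrees T); last by rewrite (bound z d' u) // scaler0.
  rewrite [X in _ * X](_ : _ = 0) ?mulr0 ?scale0r //.
  apply/eqP; rewrite prodf_seq_eq0; apply/hasP; exists d'; last by rewrite /= subrr.
  by rewrite remE // eq_sym dd.
have pimem z d u : pi z d u \in hom z d.
  rewrite piE; case: ifP => dT; last exact: mem0v.
  apply: memvZ; apply/homP/eqP; rewrite -subr_eq0.
  have := hop0 z u; rewrite (shift_prod_perm _ _ _ (perm_to_rem dT)) /= => ->.
  exact: eqxx.
exists hom, pi, T; split=> //.
- by move=> z d u /homP gu; apply/homP; rewrite gB gu linearZ.
- by move=> x d u /homP gu; apply/homP; rewrite gA gu linearZ /= scalerA lamA.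
- by move=> h d u /homP gu; apply/homP; rewrite gC gu linearZ /= lamC.
- by move=> h d u /homP gu; apply/homP; rewrite gD gu linearZ /= lamC.
- by move=> x k; apply/homP.
- move=> x d u d0 /homP gu; have := gb u; rewrite gu linearZ /= scalerA => /eqP.
  rewrite -subr_eq0 -{1}[mb m x u]scale1r -scalerBl scaler_eq0 => /orP[|/eqP //].
  rewrite -(lamb x) -mulrBr mulf_eq0 (negbTE (bs0 x)) /= subr_eq0 (inj_eq (@lam_inj _)).
  by rewrite eq_sym (negbTE d0).
- move=> z u; have [f [fE uE]] := eigen_decomposition (@lam_inj z) (degrees_uniq T) (hop0 z u).
  rewrite {1}uE; apply: eq_big_seq => d dT; rewrite {1}uE linear_sum /=.
  rewrite (bigD1_seq d) ?degrees_uniq //= (pi_hom _ _ d) ?eqxx; last exact/homP.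
  rewrite big1 ?addr0 // => e ed; rewrite (pi_hom _ _ e); last exact/homP.
  by rewrite eq_sym (negbTE ed).
Qed.

End GradingOfWeights.

Lemma degSE d : degS d = d + 1.
Proof. by case: d => [t|[|t]] //=; lia. Qed.

Lemma big_degrees (R : Type) (idx : R) (op : Monoid.com_law idx) T (F : int -> R) :
  \big[op/idx]_(d <- degrees T) F d
  = op (\big[op/idx]_(0 <= t < T) F (Posz t)) (\big[op/idx]_(0 <= t < T) F (Negz t)).
Proof. by rewrite big_cat !big_map /index_iota subn0. Qed.

(** * String lengths are forced by the dimensions *)

Section StringLengths.
Variables (n : nat) (w : 'I_n -> nat).
Local Notation xin := (xin w).
Local Notation xout := (xout w).
Implicit Types L : segment w -> int -> nat.

Lemma string_length_widen L T T' : (T <= T')%N -> string_length L T -> string_length L T'.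
Proof.
move=> TT' [*]; split=> // z d dT'; suff dT : d \notin degrees T by auto.
by apply: contra dT'; case: d => t; rewrite ?mem_Posz ?mem_Negz => /leq_trans; apply.
Qed.

Lemma string_sum_widen L T T' z : (T <= T')%N -> string_length L T ->
  (\sum_(d <- degrees T') L z d = \sum_(d <- degrees T) L z d)%N.
Proof.
move=> TT' HL; rewrite !big_degrees /=; congr (_ + _)%N.
  rewrite (big_cat_nat _ TT') //= [X in (_ + X)%N]big_nat [X in (_ + X)%N]big1 ?addn0 //.
  by move=> t /andP[Tt _]; apply: (len_bound HL); rewrite mem_Posz -leqNgt.
rewrite (big_cat_nat _ TT') //= [X in (_ + X)%N]big_nat [X in (_ + X)%N]big1 ?addn0 //.
by move=> t /andP[Tt _]; apply: (len_bound HL); rewrite mem_Negz -leqNgt.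
Qed.

Variable r : segment w -> nat.

(** In all other degrees [A] matches the lengths on the two sides of [x], so the dimensions differ
    by the two base lengths alone; one of these is 0 by [len_side], which makes truncated
    subtraction exact. *)
Lemma string_length_base L T x : string_length L T ->
  (forall z, r z = (\sum_(d <- degrees T) L z d)%N) ->
  L (xin x) (Posz 0) = (r (xin x) - r (xout x))%N /\
  L (xout x) (Negz 0) = (r (xout x) - r (xin x))%N.
Proof.
move=> HL rE.
have bp z : L z (Posz T) = 0%N by apply: (len_bound HL); rewrite mem_Posz ltnn.
have bn z : L z (Negz T) = 0%N by apply: (len_bound HL); rewrite mem_Negz ltnn.
have rin : r (xin x) = (L (xin x) (Posz 0) + \sum_(0 <= t < T) L (xout x) (Posz t)
   + \sum_(0 <= t < T) L (xin x) (Negz t))%N.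
  (* One extra degree, of length 0, makes room for the shift by one under [A]. *)
  rewrite rE -(@string_sum_widen L T T.+1) // big_degrees /=.
  rewrite [X in (_ + X)%N]big_nat_recr //= bn addn0 big_nat_recl //.
  by congr (_ + _ + _)%N; apply: eq_bigr => t _; rewrite (len_xin HL).
have rout : r (xout x) = (\sum_(0 <= t < T) L (xout x) (Posz t) +
   (L (xout x) (Negz 0) + \sum_(0 <= t < T) L (xin x) (Negz t)))%N.
  rewrite rE -(@string_sum_widen L T T.+1) // big_degrees /=.
  rewrite [X in (X + _)%N]big_nat_recr //= bp addn0 big_nat_recl //.
  by congr (_ + (_ + _))%N; apply: eq_bigr => t _; rewrite (len_xout HL).
by have [L0|L0] := len_side HL x; rewrite rin rout L0; lia.
Qed.

Lemma string_length_uniq L T L' T' : string_length L T -> string_length L' T' ->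
  (forall x, L (xin x) (Posz 0) = L' (xin x) (Posz 0)) ->
  (forall x, L (xout x) (Negz 0) = L' (xout x) (Negz 0)) -> L = L'.
Proof.
move=> HL HL' ep en; apply/funext => z; apply/funext => -[t|t]; move: z t.
- apply: line_ind_right => [j|h t IH|x t IH] //.
  + by rewrite (len_hin HL) (len_hin HL') IH.
  + by rewrite (len_xin HL) (len_xin HL') IH.
- apply: line_ind_left => [j|h t IH|x t IH] //.
  + by rewrite (len_hout HL) (len_hout HL') IH.
  + by rewrite (len_xout HL) (len_xout HL') IH.
Qed.

End StringLengths.

(** * Fixed orbits are the orbits of standard data *)

Section FixedPoints.
Variables (n : nat) (w : 'I_n -> nat) (K : numFieldType) (r : segment w -> nat).
Local Notation xin := (xin w).
Local Notation xout := (xout w).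
Local Notation V := (bowV K r).
Implicit Types (m : bow_maps K r) (L : segment w -> int -> nat).

Definition standard_set L T : set (bow_maps K r) :=
  [set m | exists ep co, standard L T m ep co].

Lemma standard_widen L T T' m ep co : string_length L T -> (T <= T')%N ->
  standard L T m ep co -> standard L T' m ep co.
Proof.
move=> HL TT' [fr *]; split=> // z; have [ep0 dual sumE] := fr z; split=> // u.
rewrite {1}(sumE u); apply: perm_big; apply: uniq_perm; try exact: frame_index_uniq.
move=> [d l]; rewrite !mem_frame_index.
have [lL|] := boolP (l < L z d)%N; rewrite ?andbF // !andbT.
have dT : d \in degrees T.
  by apply: contraLR lL => /(len_bound HL) ->; rewrite ltn0.
have dT' : d \in degrees T'.
  apply: contraLR lL => /(len_bound (string_length_widen TT' HL)) ->.
  by rewrite ltn0.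
by rewrite dT dT'.
Qed.

Lemma exprz2_inj : injective (fun d : int => (2 : K) ^ d).
Proof.
have H (a b : int) : a < b -> (2 : K) ^ a <> 2 ^ b.
  move=> ab e.
  have : (2 : K) ^ (b - a) = 1.
    by rewrite expfzDr ?pnatr_eq0 // -invr_expz -e divff // expfz_neq0 // pnatr_eq0.
  have : 0 < b - a by rewrite subr_gt0.
  case: (b - a) => // k k0 /eqP; rewrite -exprnP -natrX pnatr_eq1.
  by rewrite -[X in _ == X](expn0 2) eqn_exp2l //; case: k k0.
by move=> a b e; apply/eqP; case: ltgtP => // /H; rewrite e.
Qed.

Lemma fixed_grading m g : stable_data m -> bowGL g -> gl_act g m = torus_act (fun=> 2) m ->
  exists hom pi T, grading m hom pi T.
Proof.
move=> [bm ss sq] gGL gm.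
have gK z := (bij_lfunK (gGL z)).1.
(* Subtracting [tag z] turns the torus weights of [a] and [b] into the degrees 0 and -1 and gives
   [A] degree one; at [x_0] the factor 2^n makes up for the tag falling back from n - 1 to 0. *)
pose lam (z : segment w) (d : int) : K := 2 ^ (d - (tag z : nat)%:Z).
pose pf (x : 'I_n) : K := if x == 0 :> nat then 2 ^ n%:Z else 1.
pose bs (x : 'I_n) : K := if x == 0 :> nat then 2 ^ n%:Z else 2 ^ (x : nat)%:Z.
have two0 : (2 : K) != 0 by rewrite pnatr_eq0.
have prodE : \prod_(k < n) (2 : K) = 2 ^ n%:Z by rewrite prodr_const card_ord.
have chiE (x : 'I_n) : \prod_(k < n | (k < x)%N) (2 : K) = 2 ^ (x : nat)%:Z.
  by rewrite -(big_ord_widen n (fun=> 2 : K) (ltnW (ltn_ord x))) prodr_const card_ord.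
have tago (x : 'I_n) : (tag (xout x) : nat)%:Z = if x == 0 :> nat then n%:Z - 1 else (x : nat)%:Z - 1.
  have xn := ltn_ord x; rewrite /= ; case: eqP => x0; last first.
    have -> : (x + n).-1 = ((x.-1) + n)%N by lia.
    rewrite modnDr modn_small; lia.
  rewrite x0 add0n modn_small; lia.
have lam2 z : injective (lam z) by move=> a b /exprz2_inj /addIr.
have eqB := fun z => congr1 (fun m => mB m z) gm; have eqA := fun x => congr1 (fun m => mA m x) gm.
have eqa := fun x => congr1 (fun m => ma m x) gm; have eqb := fun x => congr1 (fun m => mb m x) gm.
have eqC := fun h => congr1 (fun m => mC m h) gm; have eqD := fun h => congr1 (fun m => mD m h) gm.
apply: (@grading_of_weights _ _ _ _ m g lam pf bs) => //.
- by move=> x; rewrite /pf; case: ifP => _; rewrite ?oner_neq0 // expfz_neq0.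
- by move=> x; rewrite /bs; case: ifP => _; rewrite expfz_neq0.
- move=> x d; rewrite /lam tago degSE /pf /=; case: ifP => [/eqP ->|_].
    by rewrite -expfzDr //; congr (_ ^ _); lia.
  by rewrite mul1r; congr (_ ^ _); lia.
- move=> x; rewrite /lam tago /bs; case: ifP => _; rewrite -expfzDr // -(expr0z (2 : K));
  congr (_ ^ _); lia.
- move=> z u; have /lfunP /(_ (g z u)) := eqB z.
  by rewrite /= !comp_lfunE gK.
- move=> x u; have /lfunP /(_ (g _ u)) := eqA x.
  rewrite /= !comp_lfunE gK /pf prodE => ->.
  by case: ifP => _; rewrite ?scale1r // scale_lfunE.
- by move=> h u; have /lfunP /(_ (g _ u)) := eqC h; rewrite /= !comp_lfunE gK.
- by move=> h u; have /lfunP /(_ (g _ u)) := eqD h; rewrite /= !comp_lfunE gK.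
- move=> x k; have /lfunP /(_ k) := eqa x.
  rewrite /= !comp_lfunE scale_lfunE chiE => ->; congr (_ *: _).
  by rewrite /lam /= sub0r -invr_expz.
- move=> x u; have /lfunP /(_ (g _ u)) := eqb x.
  rewrite /= !comp_lfunE gK /bs prodE chiE => ->.
  by case: ifP => _; rewrite scale_lfunE.
Qed.

Lemma gl_act1 m : gl_act (fun z => \1%VF) m = m.
Proof.
have id1 z : (\1^-1)%VF = \1%VF :> 'End(V z).
  have b1 : bijective (\1%VF : 'End(V z)) by exists id => u; rewrite id_lfunE.
  by apply/lfunP => u; rewrite -{1}[u]id_lfunE (bij_lfunK b1).1 id_lfunE.
by apply: bow_maps_ext => x /=; rewrite ?id1 ?comp_lfun1l ?comp_lfun1r.
Qed.

Lemma torus_actK (s : 'I_n -> K) m : torus s ->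
  torus_act s (torus_act (fun k => (s k)^-1) m) = m.
Proof.
move=> sT; have p0 P : \prod_(k < n | P k) s k != 0 by apply/prodf_neq0.
by apply: bow_maps_ext => x //=; rewrite ?prodfV; try case: (nat_of_ord x == 0%N);
  rewrite // scalerA ?invrK ?mulVf ?mulfV ?scale1r // p0.
Qed.

Lemma standard_fixed L T : string_length L T ->
  (forall z, r z = (\sum_(d <- degrees T) L z d)%N) -> Ms_fixed (standard_set L T).
Proof.
move=> HL rE; have [m [ep [co st]]] := standard_exists K HL rE.
have stE : gl_orbit m = standard_set L T.
  rewrite eqEsubset; split=> [_ [g gGL <-]|m' [ep' [co' st']]].
    exact: (standard_gl st gGL).
  exact: (standard_iso HL st st').
split; first by exists m => //; exact: (standard_stable HL st).
move=> s sT; rewrite eqEsubset; split=> [_ [m' [ep' [co' st']] <-]|m' [ep' [co' st']]].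
  exact: (standard_torus st' sT).
exists (torus_act (fun k => (s k)^-1) m'); last exact: torus_actK.
by apply: (standard_torus st') => k; rewrite invr_eq0; apply: sT.
Qed.

Lemma fixed_standard O : Ms_fixed O -> exists L T, [/\ string_length L T,
  forall z, r z = (\sum_(d <- degrees T) L z d)%N & O = standard_set L T].
Proof.
move=> [[m ms <-] fixO].
have m_in : gl_orbit m m.
  by exists (fun z => \1%VF); [move=> z; exists id => u; rewrite id_lfunE|exact: gl_act1].
have two : torus (fun _ : 'I_n => 2 : K) by move=> k; rewrite pnatr_eq0.
have : gl_orbit m (torus_act (fun=> 2) m) by rewrite -(fixO _ two); exists m.
move=> [g gGL gm]; have [hom [pi [T gr]]] := fixed_grading ms gGL gm.
case: (ms) => bm ss sq.
have [e [L [ge HL]]] := string_gens_exist gr bm ss sq.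
have [ep [co st]] := standard_of_grading HL gr bm ss sq (ex_intro _ e ge).
exists L, T; split=> //; first by move=> z; apply: (standard_dim st).
rewrite eqEsubset; split=> [_ [h hGL <-]|m' [ep' [co' st']]].
  exact: (standard_gl st hGL).
exact: (standard_iso HL st st').
Qed.

End FixedPoints.

(** * Strings on the universal cover *)

Definition zpos (x : int) : nat := if x is Posz m then m else 0%N.

Lemma zposP x : (x <= 0 /\ zpos x = 0%N) \/ (0 <= x /\ (zpos x : int) = x).
Proof. by case: x => m /=; [right|left]; split; lia. Qed.

Lemma zpos_le0 x : x <= 0 -> zpos x = 0%N.
Proof. by case: (zposP x) => -[]; lia. Qed.

Lemma zposB1 x : zpos (x - 1) = (zpos x).-1.
Proof. by case: (zposP x) (zposP (x - 1)) => -[? ?] [] [? ?]; lia. Qed.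

Lemma int_const (U : Type) (D : int -> U) : (forall X, D (X + 1) = D X) -> forall X, D X = D 0.
Proof.
move=> DS; case; elim=> [|m IH] //.
- by rewrite -IH -[RHS]DS; congr D; lia.
- by rewrite -[LHS]DS.
- by rewrite -IH -[LHS]DS; congr D; lia.
Qed.

Section Cover.
Variables (n' : nat).
Local Notation n := n'.+2.
Variable w : 'I_n -> nat.
Implicit Types X Y h : int.

Definition im (X : int) : 'I_n := inord `|(X %% n)%Z|%N.

Lemma val_im X : (im X : nat) = `|(X %% n)%Z|%N.
Proof. by rewrite inordK //; have := ltz_pmod X (isT : 0 < n%:Z); have := modz_ge0 X (isT : n%:Z != 0); lia. Qed.

Lemma im_eq X (i : 'I_n) (k : int) : X = (i : nat)%:Z + k * n -> im X = i.
Proof.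
move=> ->; apply: val_inj; rewrite /= val_im addrC modzMDl.
by rewrite modz_small //; have := ltn_ord i; lia.
Qed.

Lemma im_div X : X = (im X : nat)%:Z + (X %/ n)%Z * n.
Proof.
rewrite val_im {1}(divz_eq X n) addrC; congr (_ + _).
by have := modz_ge0 X (isT : n%:Z != 0); lia.
Qed.

Lemma im_ord (i : 'I_n) : im (i : nat)%:Z = i.
Proof. by apply: (@im_eq _ _ 0); rewrite mul0r addr0. Qed.

Lemma val_ordS (i : 'I_n) : (ordS i : nat)%:Z = (i : nat)%:Z + 1 - (i == ord_max)%:Z * n.
Proof.
have := ltn_ord i; rewrite /= -[i == _]/(i == n'.+1 :> nat); case: eqP => [->|ni] iN.
  by rewrite modnn; lia.
by rewrite modn_small; lia.
Qed.

Lemma imS X : im (X + 1) = ordS (im X).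
Proof.
apply: (@im_eq _ _ ((X %/ n)%Z + (im X == ord_max)%:Z)).
by rewrite val_ordS {1}(im_div X); ring.
Qed.

Lemma imB X : im (X - 1) = ord_pred (im X).
Proof. by rewrite -[X in RHS](subrK 1) imS ordSK. Qed.

Lemma im_period X : im (X + n) = im X.
Proof.
by apply: (@im_eq _ _ ((X %/ n)%Z + 1)); rewrite mulrDl mul1r addrA -im_div.
Qed.

Lemma ordS_neq (i : 'I_n) : ordS i != i.
Proof.
apply/eqP => /(congr1 (fun i : 'I_n => (i : nat)%:Z)); rewrite val_ordS.
by case: (_ == _) => /=; lia.
Qed.

Lemma ord_pred_neq (i : 'I_n) : ord_pred i != i.
Proof. by rewrite -[X in _ != X]ord_predK eq_sym ordS_neq. Qed.

(* [psum X] counts the o-points on the universal cover between [x_0] and [x_X]. *)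
Definition psum (X : int) : int :=
  match X with
  | Posz m => \sum_(0 <= k < m) (w (im k) : int)
  | Negz m => - \sum_(0 <= k < m.+1) (w (im (Negz k)) : int)
  end.

Arguments psum X : simpl never.

Lemma psumS X : psum (X + 1) = psum X + w (im X).
Proof.
rewrite /psum; case: X => [m|[|m]].
- by have -> : m%:Z + 1 = Posz m.+1 by [lia]; rewrite /= big_nat_recr.
- by rewrite /= big_nat1 big_geq // addNr.
- have -> : Negz m.+1 + 1 = Negz m by lia.
  by rewrite /= [in RHS]big_nat_recr //= opprD addrNK.
Qed.

Definition level : nat := \sum_i w i.

Lemma psum_period X : psum (X + n) = psum X + level.
Proof.
have H : psum (X + n) - psum X = level.
  have D_S (Y : int) : psum (Y + 1 + n) - psum (Y + 1) = psum (Y + n) - psum Y.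
    by rewrite (addrAC Y) !psumS im_period; ring.
  apply: etrans (int_const D_S X) _.
  have -> : psum 0 = 0 by rewrite /psum /= big_geq.
  rewrite add0r subr0 /psum big_mkord /level -[RHS]natz natr_sum.
  by apply: eq_bigr => i _; rewrite natz im_ord.
by rewrite -H [RHS]addrC subrK.
Qed.

Lemma psum_ge0 (t : nat) X : psum X <= psum (X + t).
Proof.
elim: t => [|t IH]; first by rewrite addr0.
by have -> : X + t.+1 = (X + t) + 1 by [lia]; rewrite psumS; apply: le_trans IH _; rewrite lerDl.
Qed.

Lemma psum_far a (t : nat) X : (0 < level)%N -> (a * n <= t)%N -> psum X + a%:Z <= psum (X + t).
Proof.
move=> l0; elim: a t => [|a IH] t at_; first by rewrite addr0 psum_ge0.
have -> : X + t = (X + (t - n)%N) + n by lia.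
rewrite psum_period; have := IH (t - n)%N; lia.
Qed.

Variable v : 'I_n -> int.

Definition jump (i : 'I_n) : int := v i - v (ord_pred i).

(* The line through [x_X] carries a string that ends [qpos X - psum X]
   o-points further, with a sign. *)
Definition qpos (X : int) : int := psum X + jump (im X).

Lemma qpos_period X : qpos (X + n) = qpos X + level.
Proof. by rewrite /qpos psum_period im_period addrAC. Qed.

Lemma qpos_far : (0 < level)%N -> exists M : nat, forall (t : nat) (i : 'I_n) h,
  (M <= t)%N -> psum (i : nat) <= h <= psum (i : nat) + w i ->
  qpos ((i : nat)%:Z - t%:Z) <= h /\ h <= qpos ((i : nat)%:Z + t%:Z).
Proof.
move=> l0; pose C := (\sum_i `|jump i|)%N.
have CP i : (`|jump i| <= C)%N by rewrite /C (bigD1 i) //= leq_addr.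
(* [psum] grows by at least 1 in each turn, [C] bounds the jumps and [level] the height of an arc,
   so [C + level] turns suffice. *)
exists ((C + level) * n)%N => t i h Mt /andP[h1 h2].
have wl : (w i <= level)%N by rewrite /level (bigD1 i) //= leq_addr.
have A := psum_far (i : nat)%:Z l0 Mt.
have B := psum_far ((i : nat)%:Z - t%:Z) l0 Mt; rewrite subrK in B.
have := CP (im ((i : nat)%:Z - t%:Z)); have := CP (im ((i : nat)%:Z + t%:Z)).
rewrite /qpos; lia.
Qed.

(** [h] is the height of the segment, counted in o-points on the cover. Its piece of degree [t]
    belongs to the line of [x_(i-t)] and the one of degree -(t+1) to the line of [x_(i+1+t)]; the
    length is the distance left to the end point [qpos] of that string. *)
Definition string_len (z : segment w) (d : int) : nat :=
  let i := (tag z : nat)%:Z in let h := psum i + (tagged z : nat)%:Z in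
  match d with
  | Posz t => zpos (qpos (i - t%:Z) - h)
  | Negz t => zpos (h - qpos (i + 1 + t%:Z))
  end.

Definition string_dim (T : nat) (Y h : int) : nat :=
  (\sum_(0 <= t < T) zpos (qpos (Y - t%:Z) - h)
   + \sum_(0 <= t < T) zpos (h - qpos (Y + 1 + t%:Z)))%N.

Lemma string_lenE T z : (\sum_(d <- degrees T) string_len z d)%N
  = string_dim T (tag z : nat) (psum (tag z : nat) + (tagged z : nat)%:Z).
Proof. by rewrite big_degrees. Qed.

Lemma ord_pred_cover (x : 'I_n) : exists e : bool,
  ((ord_pred x : nat)%:Z + 1 = (x : nat)%:Z + e%:Z * n)%R.
Proof.
exists (ord_pred x == ord_max); have := val_ordS (ord_pred x); rewrite ord_predK; lia.
Qed.

(** The arc before [x_0] has the tag n - 1, one turn ahead on the cover; heights and end points then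
    shift by the same amount, the level. At the other x-points the shift is 0. *)
Lemma cover_shift (x : 'I_n) : exists e : int, psum ((ord_pred x : nat)%:Z) + w (ord_pred x)
    = psum ((x : nat)%:Z) + e /\
  forall t, qpos ((ord_pred x : nat)%:Z + 1 + t) = qpos ((x : nat)%:Z + t) + e.
Proof.
have eP := psumS (ord_pred x : nat)%:Z; rewrite im_ord in eP; rewrite -eP.
have [[] ->] := ord_pred_cover x.
  exists level; rewrite mul1r psum_period; split=> // t.
  by rewrite -qpos_period; congr qpos; ring.
by exists 0; rewrite mul0r !addr0; split=> // t; rewrite addr0.
Qed.

Lemma string_len_xin (x : 'I_n) (t : nat) :
  string_len (xin w x) (Posz t) = zpos (qpos ((x : nat)%:Z - t%:Z) - psum (x : nat)) /\
  string_len (xin w x) (Negz t) = zpos (psum (x : nat) - qpos ((x : nat)%:Z + 1 + t%:Z)).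
Proof. by rewrite /string_len addr0. Qed.

Lemma string_len_xout (x : 'I_n) (t : nat) :
  string_len (xout w x) (Posz t) = zpos (qpos ((x : nat)%:Z - 1 - t%:Z) - psum (x : nat)) /\
  string_len (xout w x) (Negz t) = zpos (psum (x : nat) - qpos ((x : nat)%:Z + t%:Z)).
Proof.
rewrite /string_len -[tag (xout w x)]/(ord_pred x).
rewrite -[nat_of_ord (tagged (xout w x))]/(w (ord_pred x)).
have [e [-> eq]] := cover_shift x; split; congr zpos; last by rewrite eq; ring.
have := eq (- 1 - t%:Z); set y := _ + 1 + _.
have -> : y = (ord_pred x : nat)%:Z - t%:Z by rewrite /y; ring.
by move=> ->; rewrite addrA; ring.
Qed.

(** Positive level drives [qpos] to infinity in both directions, so all strings are empty beyond a
    common degree; [len_side] holds because the base lengths are the positive and the negative part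
    of one jump. *)
Lemma string_len_length : (0 < level)%N -> exists M, forall T, (M <= T)%N ->
  string_length string_len T.
Proof.
move=> l0; have [M far] := qpos_far l0; exists M => T MT; split.
- move=> [i k] t; rewrite /string_len /= /bump /=.
  set x := qpos _; have -> : x - (psum i + (1 + k)%N) = (x - (psum i + k)) - 1 by lia.
  exact: zposB1.
- move=> x t; rewrite (string_len_xin x _).1 (string_len_xout x _).1.
  by have -> : (x : nat)%:Z - t.+1%:Z = (x : nat)%:Z - 1 - t%:Z by lia.
- move=> [i k] t; rewrite /string_len /= /bump /=.
  set x := qpos _; have -> : (psum i + (1 + k)%N) - x = ((psum i + k) - x) + 1 by lia.
  by rewrite -zposB1 addrK.
- move=> x t; rewrite (string_len_xin x _).2 (string_len_xout x _).2.
  by have -> : (x : nat)%:Z + 1 + t%:Z = (x : nat)%:Z + t.+1%:Z by lia.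
- move=> x; rewrite (string_len_xin x 0).1 (string_len_xout x 0).2 !addr0.
  set a := qpos _; set b := psum _.
  case: (zposP (a - b)) => -[ab e]; [by left|right].
  by rewrite zpos_le0 //; lia.
- move=> [i k] [t|t] dT; rewrite /string_len /=; apply: zpos_le0; rewrite subr_le0.
    rewrite mem_Posz -leqNgt in dT.
    have [] := far t i (psum i + k) (leq_trans MT dT) => //.
    by have := ltn_ord k; lia.
  rewrite mem_Negz -leqNgt in dT.
  have [] := far t.+1 i (psum i + k) (leq_trans MT (leqW dT)).
    by have := ltn_ord k; lia.
  by have -> : (i : nat)%:Z + 1 + t%:Z = (i : nat)%:Z + t.+1%:Z by lia.
Qed.

End Cover.
Arguments psum : simpl never.

(** * Reflections of dimension vectors *)

Section Reflections.
Variables (n' : nat).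
Local Notation n := n'.+2.
Variable w : 'I_n -> nat.
Hypothesis level_gt0 : (0 < level w)%N.
Implicit Types (v : 'I_n -> int) (X Y h : int).

(** The dimension condition for existence on every segment; far terms of the sums vanish, so it is
    asked for all large cut-offs [T]. *)
Definition balanced_at v : Prop := exists M, forall T, (M <= T)%N ->
  forall (i : 'I_n) (k : nat), (k <= w i)%N ->
  (string_dim w v T (i : nat) (psum w (i : nat) + k%:Z) : int) = v i.

(** The pairing of kappa - sum v_i alpha_i with the i-th coroot, see [pairing_weight]; [reflect_dim]
    is therefore the simple reflection of that weight. *)
Definition excess v (i : 'I_n) : int :=
  (w i)%:Z - 2 * v i + v (ordS i) + v (ord_pred i).

Definition reflect_dim (i : 'I_n) v : 'I_n -> int :=
  fun j => if j == i then v i + excess v i else v j.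

Lemma string_dimE v T Y h : (string_dim w v T Y h : int) =
  \sum_(0 <= t < T) (zpos (qpos w v (Y - t%:Z) - h) : int)
  + \sum_(0 <= t < T) (zpos (h - qpos w v (Y + 1 + t%:Z)) : int).
Proof.
rewrite /string_dim PoszD -!natz !natr_sum.
by congr (_ + _); apply: eq_bigr => t _; rewrite natz.
Qed.

Lemma qposS v X : qpos w v (X + 1) - qpos w v X = excess v (im n' X).
Proof. rewrite /qpos psumS imS /jump /excess ordSK; ring. Qed.

(** The affine symmetric group acting on end points: the reflection exchanges [qpos X] and
    [qpos (X + 1)] for every [X] over [i]. *)
Lemma qpos_reflect v i X : qpos w (reflect_dim i v) X =
  if im n' X == i then qpos w v (X + 1)
  else if im n' X == ordS i then qpos w v (X - 1) else qpos w v X.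
Proof.
rewrite /qpos /jump /reflect_dim /excess.
have p1 := ord_pred_neq i.
case: eqP => [XE|/eqP Xi]; first by rewrite imS psumS ordSK XE (negbTE p1); ring.
case: (im n' X =P ordS i) => [XE|/eqP Xi'].
  have e : X = X - 1 + 1 by ring.
  have imX : im n' (X - 1) = i by rewrite imB XE ordSK.
  rewrite {1}e psumS imX XE ordSK eqxx; ring.
have -> : (ord_pred (im n' X) == i) = false.
  by apply: contra_neqF Xi' => /eqP <-; rewrite ord_predK.
by [].
Qed.

Section Telescoping.
Variables (v : 'I_n -> int) (i : 'I_n) (f : int -> int).
Local Notation q := (qpos w v).
Local Notation q' := (qpos w (reflect_dim i v)).
Local Notation at_i X e := (if im n' X == i then e else 0).

Lemma reflect_step X :
  f (q' X) - f (q X) = at_i X (f (q (X + 1)) - f (q X)) + at_i (X - 1) (f (q (X - 1)) - f (q X)).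
Proof.
rewrite qpos_reflect imB (can2_eq (@ord_predK _) (@ordSK _)).
case: eqP => [->|_]; first by rewrite eq_sym (negbTE (ordS_neq _)) addr0.
by case: eqP => _; rewrite ?add0r // subrr.
Qed.

(** Exchanges inside the range cancel; only a pair straddling one of its two ends contributes. *)
Lemma reflect_sum_down Y T :
  \sum_(0 <= t < T) (f (q' (Y - t%:Z)) - f (q (Y - t%:Z)))
  = at_i Y (f (q (Y + 1)) - f (q Y))
    + at_i (Y - T%:Z) (f (q (Y - T%:Z)) - f (q (Y - T%:Z + 1))).
Proof.
elim: T => [|T IH].
  by rewrite big_geq // subr0; case: ifP => _; ring.
rewrite big_nat_recr //= IH reflect_step.
have -> : Y - T.+1%:Z = Y - T%:Z - 1 by lia.
rewrite subrK; case: (im n' (Y - T%:Z) == i); case: (im n' Y == i);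
  case: (im n' (Y - T%:Z - 1) == i); ring.
Qed.

Lemma reflect_sum_up Y T :
  \sum_(0 <= t < T) (f (q' (Y + 1 + t%:Z)) - f (q (Y + 1 + t%:Z)))
  = at_i Y (f (q Y) - f (q (Y + 1)))
    + at_i (Y + T%:Z) (f (q (Y + T%:Z + 1)) - f (q (Y + T%:Z))).
Proof.
elim: T => [|T IH].
  by rewrite big_geq // addr0; case: ifP => _; ring.
rewrite big_nat_recr //= IH reflect_step.
have -> : Y + T.+1%:Z = Y + 1 + T%:Z by lia.
have -> : Y + 1 + T%:Z - 1 = Y + T%:Z by ring.
have -> : Y + T%:Z + 1 = Y + 1 + T%:Z by ring.
case: (im n' (Y + 1 + T%:Z) == i); case: (im n' Y == i);
  case: (im n' (Y + T%:Z) == i); ring.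
Qed.
End Telescoping.

(** The far ends contribute 0. When the arc is [i], the near ends contribute the difference of
    [f - g] at the two exchanged values, and [f x - g x = x - h] makes it [qpos (Y + 1) - qpos Y],
    the excess, whatever [h] is. *)
Lemma balanced_reflect v i : balanced_at v -> balanced_at (reflect_dim i v).
Proof.
move=> [M bal]; have [M' far] := qpos_far v level_gt0.
exists (maxn M M').+1 => T MT j k kw.
have MT1 : (M <= T)%N by lia.
have := bal T MT1 j k kw.
set Y : int := (j : nat); set h := psum w Y + k => balE.
have hY : psum w Y <= h <= psum w Y + w j by rewrite /h; lia.
pose f x : int := zpos (x - h); pose g x : int := zpos (h - x).
have f0 (t : nat) : (M' <= t)%N -> f (qpos w v (Y - t%:Z)) = 0.
  by move=> Mt; rewrite /f zpos_le0 // subr_le0; have [] := far t j h Mt hY.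
have g0 (t : nat) : (M' <= t)%N -> g (qpos w v (Y + t%:Z)) = 0.
  by move=> Mt; rewrite /g zpos_le0 // subr_le0; have [] := far t j h Mt hY.
have fg x : f x - g x = x - h.
  by rewrite /f /g; case: (zposP (x - h)) (zposP (h - x)) => -[? ?] [] [? ?]; lia.
have D := reflect_sum_down v i f Y T; have U := reflect_sum_up v i g Y T.
have fT : f (qpos w v (Y - T%:Z)) = 0 by apply: f0; lia.
have fT1 : f (qpos w v (Y - T%:Z + 1)) = 0.
  have -> : Y - T%:Z + 1 = Y - T.-1%:Z by lia.
  by apply: f0; lia.
have gT : g (qpos w v (Y + T%:Z)) = 0 by apply: g0; lia.
have gT1 : g (qpos w v (Y + T%:Z + 1)) = 0.
  have -> : Y + T%:Z + 1 = Y + T.+1%:Z by lia.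
  by apply: g0; lia.
rewrite fT fT1 subrr if_same addr0 sumrB in D.
rewrite gT gT1 subrr if_same addr0 sumrB in U.
have Q := qposS v Y; have jE : im n' Y = j by apply: im_ord.
have F1 := fg (qpos w v (Y + 1)); have F2 := fg (qpos w v Y).
rewrite string_dimE in balE; rewrite string_dimE.
rewrite jE in D U Q.
change (\sum_(0 <= t < T) f (qpos w v (Y - t%:Z))
  + \sum_(0 <= t < T) g (qpos w v (Y + 1 + t%:Z)) = v j) in balE.
change (\sum_(0 <= t < T) f (qpos w (reflect_dim i v) (Y - t%:Z))
  + \sum_(0 <= t < T) g (qpos w (reflect_dim i v) (Y + 1 + t%:Z))
  = if j == i then v i + excess v i else v j).
move: balE D U Q F1 F2.
move: (\sum_(0 <= t < T) f (qpos w v (Y - t%:Z))) => s1.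
move: (\sum_(0 <= t < T) g (qpos w v (Y + 1 + t%:Z))) => s2.
move: (\sum_(0 <= t < T) f (qpos w (reflect_dim i v) (Y - t%:Z))) => s3.
move: (\sum_(0 <= t < T) g (qpos w (reflect_dim i v) (Y + 1 + t%:Z))) => s4.
move: (f (qpos w v (Y + 1))) (f (qpos w v Y)) => f1 f2.
move: (g (qpos w v (Y + 1))) (g (qpos w v Y)) => g1 g2.
by case: eqP => [<-|_]; lia.
Qed.

Lemma balanced_ge0 v i : balanced_at v -> 0 <= v i.
Proof. by move=> [M /(_ M (leqnn M) i 0%N (leq0n _)) <-]. Qed.

Lemma qpos0 v X : (forall j, jump v j = 0) -> qpos w v X = psum w X.
Proof. by move=> j0; rewrite /qpos j0 addr0. Qed.

Lemma string_dim0 v T (i : 'I_n) (k : nat) : (forall j, jump v j = 0) -> (k <= w i)%N ->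
  string_dim w v T (i : nat) (psum w (i : nat) + k%:Z) = 0%N.
Proof.
move=> j0 kw; rewrite /string_dim !big1 // => t _; apply: zpos_le0; rewrite qpos0 //.
  have := psum_ge0 w t ((i : nat)%:Z + 1); rewrite psumS im_ord; lia.
have := psum_ge0 w t ((i : nat)%:Z - t%:Z); rewrite subrK; lia.
Qed.

Lemma balanced0 : balanced_at (fun=> 0).
Proof.
exists 0%N => T _ i k kw; by rewrite string_dim0 // => j; rewrite /jump subrr.
Qed.

(** The dimension is constant along an arc. Comparing the heights [h] and [h + 1] shows that as many
    x-points before the arc have [qpos > h] as x-points after it have [qpos <= h]. By dominance
    [qpos] is nondecreasing, so both numbers are 0; the first and the last o-point of the arc give
    the two bounds. *)
Lemma jump_dominant v i : balanced_at v -> (forall j, 0 <= excess v j) -> (0 < w i)%N ->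
  jump v i <= 0 /\ 0 <= jump v (ordS i).
Proof.
move=> [M bal] dom wi; pose Y : int := (i : nat).
have qmono X : qpos w v X <= qpos w v (X + 1) by rewrite -subr_ge0 qposS.
have qmonoD X (t : nat) : qpos w v X <= qpos w v (X + t%:Z).
  elim: t => [|t IH]; first by rewrite addr0.
  have -> : X + t.+1%:Z = X + t%:Z + 1 by lia.
  exact: le_trans IH (qmono _).
have H (k : nat) : (k < w i)%N ->
   qpos w v Y <= psum w Y + k%:Z /\ psum w Y + k%:Z < qpos w v (Y + 1).
  move=> kw; set h := _ + k%:Z.
  have E1 := bal M.+1 (leqnSn M) i k (ltnW kw).
  have E2 := bal M.+1 (leqnSn M) i k.+1 kw.
  have : (string_dim w v M.+1 Y h : int) = string_dim w v M.+1 Y (h + 1).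
    rewrite E1 -E2; congr (Posz (string_dim _ _ _ _ _)); rewrite /h /Y -addrA; congr (_ + _); lia.
  rewrite !string_dimE.
  pose down (t : nat) : int := (zpos (qpos w v (Y - t%:Z) - h))%:Z - (zpos (qpos w v (Y - t%:Z) - (h + 1)))%:Z.
  pose up (t : nat) : int := (zpos (h + 1 - qpos w v (Y + 1 + t%:Z)))%:Z - (zpos (h - qpos w v (Y + 1 + t%:Z)))%:Z.
  move=> sumE.
  have {}sumE : \sum_(0 <= t < M.+1) down t = \sum_(0 <= t < M.+1) up t.
    rewrite /down /up !sumrB; move: sumE.
    move: (\sum_(0 <= t < M.+1) (zpos (qpos w v (Y - t%:Z) - h))%:Z) => s1.
    move: (\sum_(0 <= t < M.+1) (zpos (h - qpos w v (Y + 1 + t%:Z)))%:Z) => s2.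
    move: (\sum_(0 <= t < M.+1) (zpos (qpos w v (Y - t%:Z) - (h + 1)))%:Z) => s3.
    move: (\sum_(0 <= t < M.+1) (zpos (h + 1 - qpos w v (Y + 1 + t%:Z)))%:Z) => s4.
    lia.
  have downE t : down t = (h < qpos w v (Y - t%:Z))%R%:Z.
    rewrite /down; set x := qpos _ _ _.
    by case: (zposP (x - h)) (zposP (x - (h + 1))) => -[? ?] [] [? ?]; case: ltP; lia.
  have upE t : up t = (qpos w v (Y + 1 + t%:Z) <= h)%R%:Z.
    rewrite /up; set x := qpos _ _ _.
    by case: (zposP (h - x)) (zposP (h + 1 - x)) => -[? ?] [] [? ?]; case: leP; lia.
  have down_ge0 : 0 <= \sum_(1 <= t < M.+1) down t.
    by apply: sumr_ge0 => t _; rewrite downE.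
  have up_ge0 : 0 <= \sum_(1 <= t < M.+1) up t.
    by apply: sumr_ge0 => t _; rewrite upE.
  have qY : qpos w v Y <= h.
    rewrite leNgt; apply/negP => hq.
    have up0 : \sum_(0 <= t < M.+1) up t = 0.
      apply: big1 => t _; rewrite upE leNgt.
      have -> : Y + 1 + t%:Z = Y + t.+1%:Z by lia.
      by rewrite (lt_le_trans hq (qmonoD _ _)).
    move: sumE; rewrite up0 big_ltn // downE subr0 hq; move: down_ge0.
    move: (\sum_(1 <= t < M.+1) down t) => s; lia.
  split=> //; rewrite ltNge; apply/negP => hq.
  have down0 : \sum_(0 <= t < M.+1) down t = 0.
    apply: big1 => t _; rewrite downE ltNge.
    have := qmonoD (Y - t%:Z) t; rewrite subrK => /le_trans -> //.
  move: sumE; rewrite down0 big_ltn // upE addr0 hq; move: up_ge0.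
  move: (\sum_(1 <= t < M.+1) up t) => s; lia.
have [H1 _] := H 0%N wi; have [_ H2] := H (w i).-1 (ltac:(lia)).
move: H1 H2; rewrite /qpos psumS imS im_ord; lia.
Qed.

(** Across an arc without o-points dominance makes the jumps nondecreasing. Starting at an arc with
    an o-point, the bounds of [jump_dominant] therefore travel round the circle, one backwards and
    one forwards, and all jumps are 0. Then [qpos = psum] and every string is empty. *)
Lemma balanced_dominant v : balanced_at v -> (forall j, 0 <= excess v j) -> v =1 fun=> 0.
Proof.
move=> bal dom.
have [j0 wj0] : exists j, (0 < w j)%N.
  apply: contrapT => H; move: level_gt0; rewrite /level big1 // => j _.
  by case wj : (w j) => //; case: H; exists j; rewrite wj.
have stepJ j : w j = 0%N -> jump v j <= jump v (ordS j).
  move=> wj; have := dom j; rewrite /excess /jump ordSK wj; lia.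
have jle j : jump v j <= 0.
  have A (t : nat) : jump v (im n' ((j0 : nat)%:Z - t%:Z)) <= 0.
    elim: t => [|t IH].
      by rewrite subr0 im_ord; have [] := jump_dominant bal dom wj0.
    have [w0|wt] := posnP (w (im n' ((j0 : nat)%:Z - t.+1%:Z))).
      apply: le_trans (stepJ _ w0) _; rewrite -imS.
      by have -> : (j0 : nat)%:Z - t.+1%:Z + 1 = (j0 : nat)%:Z - t%:Z by lia.
    by have [] := jump_dominant bal dom wt.
  have := A (j0 + n - j)%N; rewrite (@im_eq _ _ j (-1)) //.
  have := ltn_ord j; lia.
have jge j : 0 <= jump v j.
  have A (t : nat) : 0 <= jump v (im n' ((j0 : nat)%:Z + 1 + t%:Z)).
    elim: t => [|t IH].
      by rewrite addr0 imS im_ord; have [] := jump_dominant bal dom wj0.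
    have -> : (j0 : nat)%:Z + 1 + t.+1%:Z = (j0 : nat)%:Z + 1 + t%:Z + 1 by lia.
    rewrite imS; have [w0|wt] := posnP (w (im n' ((j0 : nat)%:Z + 1 + t%:Z))).
      exact: le_trans IH (stepJ _ w0).
    by have [] := jump_dominant bal dom wt.
  have := A (j + n - j0.+1)%N; rewrite (@im_eq _ _ j 1) //.
  have := ltn_ord j0; lia.
have j0E j : jump v j = 0 by apply/eqP; rewrite eq_le jle jge.
move=> i; case: bal => M /(_ M (leqnn M) i 0%N (leq0n _)) <-.
by rewrite string_dim0.
Qed.

End Reflections.

(** * Fixed points and the Weyl group orbit *)

Section FixedPointExistence.
Variables (K : numFieldType) (n' : nat).
Local Notation n := n'.+2.
Variables (w v : 'I_n -> nat).
Hypothesis level_gt0 : (0 < level w)%N.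
Let vz (i : 'I_n) : int := v i.
Let S := @string_len n' w vz.
Let r := balanced_dim (w := w) v.

Lemma string_len_base x : S (xin w x) (Posz 0) = (r (xin w x) - r (xout w x))%N /\
  S (xout w x) (Negz 0) = (r (xout w x) - r (xin w x))%N.
Proof.
rewrite /S (string_len_xin _ _ _ 0).1 (string_len_xout _ _ _ 0).2 !addr0.
rewrite /qpos im_ord /jump /vz /r /balanced_dim /=.
set a := psum _ _; set p := v (ord_pred x).
split.
  have -> : a + ((v x)%:Z - p%:Z) - a = (v x)%:Z - p%:Z by ring.
  by case: (zposP ((v x)%:Z - p%:Z)) => -[? ?]; lia.
have -> : a - (a + ((v x)%:Z - p%:Z)) = p%:Z - (v x)%:Z by ring.
by case: (zposP (p%:Z - (v x)%:Z)) => -[? ?]; lia.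
Qed.

(** The lengths at the base points are forced by the dimensions and determine all others, so [S] is
    the only candidate. *)
Lemma fixed_string_len O : @Ms_fixed n w K r O -> exists T,
  [/\ string_length S T, forall z, r z = (\sum_(d <- degrees T) S z d)%N &
      O = standard_set (K := K) (r := r) S T].
Proof.
move=> /fixed_standard [L [T [HL rE OE]]].
have [M HM] := string_len_length vz level_gt0.
suff LS : L = S by subst L; exists T.
apply: (string_length_uniq HL (HM M (leqnn M))) => x.
  by rewrite (string_length_base x HL rE).1; apply/esym/(string_len_base x).1.
by rewrite (string_length_base x HL rE).2; apply/esym/(string_len_base x).2.
Qed.

Lemma balanced_string_sum : balanced_at w vz <-> exists T, string_length S T /\
  forall z, r z = (\sum_(d <- degrees T) S z d)%N.
Proof.
split=> [[M bal]|[T [HS rE]]].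
  have [M' HM] := string_len_length vz level_gt0.
  exists (maxn M M'); split; first by apply: HM; apply: leq_maxr.
  move=> [i k]; have kw : (k <= w i)%N by rewrite -ltnS.
  have := bal (maxn M M') (leq_maxl _ _) i k kw.
  by rewrite -(string_lenE vz _ (existT _ i k)) => -[].
exists T => T' TT' i k kw.
have kw' : (k < (w i).+1)%N by [].
have := string_lenE vz T' (existT (fun i => 'I_(w i).+1) i (Ordinal kw')).
by rewrite /= => <-; rewrite (string_sum_widen _ TT' HS) -rE.
Qed.

(** The cut-off is immaterial: both sets are the orbit of the same datum. *)
Lemma standard_set_widen L T T' : string_length L T -> (T <= T')%N ->
  standard_set (K := K) (r := r) L T !=set0 ->
  standard_set (K := K) (r := r) L T = standard_set L T'.
Proof.
move=> HL TT' [m [ep [co st]]]; rewrite eqEsubset; split=> [m' [ep' [co' st']]|m' [ep' [co' st']]].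
  by exists ep', co'; apply: standard_widen TT' st'.
have [g gGL <-] := standard_iso (string_length_widen TT' HL) (standard_widen HL TT' st) st'.
exact: (standard_gl st gGL).
Qed.

Lemma fixed_set1 : balanced_at w vz -> exists p, @Ms_fixed n w K r = [set p].
Proof.
move=> /balanced_string_sum [T [HS rE]]; exists (standard_set S T).
rewrite eqEsubset; split=> [O /fixed_string_len [T' [HS' rE' ->]]|_ ->]; last first.
  exact: standard_fixed.
have ne L T0 : string_length L T0 -> (forall z, r z = (\sum_(d <- degrees T0) L z d)%N) ->
    standard_set (K := K) (r := r) L T0 !=set0.
  by move=> HL LE; have [m [ep [co st]]] := standard_exists K HL LE; exists m, ep, co.
rewrite /= (standard_set_widen HS (leq_maxl T T') (ne _ _ HS rE)).
by rewrite (standard_set_widen HS' (leq_maxr T T') (ne _ _ HS' rE')).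
Qed.

Lemma fixed_set0 : ~ balanced_at w vz -> @Ms_fixed n w K r = set0.
Proof.
move=> nbal; rewrite -subset0 => O /fixed_string_len [T [HS rE _]].
by apply: nbal; apply/balanced_string_sum; exists T.
Qed.

End FixedPointExistence.

(** * Weights, simple reflections and the Weyl group orbit *)

Section Weights.
Variables (K : numFieldType) (n' : nat).
Local Notation n := n'.+2.
Implicit Types (l : aff_hdual K n) (i j : 'I_n).

Lemma pairingD l l' i : pairing (l + l') i = pairing l i + pairing l' i.
Proof. by rewrite /pairing /= mxE. Qed.

Lemma pairingZ a l i : pairing (a *: l) i = a * pairing l i.
Proof. by rewrite /pairing /= mxE. Qed.

Lemma pairing0 i : pairing (0 : aff_hdual K n) i = 0.
Proof. by rewrite /pairing /= mxE. Qed.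

Lemma pairing_sum (f : 'I_n -> aff_hdual K n) i :
  pairing (\sum_j f j) i = \sum_j pairing (f j) i.
Proof.
by rewrite (big_morph (fun l => pairing l i) (fun l l' => pairingD l l' i) (pairing0 i)).
Qed.

Lemma pairing_alpha i j : pairing (alpha j : aff_hdual K n) i = aff_cartan K i j.
Proof. by rewrite /pairing /= mxE. Qed.

Lemma pairing_Lambda i j : pairing (Lambda j : aff_hdual K n) i = (i == j)%:R.
Proof. by rewrite /pairing /= mxE eqxx. Qed.

Lemma sum_cartan (f : 'I_n -> K) i :
  \sum_j f j * aff_cartan K i j = 2 * f i - f (ordS i) - f (ord_pred i).
Proof.
have pick (j0 : 'I_n) : \sum_j f j * (j == j0)%:R = f j0.
  rewrite (bigD1 j0) //= eqxx mulr1 big1 ?addr0 // => j /negbTE ->; exact: mulr0.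
rewrite /aff_cartan; under eq_bigr do rewrite !mulrBr mulrCA [i == _]eq_sym.
by rewrite !sumrB -mulr_sumr !pick.
Qed.

Variables (w : 'I_n -> nat) (c : K) (kappa : aff_hdual K n).
Hypothesis kappaE : kappa = \sum_i (w i)%:R *: Lambda i + c *: delta.
Hypothesis level_gt0 : (0 < level w)%N.

Lemma pairing_kappa i : pairing kappa i = (w i)%:R.
Proof.
rewrite kappaE pairingD pairingZ /delta !pairing_sum.
rewrite [X in _ + c * X](_ : _ = 0) ?mulr0 ?addr0; last first.
  under eq_bigr do rewrite pairing_alpha -[aff_cartan _ _ _]mul1r.
  by rewrite (sum_cartan (fun=> 1)); ring.
rewrite (bigD1 i) //= pairingZ pairing_Lambda eqxx mulr1 big1 ?addr0 // => j ji.
by rewrite pairingZ pairing_Lambda eq_sym (negbTE ji) mulr0.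
Qed.

Definition weight (v : 'I_n -> int) : aff_hdual K n :=
  kappa - \sum_i (v i)%:~R *: alpha i.

Lemma pairing_weight v i : pairing (weight v) i = (excess w v i)%:~R.
Proof.
rewrite /weight -scaleN1r pairingD pairingZ pairing_kappa pairing_sum.
under eq_bigr do rewrite pairingZ pairing_alpha.
rewrite (sum_cartan (fun j => (v j)%:~R)) /excess.
rewrite !rmorphD rmorphN rmorphM /=; ring.
Qed.

Lemma reflection_weight i v : simple_reflection i (weight v) = weight (reflect_dim w i v).
Proof.
rewrite /simple_reflection pairing_weight /weight -addrA -opprD; congr (_ - _).
rewrite (bigD1 i) //= [in RHS](bigD1 i) //= /reflect_dim eqxx addrAC -scalerDl -rmorphD.
by congr (_ + _); apply: eq_bigr => j /negbTE ->.
Qed.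

Lemma reflectionK i : involutive (@simple_reflection K n i).
Proof.
move=> l; rewrite /simple_reflection -!scaleNr !pairingD !pairingZ pairing_alpha.
have -> : aff_cartan K i i = 2.
  rewrite /aff_cartan eqxx mulr1 [i == _]eq_sym (negbTE (ordS_neq i)).
  by rewrite [i == _]eq_sym (negbTE (ord_pred_neq i)) !subr0.
rewrite -addrA -scalerDl [X in X *: _](_ : _ = 0) ?scale0r ?addr0 //; ring.
Qed.

Lemma weyl_orbit_sym l l' : weyl_orbit l l' -> weyl_orbit l' l.
Proof.
move=> [s _ <-]; exists (rev s) => //.
elim: s => //= i s IH.
by rewrite rev_cons -cats1 foldr_cat /= reflectionK.
Qed.

Lemma weyl_orbit_trans l1 l2 l3 : weyl_orbit l1 l2 -> weyl_orbit l2 l3 -> weyl_orbit l1 l3.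
Proof. by move=> [s _ <-] [t _ <-]; exists (t ++ s) => //; rewrite foldr_cat. Qed.

(** [kappa] itself corresponds to the balanced vector 0, and each reflection preserves balance. *)
Lemma weyl_orbit_balanced l : weyl_orbit kappa l ->
  exists2 v, l = weight v & balanced_at w v.
Proof.
move=> [s _ <-]; elim: s => [|i s [v /= -> bal]].
  exists (fun=> 0); last exact: balanced0.
  by rewrite /weight big1 ?subr0 // => i _; rewrite scale0r.
exists (reflect_dim w i v); first exact: reflection_weight.
exact: balanced_reflect.
Qed.

Lemma weight_dominant v : dominant (weight v) -> forall i, 0 <= excess w v i.
Proof.
move=> dom i; have [k] := dom i; rewrite pairing_weight.
by move/eqP; rewrite -[k%:R]/(k%:Z%:~R) eqr_int => /eqP ->.
Qed.

Lemma weight0 : weight (fun=> 0) = kappa.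
Proof. by rewrite /weight big1 ?subr0 // => i _; rewrite scale0r. Qed.

(** Descent on [\sum_i v i]: reflecting at a negative excess lowers it, and balance, which is
    preserved, keeps it nonnegative. The descent ends at a dominant weight, where [v] is 0. *)
Lemma balanced_weyl_orbit v : balanced_at w v -> weyl_orbit (weight v) kappa.
Proof.
have [m] := ubnP `|(\sum_i v i)%R|%N; elim: m v => // m IH v vm bal.
have v0 u : balanced_at w u -> 0 <= \sum_i u i.
  by move=> bu; apply: sumr_ge0 => i _; apply: balanced_ge0 bu.
have [dom|/existsNP [i /negP]] := pselect (forall i, 0 <= excess w v i).
  exists [::] => //=; rewrite -weight0 /weight; congr (_ - _).
  by apply: eq_bigr => i _; rewrite (balanced_dominant level_gt0 bal dom).
rewrite -ltNge => exi.
have bal' := balanced_reflect level_gt0 i bal.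
have sumE : \sum_j reflect_dim w i v j = \sum_j v j + excess w v i.
  rewrite (bigD1 i) //= [in RHS](bigD1 i) //= /reflect_dim eqxx addrAC.
  by congr (_ + _ + _); apply: eq_bigr => j /negbTE ->.
have /IH/(_ bal') : (`|(\sum_j reflect_dim w i v j)%R| < m)%N.
  move: (v0 _ bal) (v0 _ bal') vm; rewrite sumE.
  by move: (\sum_i v i) (excess w v i) exi => a b; lia.
rewrite -reflection_weight => -[s _ sE]; exists (rcons s i) => //.
by rewrite -cats1 foldr_cat.
Qed.

(** Independence of the simple roots. Equal pairings make the second differences of [u - v] vanish,
    so it is affine along the cover, and constant by periodicity; the coordinate along [delta],
    which only sees [alpha_0], makes the constant 0. *)
Lemma weight_inj u v : weight u = weight v -> u =1 v.
Proof.
move=> uv; pose d i := u i - v i.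
have d0 : d ord0 = 0.
  have := congr1 (fun l : aff_hdual K n => l.2) uv; rewrite /weight /= => /addrI /oppr_inj.
  have snd_sum (f : 'I_n -> int) : (\sum_i (f i)%:~R *: (alpha i : aff_hdual K n)).2 = (f ord0)%:~R.
    rewrite (big_morph (fun l : aff_hdual K n => l.2) (id1 := 0) (op1 := +%R)) //.
    rewrite big_ord_recl /= big1 ?addr0; first by rewrite /GRing.scale /= mulr1.
    by move=> i _; rewrite scaler0.
  by rewrite !snd_sum => /intr_inj e; rewrite /d e subrr.
have dS i : d (ordS i) - d i = d i - d (ord_pred i).
  have := congr1 (fun l => pairing l i) uv; rewrite /= !pairing_weight => /intr_inj.
  rewrite /excess /d; lia.
have step (X : int) : d (im n' (X + 1)) - d (im n' X) = d (im n' 1) - d (im n' 0).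
  apply: (int_const (D := fun X => d (im n' (X + 1)) - d (im n' X))) => Y /=.
  by rewrite !imS dS ordSK.
set e := d (im n' 1) - d (im n' 0) in step.
have lin (t : nat) : d (im n' t) = t%:Z * e.
  elim: t => [|t IH]; first by rewrite mul0r (@im_eq _ _ ord0 0).
  by have := step t; have -> : t%:Z + 1 = t.+1%:Z by [lia]; rewrite IH; lia.
have e0 : e = 0.
  have := lin n; rewrite (@im_eq _ _ ord0 1) ?mul1r // d0 => /esym/eqP.
  by rewrite mulf_eq0 => /orP[|/eqP].
move=> i; apply/eqP; rewrite -subr_eq0; apply/eqP.
by have := lin i; rewrite im_ord e0 mulr0.
Qed.

Lemma balanced_dominant_conj mu (v : 'I_n -> int) : mu = weight v ->
  (kappa = dominant_conj mu <-> balanced_at w v).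
Proof.
move=> muE; have kdom : dominant kappa by move=> i; exists (w i); apply: pairing_kappa.
have orbitP : weyl_orbit mu kappa <-> balanced_at w v.
  split=> [|bal]; last by rewrite muE; apply: balanced_weyl_orbit.
  move=> /weyl_orbit_sym /weyl_orbit_balanced [u]; rewrite muE => /weight_inj vu bal.
  by have -> : v = u by apply/funext.
rewrite -orbitP /dominant_conj; case: xgetP => [l lE [ol dl]|H]; last first.
  (* Were there no dominant conjugate, the default value [mu] would equal [kappa], which is dominant
     and conjugate to itself. *)
  split=> [k|ok]; last by case: (H kappa).
  by case: (H mu); rewrite -{2}k; split=> //; exists [::].
split=> [->//|ok].
(* Uniqueness of the dominant conjugate: the chosen one lies in the orbit of [kappa], so its vector
   [u] is balanced and dominant, hence 0. *)
have [u uE bal] := weyl_orbit_balanced (weyl_orbit_trans (weyl_orbit_sym ok) ol).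
rewrite uE in dl *; rewrite -weight0 /weight; congr (_ - _).
apply: eq_bigr => i _; congr (_%:~R *: _).
by rewrite (balanced_dominant level_gt0 bal (weight_dominant dl)).
Qed.

End Weights.

Local Open Scope complex_scope.

Theorem proposition4p1 (R : realType) (n : nat) (n_ge2 : (2 <= n)%N)
    (kappa mu : aff_hdual R[i] n) (w v : 'I_n -> nat) (c : R[i])
    (kappaE : kappa = \sum_i (w i)%:R *: Lambda i + c *: delta)
    (level_ge1 : (1 <= \sum_i w i)%N)
    (mu_le_kappa : kappa - mu = \sum_i (v i)%:R *: alpha i) :
  (kappa = dominant_conj mu ->
     exists p, Ms_weight_fixed R[i] w v = [set p]) /\
  (kappa <> dominant_conj mu ->
     Ms_weight_fixed R[i] w v = set0).
Proof.
case: n n_ge2 kappa mu w v kappaE level_ge1 mu_le_kappa => [//|[//|n']] _.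
move=> kappa mu w v kappaE level_ge1 mu_le_kappa.
have muE : mu = weight kappa (fun i => (v i)%:Z).
  by rewrite /weight; apply/eqP; rewrite eq_sym subr_eq addrC -subr_eq mu_le_kappa.
have fixP := balanced_dominant_conj kappaE level_ge1 muE.
split=> [/fixP bal|kappaN]; first exact: fixed_set1.
by apply: fixed_set0 => // /fixP.
Qed.
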